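(* Let $h=\hat h\circ\tilde h:\Sigma^c\to\mathcal R$ be a random tornado-mix tabulation hash function with $d$ derived characters, the last two from $\Psi$, and let $f$ be a selector function with query keys $Q$. If $\mu=\mu^f\le|\Psi|/2$, then the derived selected keys $\tilde h(X^{f,h})$ are linearly dependent with probability at most $$14\mu^3\left(\frac{3}{|\Psi|}\right)^2\left(\frac{3}{|\Sigma|}\right)^{d-1}+\frac{1}{2^{|\Sigma|/2}}.$$
   Context: Let $\Sigma=\{0,\dots,2^k-1\}$ and $\Psi=\{0,\dots,2^{k'}-1\}$ be alphabets identified with bit strings, $\oplus$ bitwise xor; throughout $|\Sigma|\ge2^8$; $\mathcal R=\{0,\dots,2^r-1\}$. A simple tabulation hash function on $A_1\times\cdots\times A_b$ with values in a set of bit strings $\mathcal R'$ is $g(x_1\cdots x_b)=T_1[x_1]\oplus\cdots\oplus T_b[x_b]$ with independent fully random tables $T_i:A_i\to\mathcal R'$. A random tornado-mix tabulation hash function $h:\Sigma^c\to\mathcal R$ with $d\ge2$ derived characters consists of mutually independent simple tabulation functions $\tilde h_i:\Sigma^{c+i-1}\to\Sigma$ ($i=0,\dots,d-2$), $\tilde h_i:\Sigma^{c+d-2}\to\Psi$ ($i=d-1,d$), $\hat h:\Sigma^{c+d-2}\times\Psi^2\to\mathcal R$. The derived key of $x=x_1\cdots x_c$ is $\tilde h(x)=\tilde x_1\cdots\tilde x_{c+d}$ with $\tilde x_i=x_i$ ($i\le c-1$), $\tilde x_c=x_c\oplus\tilde h_0(\tilde x_1\cdots\tilde x_{c-1})$,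 $\tilde x_i=\tilde h_{i-c}(\tilde x_1\cdots\tilde x_{i-1})$ ($c<i\le c+d-2$), $\tilde x_i=\tilde h_{i-c}(\tilde x_1\cdots\tilde x_{c+d-2})$ ($i=c+d-1,c+d$); $h(x)=\hat h(\tilde h(x))$. A selector function with query keys $Q\subseteq\Sigma^c$ is $f:\Sigma^c\times\mathcal R\times\mathcal R^Q\to\{0,1\}$ with $f(q,\cdot,\cdot)=1$ for $q\in Q$; $X^{f,h}=\{x: f(x,h(x),h|_Q)=1\}$; $p^f_x=\max_{\varphi\in\mathcal R^Q}\Pr_{r\sim\mathcal U(\mathcal R)}[f(x,r,\varphi)=1]$; $\mu^f=\sum_x p^f_x$. A set of keys is linearly dependent if some nonempty subset has, at every position, every character appearing an even number of times among its keys. *)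

(* Defs.v *)
From HB Require Import structures.
From mathcomp Require Import all_boot all_order all_algebra.
Set Implicit Arguments.
Unset Strict Implicit.
Unset Printing Implicit Defensive.
Import Order.TTheory GRing.Theory Num.Theory.
Local Open Scope ring_scope.

(* Alphabets of bit strings of length k: 'rV['F_2]_k; addition is bitwise xor.
   Sigma = bits k, Psi = bits k', R = bits r. *)
Notation bits k := 'rV['F_2]_k.

Notation key k c := (c.-tuple (bits k)).

Definition stab (k : nat) (A : zmodType) (n : nat)
  (T : {ffun 'I_n -> {ffun bits k -> A}}) (s : seq (bits k)) : A :=
  \sum_(j < n) T j (nth 0 s j).

Notation htil_tables k c d :=
  {dffun forall i : 'I_d.-1, {ffun 'I_(c + i - 1) -> {ffun bits k -> bits k}}}.

Notation psi_tables k k' c d :=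
  ({ffun 'I_(c + d - 2) -> {ffun bits k -> bits k'}} *
   {ffun 'I_(c + d - 2) -> {ffun bits k -> bits k'}})%type.

Notation hhat_tables k k' r c d :=
  ({ffun 'I_(c + d - 2) -> {ffun bits k -> bits r}} *
   ({ffun bits k' -> bits r} * {ffun bits k' -> bits r}))%type.

Notation Omega k k' r c d :=
  (htil_tables k c d * psi_tables k k' c d * hhat_tables k k' r c d)%type.

Notation dkey_t k k' c d :=
  ({ffun 'I_(c + d - 2) -> bits k} * (bits k' * bits k'))%type.

(* The first c+d-2 derived characters:
   \tilde x_i = x_i (i <= c-1), \tilde x_c = x_c xor \tilde h_0(\tilde x_1..\tilde x_{c-1}),
   \tilde x_{c+i} = \tilde h_i(\tilde x_1 .. \tilde x_{c+i-1}) for 1 <= i <= d-2. *)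
Definition dseq (k c d : nat) (H : htil_tables k c d) (x : key k c) : seq (bits k) :=
  foldl (fun s (i : 'I_d.-1) =>
           rcons s ((if val i == 0%N then nth 0 x c.-1 else 0) + stab (H i) s))
        (take c.-1 x) (enum 'I_d.-1).

Definition dkey (k k' r c d : nat) (w : Omega k k' r c d) (x : key k c)
  : dkey_t k k' c d :=
  let s := dseq w.1.1 x in
  ([ffun j : 'I_(c + d - 2) => nth 0 s j], (stab w.1.2.1 s, stab w.1.2.2 s)).

Definition hash (k k' r c d : nat) (w : Omega k k' r c d) (x : key k c) : bits r :=
  let dk := dkey w x in
  stab w.2.1 [seq dk.1 j | j <- enum 'I_(c + d - 2)] + w.2.2.1 dk.2.1 + w.2.2.2 dk.2.2.

Definition Pr (T : finType) (P : pred T) : rat :=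
  #|[set t | P t]|%:R / #|T|%:R.

Notation selector k r c Q :=
  (key k c -> bits r -> {ffun {x : key k c | x \in Q} -> bits r} -> bool).

Definition p_sel (k r c : nat) (Q : {set key k c}) (f : selector k r c Q)
  (x : key k c) : rat :=
  \big[Num.max/0]_(phi : {ffun {x : key k c | x \in Q} -> bits r})
     Pr (fun rr : bits r => f x rr phi).

Definition mu_sel (k r c : nat) (Q : {set key k c}) (f : selector k r c Q) : rat :=
  \sum_(x : key k c) p_sel f x.

Definition selected (k k' r c d : nat) (Q : {set key k c}) (f : selector k r c Q)
  (w : Omega k k' r c d) : {set key k c} :=
  [set x | f x (hash w x) [ffun q : {x : key k c | x \in Q} => hash w (val q)]].

Definition lin_dep (k k' c d : nat) (Y0 : {set dkey_t k k' c d}) : bool :=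
  [exists Y : {set dkey_t k k' c d},
    [&& Y \subset Y0, Y != set0,
        [forall j : 'I_(c + d - 2), forall a : bits k,
           ~~ odd #|[set y in Y | y.1 j == a]|],
        [forall a : bits k', ~~ odd #|[set y in Y | y.2.1 == a]|] &
        [forall a : bits k', ~~ odd #|[set y in Y | y.2.2 == a]|]]].

(* Main.v *)
Require Import Defs.
From mathcomp Require Import all_boot all_order all_algebra.
From mathcomp Require Import ring lra zify.
Set Implicit Arguments.
Unset Strict Implicit.
Unset Printing Implicit Defensive.
Import Order.TTheory GRing.Theory Num.Theory.
Local Open Scope ring_scope.

(* Idea. A dependent set of selected derived keys contains a certificate: a set Y of keys that
   is even in both Psi-characters, and a path P, z whose consecutive keys agree alternately in
   the first and in the second Psi-character, such that Y and P together are independent on the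
   Sigma-characters while adding z makes them dependent. Given the Sigma-characters, the
   coincidences along Y and P are covered by disjoint pairs, each costing 1 / |Psi|, and
   the hash values of keys that are independent modulo Q are uniform. So a certificate with l keys
   besides z costs |Psi|^(1 - l) times a product of selection probabilities, and a union bound
   yields powers of mu.

   Dependence on the Sigma-characters is bounded level by level. The last characters of a
   minimal zero set w coincide in pairs, whose differences are independent by minimality; this
   costs npair |w| / n^(|w| / 2 - 1) times the probability of dependence one level
   below, n = |Sigma|. For at most 14 keys this recursion is solved with explicit
   coefficients. For more keys, set aside the last s = 3 k - 8 keys of the sequence: either the
   rest is already dependent below, and the keys set aside contribute a free factor
   (mu / |Psi|)^s, or at most 2^s zero sets remain, each exponentially unlikely to be completed. *)

(** * Expectation over finite types *)

(** The delicate point is the exponent of mu. A certificate with l keys besides z offers only l - 1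
    factors 1 / |Psi|, so the sum over z must cost no factor mu. This is what [key_sum0] provides:
    the input characters of a zero set sum to 0, so its last key is determined by the others. When
    the whole certificate is a zero set, the hash value of z cannot be treated as independent of the
    rest, and the same determinacy replaces the missing selection probability. A zero set has at
    least four keys, hence l >= 3 and the main term mu^3 / |Psi|^2. The recursion for long circuits
    ends in a remainder without the sum condition, with one factor mu too many, but this remainder
    gains (3 / |Sigma|)^2 instead of 3 / |Sigma| per level. It is thereby at most a multiple of the
    square of the main term, which is harmless because the claim is trivial once its bound reaches
    1. *)

Section WithField.
Variable Rt : realFieldType.

Definition Ex (T : finType) (f : T -> Rt) : Rt := (\sum_t f t) / #|T|%:R.

Lemma Ex_le (T : finType) (f g : T -> Rt) :
  (forall t, f t <= g t) -> Ex f <= Ex g.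
Proof. by move=> h; rewrite ler_wpM2r ?invr_ge0 ?ler0n// ler_sum. Qed.

Lemma eq_Ex (T : finType) (f g : T -> Rt) : f =1 g -> Ex f = Ex g.
Proof. by move=> h; rewrite /Ex (eq_bigr _ (fun t _ => h t)). Qed.

Lemma Ex_ge0 (T : finType) (f : T -> Rt) : (forall t, 0 <= f t) -> 0 <= Ex f.
Proof. by move=> h; rewrite mulr_ge0 ?invr_ge0 ?ler0n// sumr_ge0. Qed.

Lemma ExZ (T : finType) a (f : T -> Rt) : Ex (fun t => a * f t) = a * Ex f.
Proof. by rewrite /Ex -mulr_sumr mulrA. Qed.

Lemma ExZr (T : finType) a (f : T -> Rt) : Ex (fun t => f t * a) = Ex f * a.
Proof. by rewrite /Ex -mulr_suml mulrAC. Qed.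

Lemma ExD (T : finType) (f g : T -> Rt) : Ex (fun t => f t + g t) = Ex f + Ex g.
Proof. by rewrite /Ex big_split mulrDl. Qed.

Lemma Ex_sum (T : finType) I (r : seq I) (P : pred I) (F : I -> T -> Rt) :
  Ex (fun t => \sum_(i <- r | P i) F i t) = \sum_(i <- r | P i) Ex (F i).
Proof. by rewrite /Ex exchange_big mulr_suml. Qed.

(** The sign condition covers an empty [T], where the expectation is 0 by the convention for
    division by 0. *)
Lemma Ex_le_const (T : finType) (f : T -> Rt) a :
  0 <= a -> (forall t, f t <= a) -> Ex f <= a.
Proof.
move=> a0 h; rewrite /Ex; have [T0|] := posnP #|T|.
  by rewrite T0 invr0 mulr0.
move=> T0; rewrite ler_pdivrMr ?ltr0n// mulr_natr -sumr_const.
by rewrite ler_sum.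
Qed.

Lemma Ex_pair (T1 T2 : finType) (f : T1 * T2 -> Rt) :
  Ex f = Ex (fun a => Ex (fun b => f (a, b))).
Proof.
rewrite /Ex card_prod natrM invfM mulrA mulrAC.
rewrite -mulr_suml; congr (_ / _ / _).
by rewrite pair_bigA; apply: eq_bigr => -[].
Qed.

(** Each [sh u] permutes the finite type [T], so averaging over [u] changes nothing; [u0] keeps the
    number of shifts nonzero. *)
Lemma Ex_shift (T U : finType) (sh : U -> T -> T) (f : T -> Rt) (u0 : U) :
  (forall u, injective (sh u)) ->
  Ex f = Ex (fun t => Ex (fun u => f (sh u t))).
Proof.
move=> inj; rewrite /Ex -mulr_suml exchange_big /=.
rewrite [in RHS](eq_bigr (fun=> \sum_t f t)) => [|u _]; last first.
  by rewrite [RHS](reindex_inj (inj u)).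
rewrite sumr_const -(mulr_natr (\sum_t f t)).
rewrite mulfK// pnatr_eq0 -lt0n.
by apply/card_gt0P; exists u0.
Qed.

Definition dfupd (I : finType) (T : I -> finType) (i : I)
  (H : {dffun forall j, T j}) (X : T i) : {dffun forall j, T j} :=
  finfun (dfwith H X : forall j, T j).

#[global] Arguments dfupd {I T i} H X.

(** Exchanging coordinate [i] with a fresh copy is an involution, hence preserves the uniform
    measure. In this way one table is exposed while all others stay fixed. *)
Lemma Ex_resample (I : finType) (T : I -> finType) (i : I)
  (f : {dffun forall j, T j} -> Rt) :
  Ex f = Ex (fun H => Ex (fun X => f (dfupd (i := i) H X))).
Proof.
have sX (H : {dffun forall j, T j}) X : dfupd H X i = X by rewrite ffunE dfwith_in.
have oX (H : {dffun forall j, T j}) (X : T i) j : i != j -> dfupd H X j = H j.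
  by move=> h; rewrite ffunE dfwith_out.
pose h (q : {dffun forall j, T j} * T i) : {dffun forall j, T j} * T i :=
  (dfupd q.1 q.2, q.1 i).
have hK : involutive h.
  move=> [H X]; rewrite /h /= sX (_ : dfupd _ _ = H)//; apply/ffunP => j.
  have [<-|ij] := eqVneq i j; first by rewrite sX.
  by rewrite !oX.
transitivity (Ex (fun q => f (h q).1)); last by rewrite Ex_pair.
have -> : Ex (fun q => f (h q).1) = Ex (fun q : {dffun forall j, T j} * T i => f q.1).
  by rewrite /Ex [in RHS](reindex_inj (inv_inj hK)).
rewrite Ex_pair; apply: eq_Ex => H /=.
rewrite /Ex sumr_const -(mulr_natr (f H)) mulfK// pnatr_eq0 -lt0n.
by apply/card_gt0P; exists (H i).
Qed.

Lemma Ex_const (T : finType) (a : Rt) (t0 : T) : Ex (fun _ : T => a) = a.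
Proof.
rewrite /Ex sumr_const -(mulr_natr a) mulfK// pnatr_eq0 -lt0n.
by apply/card_gt0P; exists t0.
Qed.

Lemma Ex_bij (T U : finType) (f : T -> U) (F : U -> Rt) :
  bijective f -> Ex (fun t => F (f t)) = Ex F.
Proof.
move=> bf; rewrite /Ex (bij_eq_card bf) [in RHS](reindex f)//.
by apply: onW_bij.
Qed.

End WithField.

Lemma PrE (R : realFieldType) (T : finType) (P : pred T) :
  #|[set t | P t]|%:R / #|T|%:R = Ex (fun t => (P t)%:R : R).
Proof.
rewrite /Ex cardsE -sum1_card natr_sum big_mkcond /=.
by congr (_ / _); apply: eq_bigr => t _; rewrite unfold_in; case: (P t).
Qed.

(** * Uniformity of simple tabulation on independent keys *)

Section WithField.
Variable Rt : realFieldType.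
Local Notation Ex := (@Ex Rt _).

(** Averaging over the shifts moves [val] through all its values without touching [inv], so [val] is
    uniform even conditionally on [inv]. Used with a trivial [inv] for plain uniformity, and with
    the query hashes as [inv]. *)
Lemma Ex_section (T I : finType) (A : zmodType) (U : finType)
  (tou : U -> A) (ofu : A -> U) (val : T -> U) (inv : T -> I) (sh : U -> T -> T)
  (F : I -> U -> Rt) (u0 : U) :
  cancel tou ofu -> cancel ofu tou ->
  (forall u, injective (sh u)) ->
  (forall u t, tou (val (sh u t)) = tou (val t) + tou u) ->
  (forall u t, inv (sh u t) = inv t) ->
  Ex (fun t => F (inv t) (val t)) = Ex (fun t => Ex (fun u => F (inv t) u)).
Proof.
move=> tK oK inj hv hi; rewrite (Ex_shift _ u0 inj); apply: eq_Ex => t.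
pose g u := ofu (tou (val t) + tou u).
have gi : injective g.
  by move=> u v /(can_inj oK) /addrI /(can_inj tK).
rewrite /Ex [in RHS](reindex_inj gi); congr (_ / _); apply: eq_bigr => u _.
by rewrite hi /g -hv tK.
Qed.

Lemma F2_natr_eq0 (n : nat) : (n%:R == 0 :> 'F_2) = ~~ odd n.
Proof.
by rewrite -dvdn2 (dvdn_pcharf (pchar_Fp (isT : prime 2))).
Qed.

Lemma F2_cases (x : 'F_2) : x = (x != 0)%:R.
Proof.
by apply/val_inj; case: x => -[|[|m]] //.
Qed.

(** The rows of [G] stay independent in the quotient by the row space of [R], onto which [cokermx]
    projects; the columns of [K] are dual functionals pulled back from there. *)
Lemma dual_family (F : fieldType) (t q N : nat) (G : 'M[F]_(t, N)) (R : 'M[F]_(q, N)) :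
  (forall u : 'rV_t, (u *m G <= R)%MS -> u = 0) ->
  exists K : 'M_(N, t), G *m K = 1%:M /\ R *m K = 0.
Proof.
move=> h.
have fr : row_free (G *m cokermx R).
  rewrite -kermx_eq0; apply/eqP/row_matrixP => i; rewrite row0; apply: h.
  by rewrite submxE -mulmxA -row_mul mulmx_ker row0.
have /row_freeP [K0 hK] := fr.
exists (cokermx R *m K0); split; first by rewrite mulmxA.
by rewrite mulmxA mulmx_coker mul0mx.
Qed.

Definition indicator (D : finType) (P : pred D) : 'rV['F_2]_#|D| :=
  \row_j (P (enum_val j))%:R.

(* Incidence vector over F_2 of the position characters: the keys of a zero set are those whose
   vectors sum to 0. *)
Definition char_vec (k N : nat) (s : seq (bits k)) : 'rV['F_2]_#|{: 'I_N * bits k}| :=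
  indicator (fun p : 'I_N * bits k => nth 0 s p.1 == p.2).

(** A section of evaluation: when the columns of [K] are dual to chosen sums of keys, adding this
    table to a random one moves the i-th sum by exactly [u i]. *)
Definition stab_sec (k N r t : nat) (K : 'M['F_2]_(#|{: 'I_N * bits k}|, t))
  (u : {ffun 'I_t -> bits r}) : {ffun 'I_N -> {ffun bits k -> bits r}} :=
  [ffun j => [ffun a => \sum_x K (enum_rank (j, a)) x *: u x]].

Lemma stab_secE (k N r t : nat) (K : 'M['F_2]_(#|{: 'I_N * bits k}|, t))
  (u : {ffun 'I_t -> bits r}) (s : seq (bits k)) :
  stab (stab_sec K u) s = \sum_x (char_vec N s *m K) 0 x *: u x.
Proof.
rewrite /stab.
under eq_bigr do rewrite !ffunE.
rewrite exchange_big; apply: eq_bigr => x _ /=.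
rewrite -scaler_suml; congr (_ *: _); rewrite mxE.
rewrite (reindex (@enum_rank {: 'I_N * bits k})) /=; last first.
  by exists enum_val => ? _; rewrite (enum_rankK, enum_valK).
under [RHS]eq_bigr do rewrite mxE enum_rankK.
rewrite (eq_bigr (fun p : 'I_N * bits k =>
  (nth 0 s p.1 == p.2)%:R * K (enum_rank (p.1, p.2)) x)) => [|[]//].
rewrite -(pair_bigA _ (fun (i : 'I_N) a => (nth 0 s i == a)%:R * K (enum_rank (i, a)) x)) /=.
apply: eq_bigr => j _; rewrite (bigD1 (nth 0 s j)) //= eqxx mul1r.
rewrite big1 ?addr0// => a; rewrite eq_sym => /negPf ->; by rewrite mul0r.
Qed.

Lemma stabD (k n : nat) (A : zmodType) (T T' : {ffun 'I_n -> {ffun bits k -> A}})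
  (s : seq (bits k)) : stab (T + T') s = stab T s + stab T' s.
Proof. by rewrite /stab -big_split; apply: eq_bigr => j _; rewrite !ffunE. Qed.

Lemma sum_scale_kv (k N r t : nat) (K : 'M['F_2]_(#|{: 'I_N * bits k}|, t))
  (u : {ffun 'I_t -> bits r}) (l : seq (seq (bits k))) :
  \sum_(s <- l) stab (stab_sec K u) s
   = \sum_x ((\sum_(s <- l) char_vec N s) *m K) 0 x *: u x.
Proof.
under eq_bigr do rewrite stab_secE.
rewrite exchange_big; apply: eq_bigr => x _ /=; rewrite -scaler_suml.
by rewrite mulmx_suml summxE.
Qed.

(** [G i] lists the keys whose values are added: two keys to express a coincidence, a single one for
    its own value. *)
Lemma stab_uniform (k N r t : nat) (G : 'I_t -> seq (seq (bits k)))
  (S : pred {ffun 'I_t -> bits r}) :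
  (forall u : 'rV['F_2]_t,
     \sum_i u 0 i *: (\sum_(s <- G i) char_vec N s) = 0 -> u = 0) ->
  Ex (fun T : {ffun 'I_N -> {ffun bits k -> bits r}} =>
        (S [ffun i => \sum_(s <- G i) stab T s])%:R)
  = Ex (fun u => (S u)%:R).
Proof.
move=> h.
pose M : 'M_(t, _) := \matrix_i \sum_(s <- G i) char_vec N s.
have rowM (u : 'rV_t) : u *m M = \sum_i u 0 i *: (\sum_(s <- G i) char_vec N s).
  by rewrite mulmx_sum_row; apply: eq_bigr => i _; rewrite rowK.
have [K [MK _]] : exists K, M *m K = 1%:M /\ (0 : 'M_(0, _)) *m K = 0.
  by apply: dual_family => u; rewrite rowM => /submx0null /h.
have dl i j : ((\sum_(s <- G i) char_vec N s) *m K) 0 j = (i == j)%:R.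
  by rewrite -(rowK (fun i => \sum_(s <- G i) char_vec N s)) -row_mul MK rowE mulmx1 mxE eqxx eq_sym.
pose TT := {ffun 'I_N -> {ffun bits k -> bits r}}.
pose U := {ffun 'I_t -> bits r}.
rewrite (@Ex_section TT unit U U id id
   (fun T : TT => [ffun i => \sum_(s <- G i) stab T s]) (fun=> tt)
   (fun (u : U) (T : TT) => T + stab_sec K u) (fun _ u => (S u)%:R) 0) //.
- by rewrite (Ex_const _ (0 : TT)).
- by move=> u; apply: addIr.
move=> u T; apply/ffunP => i; rewrite !ffunE.
under eq_bigr do rewrite stabD.
rewrite big_split sum_scale_kv /=; congr (_ + _).
rewrite (bigD1 i)//= dl eqxx scale1r big1 ?addr0// => j ji.
by rewrite dl eq_sym (negPf ji) scale0r.
Qed.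

End WithField.

Section WithField.
Variable Rt : realFieldType.
Local Notation Ex := (@Ex Rt _).

(* All perfect matchings of [s]; [f] is fuel, at least [size s]. *)
Fixpoint pairings (T : eqType) (f : nat) (s : seq T) : seq (seq (T * T)) :=
  match f, s with
  | _, [::] => [:: [::]]
  | f'.+1, x :: s' =>
      flatten [seq [seq (x, y) :: M | M <- pairings f' (rem y s')] | y <- s']
  | 0, _ => [::]
  end.

(* The number of perfect matchings of [a] points. *)
Fixpoint npair (a : nat) : nat :=
  match a with 0 => 1 | 1 => 0 | a'.+2 => (a'.+1 * npair a')%N end.

Definition unpair (T : Type) (M : seq (T * T)) : seq T :=
  flatten [seq [:: p.1; p.2] | p <- M].

Lemma size_unpair (T : Type) (M : seq (T * T)) : size (unpair M) = (size M).*2.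
Proof. by elim: M => //= p M IH; rewrite doubleS -IH. Qed.

Lemma size_pairings (T : eqType) f (s : seq T) :
  (size s <= f)%N -> size (pairings f s) = npair (size s).
Proof.
elim: f s => [|f IH] [|x s] //= hs; rewrite size_flatten /shape sumnE !big_map.
rewrite (eq_big_seq (fun=> npair (size s).-1)) => [|y ys]; last first.
  by rewrite size_map IH size_rem// (leq_trans (leq_pred _)).
by rewrite big_const_seq iter_addn_0 count_predT mulnC; case: (size s).
Qed.

(** The value of the first key recurs because its class is even, and removing both keys keeps all
    classes even. *)
Lemma pairings_even (T A : eqType) (v : T -> A) f (s : seq T) :
  (size s <= f)%N -> (forall a, ~~ odd (count (fun x => v x == a) s)) ->
  exists2 M, M \in pairings f s & all (fun p => v p.1 == v p.2) M.
Proof.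
elim: f s => [|f IH] [|x s] //= hs ev; try by exists [::]; rewrite ?inE.
have : has (fun y => v y == v x) s.
  by have := ev (v x); rewrite eqxx oddD /= negbK has_count; case: count.
move=> /hasP [y ys /eqP yx].
have := perm_to_rem ys => /permP ps.
have [||M MM vM] := IH (rem y s).
- by rewrite size_rem// (leq_trans (leq_pred _)).
- move=> a; have := ev a; rewrite (ps (fun x => v x == a)) /= yx addnA addnn.
  by rewrite oddD odd_double.
exists ((x, y) :: M); last by rewrite /= yx eqxx.
by apply/flattenP; exists [seq (x, y) :: M | M <- pairings f (rem y s)]; apply/mapP; [exists y|exists M].
Qed.

Lemma pairings_perm (T : eqType) f (s : seq T) M :
  M \in pairings f s -> perm_eq (unpair M) s.
Proof.
elim: f s M => [|f IH] [|x s] M //=; try by rewrite inE => /eqP ->.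
move=> /flattenP [l /mapP [y ys ->]] /mapP [M' /IH pM' ->] /=.
rewrite /unpair /= perm_cons (perm_trans _ (_ : perm_eq (y :: rem y s) s))//.
  by rewrite perm_cons.
by rewrite perm_sym perm_to_rem.
Qed.

Lemma stab_pairs (k N r t : nat) (G : 'I_t -> seq (seq (bits k))) (c : 'I_t -> bits r) :
  (forall u : 'rV['F_2]_t,
     \sum_i u 0 i *: (\sum_(s <- G i) char_vec N s) = 0 -> u = 0) ->
  Ex (fun T : {ffun 'I_N -> {ffun bits k -> bits r}} =>
        [forall i, \sum_(s <- G i) stab T s == c i]%:R)
  = (#|bits r|%:R ^+ t)^-1.
Proof.
move=> h; have := @stab_uniform Rt k N r t G (pred1 (finfun c)) h => /=.
have -> : Ex (fun u : {ffun 'I_t -> bits r} => (u == finfun c)%:R) = (#|bits r|%:R ^+ t)^-1.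
  rewrite -PrE card_ffun card_ord natrX (_ : [set t0 | _] = [set finfun c]) ?cards1 ?mul1r//.
  by apply/setP => u; rewrite !inE.
move=> <-; apply: eq_Ex => T; congr (nat_of_bool _)%:R.
apply/forallP/eqP => [e|/ffunP e i]; first by apply/ffunP => i; rewrite !ffunE; apply/eqP.
by have := e i; rewrite !ffunE => ->.
Qed.

End WithField.

(** * Zero sets of key sequences *)

Lemma addrr2 (k : nat) (x : bits k) : x + x = 0.
Proof. by apply/matrixP => i j; rewrite !mxE (addrr_pchar2 (pchar_Fp (isT : prime 2))). Qed.

Lemma sum_F2_scale (k : nat) (I : finType) (u : I -> 'F_2) (F : I -> bits k) :
  \sum_i u i *: F i = \sum_(i | u i != 0) F i.
Proof.
rewrite [RHS]big_mkcond /=; apply: eq_bigr => i _.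
by rewrite {1}(F2_cases (u i)); case: ifP; rewrite ?scale1r ?scale0r.
Qed.

Section ZeroSets.
Variables (k : nat) (X : finType).
Implicit Types (sq : X -> seq (bits k)) (w V : {set X}) (j : nat).

Definition even_values (A : finType) (v : X -> A) w : bool :=
  [forall a, ~~ odd #|[set x in w | v x == a]|].

Definition zero_set sq j w : bool := [forall p : 'I_j, even_values (fun x => nth 0 (sq x) p) w].

Definition dep sq j V : bool :=
  [exists w : {set X}, [&& w \subset V, w != set0 & zero_set sq j w]].

Definition circuit (P : pred {set X}) w : bool :=
  [&& w != set0, P w & [forall w' : {set X}, (w' \proper w) && P w' ==> (w' == set0)]].

Lemma zero_setP sq j w : reflect (\sum_(x in w) char_vec j (sq x) = 0) (zero_set sq j w).
Proof.
have E (p : 'I_j) a : (\sum_(x in w) char_vec j (sq x)) 0 (enum_rank (p, a))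
   = (#|[set x in w | nth 0 (sq x) p == a]|)%:R.
  rewrite summxE -sum1_card natr_sum (eq_bigl _ _ (fun x => in_set _ x)) /=.
  rewrite [RHS]big_mkcondr /=; apply: eq_bigr => x _.
  by rewrite !mxE enum_rankK /=; case: eqP.
apply: (iffP forallP) => [h|h p].
  apply/rowP => i; rewrite -(enum_valK i); case: (enum_val i) => p a.
  by rewrite E mxE; apply/eqP; rewrite F2_natr_eq0; apply: (forallP (h p)).
by apply/forallP => a; rewrite -F2_natr_eq0 -E h mxE.
Qed.

(** Addition of indicator vectors over F_2, under which the zero sets form a subspace. *)
Definition sym_diff w w' := (w :\: w') :|: (w' :\: w).

Lemma sum_sym_diff (r : nat) (F : X -> bits r) w w' :
  \sum_(x in sym_diff w w') F x = \sum_(x in w) F x + \sum_(x in w') F x.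
Proof.
rewrite (big_setID w' (A := w)) /= (big_setID w (A := w')) /= [w' :&: w]setIC.
rewrite addrACA addrr2 add0r (big_setID w (A := sym_diff w w')) /=.
by congr (_ + _); apply: eq_bigl => x; rewrite !inE; case: (x \in w); case: (x \in w').
Qed.

Lemma zero_set_sym_diff sq j w w' : zero_set sq j w -> zero_set sq j w' -> zero_set sq j (sym_diff w w').
Proof. by move=> /zero_setP h /zero_setP h'; apply/zero_setP; rewrite sum_sym_diff h h' addr0. Qed.

Lemma sym_diff_eq0 w w' : (sym_diff w w' == set0) = (w == w').
Proof. by rewrite setU_eq0 !setD_eq0 eqEsubset. Qed.

Lemma zero_setW sq j j' w : (j' <= j)%N -> zero_set sq j w -> zero_set sq j' w.
Proof. by move=> h /forallP z; apply/forallP => p; have := z (widen_ord h p). Qed.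

Lemma eq_zset sq sq' j w :
  (forall x p, (p < j)%N -> nth 0 (sq x) p = nth 0 (sq' x) p) ->
  zero_set sq j w = zero_set sq' j w.
Proof.
move=> h; apply: eq_forallb => p; apply: eq_forallb => a; congr (~~ odd _).
by apply: eq_card => x; rewrite !inE h.
Qed.

Lemma zero_setS sq j w :
  zero_set sq j.+1 w = zero_set sq j w && even_values (fun x => nth 0 (sq x) j) w.
Proof.
apply/forallP/andP => [h|[/forallP h e] p].
  split; last exact: (h ord_max).
  by apply/forallP => p; have := h (widen_ord (leqnSn j) p).
have [pj|] := ltnP p j; first exact: (h (Ordinal pj)).
by move=> jp; have -> : (p : nat) = j by apply/eqP; rewrite eqn_leq jp -ltnS ltn_ord.
Qed.

Lemma depS sq j V V' : V \subset V' -> dep sq j V -> dep sq j V'.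
Proof.
move=> s /existsP [w /and3P [wV w0 z]]; apply/existsP; exists w.
by rewrite (subset_trans wV s) w0.
Qed.

Lemma circuit_exists (P : pred {set X}) w :
  w != set0 -> P w -> exists2 w', circuit P w' & w' \subset w.
Proof.
move=> w0 Pw.
have [|w' /minsetP [/andP [w'0 Pw'] m] sw] := @minset_exists _ (fun w => (w != set0) && P w) w.
  by rewrite w0.
exists w' => //; apply/and3P; split=> //; apply/forallP => w''; apply/implyP => /andP [pr Pw''].
apply: contraTT pr => h; rewrite properE negb_and orbC; apply/orP.
have [sub|//] := boolP (w'' \subset w'); last by right.
by left; rewrite negbK (m w'') // h.
Qed.

Lemma circuit_eq (P Q : pred {set X}) w : P =1 Q -> circuit P w = circuit Q w.
Proof.
by move=> h; rewrite /circuit h; congr [&& _, _ & _]; apply: eq_forallb => w'; rewrite h.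
Qed.

Lemma even_values_unpair (A : finType) (v : X -> A) (M : seq (X * X)) :
  uniq (unpair M) -> all (fun p => v p.1 == v p.2) M ->
  even_values v [set x in unpair M].
Proof.
move=> um aM; apply/forallP => a.
have -> : #|[set x in [set x in unpair M] | v x == a]| = count (fun x => v x == a) (unpair M).
  rewrite -size_filter -(card_uniqP (filter_uniq _ um)); apply: eq_card => x.
  by rewrite !inE mem_filter andbC.
elim: M aM {um} => //= p M IH /andP [/eqP e /IH]; rewrite e addnA addnn oddD odd_double /=.
by [].
Qed.

Lemma unpair_subseq (M M' : seq (X * X)) : subseq M M' -> subseq (unpair M) (unpair M').
Proof.
elim: M' M => [|p' M' IH] [|p M] //= h; try exact: sub0seq.
move: h; case: eqP => [-> /IH|_ /IH] h; first by rewrite !eqxx.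
exact: (subseq_trans h (suffix_subseq [:: p'.1; p'.2] _)).
Qed.

Lemma mem_unpair (M : seq (X * X)) p : p \in M -> p.1 \in unpair M.
Proof. by move=> h; apply/flatten_mapP; exists p => //; rewrite inE eqxx. Qed.

End ZeroSets.

Section WithField.
Variable Rt : realFieldType.
Local Notation Ex := (@Ex Rt _).

Section Pairs.
Variables (k r : nat) (X : finType) (sq : X -> seq (bits k)) (j : nat).
Let TT (r : nat) := {ffun 'I_j -> {ffun bits k -> bits r}}.

Definition shifted_stab r (level_shift : X -> bits r) (T : TT r) (x : X) := level_shift x + stab T (sq x).

(** A linear relation among the pair differences selects a submatching whose keys form a zero set,
    so without one the differences are independent; [level_shift] only changes their target
    values. *)
Lemma pairs_prob (level_shift : X -> bits r) (M : seq (X * X)) :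
  uniq (unpair M) ->
  (forall M', subseq M' M -> M' != [::] -> ~~ zero_set sq j [set x in unpair M']) ->
  Ex (fun T : TT r => (all (fun p => shifted_stab level_shift T p.1 == shifted_stab level_shift T p.2) M)%:R)
  <= (#|bits r|%:R ^+ size M)^-1.
Proof.
move=> uM indep; case: M uM indep => [|p0 M0].
  by move=> _ _; rewrite expr0 invr1; apply: Ex_le_const.
move: (p0 :: M0) => M uM indep.
pose t := size M; pose pr (i : 'I_t) := tnth (in_tuple M) i.
pose G (i : 'I_t) := [:: sq (pr i).1; sq (pr i).2].
rewrite -(@stab_pairs Rt k j r t G (fun i => level_shift (pr i).1 + level_shift (pr i).2)).
  apply: Ex_le => T; rewrite ler_nat; case: (boolP (all _ _)) => // /allP aM.
  rewrite lt0b; apply/forallP => i; rewrite big_cons big_seq1.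
  have /eqP := aM (pr i) (mem_tnth i (in_tuple M)).
  rewrite /shifted_stab => /(congr1 (fun z => level_shift (pr i).1 + z + stab T (sq (pr i).2))).
  by rewrite addrA addrr2 add0r -!addrA addrr2 addr0 => ->.
move=> u; rewrite sum_F2_scale => su; apply/eqP; apply: contraT => u0.
pose m := [seq u 0 i != 0 | i <- enum 'I_t].
have ms : subseq (mask m M) M by apply: mask_subseq.
have nthm (i : 'I_t) : nth false m i = (u 0 i != 0).
  by rewrite (nth_map i) ?size_enum_ord// nth_ord_enum.
have mn : mask m M != [::].
  move: u0; apply: contraNneq => m0; apply/eqP/rowP => i; rewrite mxE; apply/eqP.
  apply: contraT; rewrite -nthm => mi.
  have : has id m by apply/hasP; exists true => //; rewrite -mi mem_nth// size_map size_enum_ord.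
  have := size_mask (s := M) (m := m); rewrite size_map size_enum_ord => /(_ erefl).
  by rewrite m0 has_count => /= <-.
have /negP [] := indep _ ms mn; apply/zero_setP.
rewrite (eq_bigl (fun x => x \in unpair (mask m M))) => [|x]; last by rewrite inE.
rewrite -big_uniq /=; last exact: (subseq_uniq (unpair_subseq ms)).
rewrite /unpair big_flatten big_map big_mask -[RHS]su.
by apply: eq_big => [i|i _]; rewrite ?nthm ?andbT// big_cons big_seq1 /G big_cons big_seq1.
Qed.

End Pairs.

Section Circuits.
Variables (k : nat) (X : finType) (sq : X -> seq (bits k)) (j : nat).
Let TT (r : nat) := {ffun 'I_j -> {ffun bits k -> bits r}}.
Local Notation shifted_stab := (shifted_stab sq).

Lemma circuit_prob (level_shift : X -> bits k) (w : {set X}) :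
  Ex (fun T : TT k => (circuit (fun w => zero_set sq j w && even_values (shifted_stab level_shift T) w) w)%:R)
  <= (npair #|w|)%:R * (#|bits k|%:R ^+ (#|w|./2.-1))^-1.
Proof.
have [->|w0] := eqVneq w set0.
  apply: Ex_le_const => [|T]; last by rewrite /circuit eqxx mulr_ge0// invr_ge0 exprn_ge0.
  by rewrite mulr_ge0// invr_ge0 exprn_ge0.
pose P (T : TT k) (w : {set X}) := zero_set sq j w && even_values (shifted_stab level_shift T) w.
pose mt (T : TT k) (M : seq (X * X)) := all (fun p => shifted_stab level_shift T p.1 == shifted_stab level_shift T p.2) M.
pose pw := pairings (size (enum w)) (enum w).
apply: (@le_trans _ _ (Ex (fun T => \sum_(M <- pw) (circuit (P T) w && mt T M)%:R))).
  apply: Ex_le => T; case: (boolP (circuit _ w)) => [c|_]; last exact: sumr_ge0.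
  have {}c : circuit (P T) w := c.
  have /andP [_ e] : P T w by case/and3P: c.
  have [|M Mp mM] := @pairings_even _ _ (shifted_stab level_shift T) (size (enum w)) (enum w) (leqnn _).
    move=> a; have := forallP e a; congr (~~ odd _).
    rewrite -size_filter -(card_uniqP (filter_uniq _ (enum_uniq _))).
    by apply: eq_card => x; rewrite !inE mem_filter mem_enum andbC.
  by rewrite (big_rem M Mp) /mt mM /= lerDl sumr_ge0.
rewrite Ex_sum cardE -(size_pairings (leqnn (size (enum w)))) -/pw mulr_natl.
rewrite -(count_predT pw) -iter_addr_0 -big_const_seq big_seq [leRHS]big_seq.
apply: ler_sum => M Mpw; have pM := pairings_perm Mpw.
have uM : uniq (unpair M) by rewrite (perm_uniq pM) enum_uniq.
have memM x : (x \in unpair M) = (x \in w) by rewrite (perm_mem pM) mem_enum.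
have sM : (size (enum w))./2 = size M by rewrite -(perm_size pM) size_unpair doubleK.
(* One pair is given up: all pairs of [M] together make up [w], which is itself a zero set below, so
   their differences are not independent. *)
rewrite sM; case: M Mpw pM uM memM sM => [|p0 M'] Mpw pM uM memM sM.
  by case/negP: w0; apply/eqP/setP => x; rewrite -memM inE.
rewrite /=; have sub' M'' : subseq M'' M' -> subseq M'' (p0 :: M').
  by move=> s; apply: subseq_trans s (subseq_cons _ _).
have uM' : uniq (unpair M') by apply: subseq_uniq uM; apply: unpair_subseq; apply: sub'.
(* If some remaining pairs already form a zero set below, the event is impossible: being matched,
   their keys are even in the new character too, and they miss [p0], against minimality. *)
have [/existsP [m /andP [mn zm]]|no] :=
  boolP [exists m : (size M').-tuple bool,
           (mask m M' != [::]) && zero_set sq j [set x in unpair (mask m M')]].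
  rewrite (eq_Ex (g := fun=> 0)); first by rewrite (Ex_const _ (0 : TT k)) invr_ge0 exprn_ge0.
  move=> T; case: (boolP (_ && _)) => // /andP [/and3P [_ _ /forallP mini] aM].
  have small_sum : subseq (mask m M') M' := mask_subseq _ _.
  have /implyP := mini [set x in unpair (mask m M')].
  case: (mask m M') mn small_sum zm => // q M'' _ small_sum zm h.
  have /eqP/setP/(_ q.1) : [set x in unpair (q :: M'')] == set0.
    apply: h; rewrite /P zm even_values_unpair ?andbT; first last.
    - by apply/allP => p /(mem_subseq small_sum); case/andP: aM => _ /allP aM /aM.
    - exact: (subseq_uniq (unpair_subseq small_sum)).
    rewrite properE; apply/andP; split.
      by apply/subsetP => x; rewrite inE -memM => /(mem_subseq (unpair_subseq (sub' _ small_sum))).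
    apply/subsetPn; exists p0.1; first by rewrite -memM (@mem_unpair _ _ p0)// mem_head.
    rewrite inE; apply/negP => /(mem_subseq (unpair_subseq small_sum)) h.
    by move: uM; rewrite /unpair /= inE negb_or -/(unpair M') h andbF.
  by rewrite !inE eqxx.
apply: (@le_trans _ _ _ _ _ _ (pairs_prob (sq := sq) (j := j) level_shift uM' _)); last first.
  move=> M'' /subseqP [m small_sum ->] mn; apply: contra no => zm.
  have hm : size m == size M' by apply/eqP.
  by apply/existsP; exists (Tuple hm); rewrite mn.
apply: Ex_le => T; rewrite ler_nat; case: (boolP (_ && _)) => // /andP [_].
by rewrite /mt /= => /andP [_ ->].
Qed.

End Circuits.

End WithField.

(** * Parities of random sequences *)

Section WithField.
Variable Rt : realFieldType.
Local Notation Ex := (@Ex Rt _).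

Fixpoint seqs (T : finType) (b : nat) : seq (seq T) :=
  if b is b'.+1 then [seq x :: t | x <- enum T, t <- seqs T b'] else [:: [::]].

Lemma mem_seqs (T : finType) b (t : seq T) : (t \in seqs T b) = (size t == b).
Proof.
elim: b t => [|b IH] [|x t] //=; first by apply/allpairsP => -[[? ?] [_ _]].
rewrite eqSS -IH; apply/allpairsP/idP => [[[y u] [_ hu [_ ->]]] //|h].
by exists (x, t); rewrite mem_enum.
Qed.

Lemma uniq_seqs (T : finType) b : uniq (seqs T b).
Proof.
elim: b => //= b IH; apply: allpairs_uniq => //; first exact: enum_uniq.
by move=> [x t] [y u] _ _ [-> ->].
Qed.

Lemma sum_seqsS (R : nmodType) (T : finType) b (F : seq T -> R) :
  \sum_(t <- seqs T b.+1) F t = \sum_x \sum_(t <- seqs T b) F (x :: t).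
Proof. by rewrite big_allpairs_dep big_enum. Qed.

Lemma sum_seqsS_nat (T : finType) b (F : seq T -> nat) :
  (\sum_(t <- seqs T b.+1) F t = \sum_x \sum_(t <- seqs T b) F (x :: t))%N.
Proof. exact: sum_seqsS. Qed.

Lemma sum_tuple_seqs (R : nmodType) (T : finType) b (F : seq T -> R) :
  \sum_(t : b.-tuple T) F t = \sum_(t <- seqs T b) F t.
Proof.
rewrite -(big_map (@tval b T) predT F); apply: perm_big; apply: uniq_perm.
- by rewrite map_inj_uniq ?index_enum_uniq//; apply: val_inj.
- exact: uniq_seqs.
move=> t; rewrite mem_seqs; apply/mapP/eqP => [[u _ ->]|h]; first exact: size_tuple.
by exists (tcast h (in_tuple t)); rewrite ?mem_index_enum// val_tcast.
Qed.

Section Parity.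
Variable A : finType.
Implicit Types (t : seq A) (v : {ffun A -> 'F_2}).

Definition parity t : {ffun A -> 'F_2} := [ffun a => (count_mem a t)%:R].
Definition delta (a : A) : {ffun A -> 'F_2} := [ffun b => (a == b)%:R].
Definition parity_count b v : nat := \sum_(t <- seqs A b) (parity t == v).
Definition support_size v : nat := #|[set a | v a != 0]|.

Lemma addff2 v : v + v = 0.
Proof. by apply/ffunP => a; rewrite !ffunE (addrr_pchar2 (pchar_Fp (isT : prime 2))). Qed.

Lemma oppff2 v : - v = v.
Proof. by apply/eqP; rewrite eq_sym -subr_eq0 opprK addff2. Qed.

Lemma parity_cons a t : parity (a :: t) = delta a + parity t.
Proof. by apply/ffunP => b; rewrite !ffunE /= natrD. Qed.

Lemma parity_consE a t v : (parity (a :: t) == v) = (parity t == v + delta a).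
Proof. by rewrite parity_cons -subr_eq oppff2 addrC. Qed.

Lemma cntS b v : parity_count b.+1 v = (\sum_a parity_count b (v + delta a)%R)%N.
Proof.
rewrite /parity_count sum_seqsS_nat; apply: eq_bigr => a _; apply: eq_bigr => t _.
by rewrite parity_consE.
Qed.

Lemma cnt0 v : parity_count 0 v = (v == 0).
Proof.
by rewrite /parity_count big_seq1 eq_sym (_ : parity [::] = 0)//; apply/ffunP => a; rewrite !ffunE.
Qed.

Lemma cntD a b v : parity_count (a + b) v = (\sum_u parity_count a u * parity_count b (v + u)%R)%N.
Proof.
elim: a v => [|a IH] v.
  rewrite (bigD1 (0 : {ffun A -> 'F_2}))//= cnt0 eqxx mul1n addr0 big1 ?addn0// => u u0.
  by rewrite cnt0 (negPf u0).
rewrite addSn cntS; under eq_bigr do rewrite IH.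
under [RHS]eq_bigr do rewrite cntS big_distrl /=.
rewrite [RHS]exchange_big /=; apply: eq_bigr => x _.
rewrite [RHS](reindex_inj (addrI (delta x))) /=; apply: eq_bigr => u _.
by rewrite (addrC (delta x) u) -(addrA u) addff2 addr0 (addrC u) addrA.
Qed.

(** The count is a convolution of two equal functions, so Cauchy-Schwarz, in the form 2ab <= a^2 +
    b^2, bounds it by its value at 0. *)
Lemma parity_count_double (t : nat) v : (parity_count (t + t) v <= parity_count (t + t) 0%R)%N.
Proof.
rewrite !cntD -(leq_pmul2l (m := 2))//.
have -> : (\sum_u parity_count t u * parity_count t (0 + u)%R = \sum_u parity_count t u * parity_count t u)%N.
  by apply: eq_bigr => u _; rewrite add0r.
have -> : (2 * \sum_i parity_count t i * parity_count t i
   = \sum_i (parity_count t i ^ 2 + parity_count t (v + i)%R ^ 2))%N.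
  rewrite big_split /= mul2n -addnn; congr (_ + _)%N.
  by rewrite [LHS](reindex_inj (addrI v)) /=; apply: eq_bigr => i _; rewrite mulnn.
by rewrite big_distrr leq_sum//= => i _; apply: nat_Cauchy.
Qed.

Lemma parity_count_mono (t b : nat) v : (parity_count (b + (t + t)) v <= #|A| ^ b * parity_count (t + t) 0%R)%N.
Proof.
elim: b v => [|b IH] v; first by rewrite mul1n parity_count_double.
rewrite addSn cntS expnS -mulnA -[leqRHS]sum_nat_const.
by apply: leq_sum => a _; apply: IH.
Qed.

(** Deleting an occurrence of [a] leaves a sequence of parity [v], and the deleted entry stood in
    one of [b.+1] places. *)
Lemma parity_count_mem b a v :
  (\sum_(t <- seqs A b.+1) ((a \in t) && (parity t == (v + delta a)%R)) <= b.+1 * parity_count b v)%N.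
Proof.
elim: b v => [|b IH] v.
  rewrite mul1n cnt0 sum_seqsS_nat (bigD1 a)//= [X in (_ + X)%N]big1 => [|c /negPf ca].
    rewrite addn0 big_seq1 parity_consE -addrA addff2 addr0 inE eqxx eq_sym.
    by rewrite (_ : parity [::] = 0)//; apply/ffunP => x; rewrite !ffunE.
  by rewrite big_seq1 inE eq_sym ca.
rewrite sum_seqsS_nat (bigD1 a)//= mulSn; apply: leq_add.
  apply: leq_sum => t _; rewrite parity_consE -addrA addff2 addr0.
  by case: (_ \in _).
rewrite cntS big_distrr [leqRHS](bigD1 a)//= -[leqLHS]add0n leq_add// leq_sum// => c ca.
apply: leq_trans (IH (v + delta c)); apply: leq_sum => t _.
by rewrite parity_consE inE eq_sym (negPf ca) addrAC.
Qed.

(** In a sequence of parity 0 the first entry occurs again; deleting both occurrences gives the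
    recursion of [npair]. *)
Lemma parity_count_npair (t : nat) : (parity_count t.*2 0%R <= npair t.*2 * #|A| ^ t)%N.
Proof.
elim: t => [|t IH]; first by rewrite cnt0 eqxx.
rewrite doubleS cntS /= expnS.
apply: (@leq_trans (\sum_(a : A) (t.*2.+1 * parity_count t.*2 0%R)%N)).
  apply: leq_sum => a _; apply: leq_trans (parity_count_mem _ a 0).
  rewrite /parity_count; apply: leq_sum => u _; case: eqP => // e.
  have : parity u a = 1 by rewrite e add0r ffunE eqxx.
  rewrite ffunE andbT => c1; rewrite lt0b.
  by rewrite -has_pred1 has_count lt0n; apply: contra_eqN c1 => /eqP ->.
rewrite sum_nat_const; move: IH; rewrite -(leq_pmul2l (m := (#|A| * t.*2.+1).+1))//.
have -> : (t.*2.+1 * npair t.*2 * (#|A| * #|A| ^ t) = #|A| * (t.*2.+1 * (npair t.*2 * #|A| ^ t)))%N by ring.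
by rewrite leq_pmul2l// => IH; do 2! rewrite leq_mul2l ?IH ?orbT.
Qed.

(** Give [v] the weight [x ^+ support_size v]: the total weight factors over the coordinates into
    [(1 + x) ^+ #|A|], and each counted [v] weighs at least [x ^+ s]. *)
Lemma card_wt (x : Rt) s : 0 < x -> x <= 1 ->
  (#|[set v | support_size v <= s]%N|)%:R <= (1 + x) ^+ #|A| / x ^+ s.
Proof.
move=> x0 x1; rewrite ler_pdivlMr ?exprn_gt0// mulr_natl -sumr_const.
have -> : (1 + x) ^+ #|A| = \sum_(v : {ffun A -> 'F_2}) x ^+ support_size v.
  rewrite -prodr_const.
  transitivity (\prod_(a : A) \sum_(e : 'F_2) (if e != 0 then x else 1)).
    by apply: eq_bigr => a _; rewrite big_ord_recl big_ord1.
  rewrite bigA_distr_bigA; apply: eq_bigr => v _ /=.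
  rewrite -big_mkcond /= /support_size -prodr_const; apply: eq_bigl => a.
  by rewrite inE.
rewrite big_mkcond /=; apply: ler_sum => v _; rewrite inE; case: ifP => h.
  by apply: ler_wiXn2l => //; apply: ltW.
by rewrite exprn_ge0 ?ltW.
Qed.

(* Chernoff bound with parameter [x]; no parity vector is more likely than 0, which is reached by
   at most [npair] pairings of the first [2 t] values. *)
Lemma parity_ball (s t b : nat) (x : Rt) : 0 < x -> x <= 1 -> (t.*2 <= b)%N -> (0 < #|A|)%N ->
  Ex (fun u : b.-tuple A => (support_size (parity u) <= s)%:R%N)
  <= (1 + x) ^+ #|A| / x ^+ s * ((npair t.*2)%:R / #|A|%:R ^+ t).
Proof.
move=> x0 x1 tb A0; rewrite /Ex card_tuple.
rewrite (sum_tuple_seqs _ (fun u => (support_size (parity u) <= s)%:R%N)).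
have -> : \sum_(u <- seqs A b) (support_size (parity u) <= s)%:R%N
   = \sum_(v in [set v | support_size v <= s]%N) (parity_count b v)%:R :> Rt.
  under [RHS]eq_bigr do rewrite /parity_count natr_sum.
  rewrite exchange_big; apply: eq_bigr => u _ /=.
  rewrite -[RHS]natr_sum; congr (_%:R).
  case: (boolP (support_size (parity u) <= s)%N) => h.
    rewrite (bigD1 (parity u)) ?inE//= eqxx big1 ?addn0// => v /andP [_].
    by rewrite eq_sym => /negPf ->.
  by rewrite big1// => v; rewrite inE; case: eqP => // <- /(negP h).
have nA : 0 < #|A|%:R :> Rt by rewrite ltr0n.
rewrite ler_pdivrMr ?natrX ?exprn_gt0//.
apply: (@le_trans _ _ (\sum_(v in [set v | support_size v <= s]%N) ((npair t.*2)%:R / #|A|%:R ^+ t * #|A|%:R ^+ b))).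
  apply: ler_sum => v _; rewrite mulrAC ler_pdivlMr ?exprn_gt0// -!natrX -!natrM ler_nat.
  rewrite -{1}(subnK tb) -addnn.
  apply: (leq_trans (leq_mul (parity_count_mono _ _ _) (leqnn _))); rewrite addnn.
  apply: (@leq_trans (#|A| ^ (b - t.*2) * (npair t.*2 * #|A| ^ t) * #|A| ^ t)%N).
    by rewrite leq_mul2r leq_mul2l parity_count_npair !orbT.
  by rewrite -{2}(subnK tb) -addnn !expnD; apply/eq_leq; ring.
rewrite sumr_const -[leLHS]mulr_natl -[leRHS]mulrA ler_wpM2r ?card_wt//.
by rewrite !mulr_ge0 ?invr_ge0 ?exprn_ge0// ltW.
Qed.

End Parity.

End WithField.

Section WithField.
Variable Rt : realFieldType.
Local Notation Ex := (@Ex Rt _).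

Section Indep.
Variables (k r : nat) (X : finType) (sq : X -> seq (bits k)) (j : nat).
Let TT (r : nat) := {ffun 'I_j -> {ffun bits k -> bits r}}.

Lemma indep_uniform (level_shift : X -> bits r) (l : seq X) (S : pred (seq (bits r))) :
  uniq l -> ~~ dep sq j [set x in l] ->
  Ex (fun T : TT r => (S [seq shifted_stab sq level_shift T x | x <- l])%:R)
  = Ex (fun u : (size l).-tuple (bits r) => (S u)%:R).
Proof.
move=> ul nd; pose t := size l; pose e (i : 'I_t) := tnth (in_tuple l) i.
have ei : injective e.
  by move=> a b; rewrite /e !(tnth_nth (e a)) => /eqP; rewrite nth_uniq ?ltn_ord// => /eqP /val_inj.
pose f (u : {ffun 'I_t -> bits r}) : t.-tuple (bits r) := [tuple level_shift (e i) + u i | i < t].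
have bf : bijective f.
  exists (fun v => [ffun i => level_shift (e i) + tnth v i]) => [u|v].
    by apply/ffunP => i; rewrite ffunE tnth_mktuple addrA addrr2 add0r.
  by apply/eq_from_tnth => i; rewrite tnth_mktuple ffunE addrA addrr2 add0r.
rewrite -(Ex_bij _ bf).
have h (u : 'rV['F_2]_t) : \sum_i u 0 i *: (\sum_(s <- [:: sq (e i)]) char_vec j s) = 0 -> u = 0.
  rewrite sum_F2_scale => su; apply/eqP; apply: contraT => u0.
  case/negP: nd; apply/existsP; exists [set e i | i in [set i | u 0 i != 0]].
  apply/and3P; split.
  - by apply/subsetP => x /imsetP [i _ ->]; rewrite inE mem_tnth.
  - apply: contraNneq u0 => /setP im0; apply/eqP/rowP => i; rewrite mxE.
    by have := im0 (e i); rewrite mem_imset// !inE => /negbFE /eqP.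
  apply/zero_setP; rewrite big_imset /=; last by move=> a b _ _ /ei.
  rewrite -[RHS]su; apply: eq_big => [i|i _]; rewrite ?inE ?big_seq1//.
rewrite -(@stab_uniform Rt k j r t (fun i => [:: sq (e i)]) (fun u => S (f u)) h).
apply: eq_Ex => T; congr (nat_of_bool (S _))%:R.
have el : l = [seq e i | i <- enum 'I_t] by rewrite -[LHS]/(tval (in_tuple l)) -map_tnth_enum.
rewrite /f /= {1}el -map_comp; apply/eq_map => i.
by rewrite /= ffunE big_seq1.
Qed.

(** A matching of [Y] joined with [Ms] consists of disjoint pairs inside the independent set [V], so
    here no pair has to be given up. *)
Lemma even_pairs_prob (level_shift : X -> bits r) (Y V : {set X}) (Ms : seq (X * X)) :
  uniq (unpair Ms) -> (forall x, x \in unpair Ms -> x \notin Y) ->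
  (forall x, x \in unpair Ms -> x \in V) -> Y \subset V -> ~~ dep sq j V ->
  Ex (fun T : TT r => (even_values (shifted_stab sq level_shift T) Y
        && all (fun p => shifted_stab sq level_shift T p.1 == shifted_stab sq level_shift T p.2) Ms)%:R)
  <= (npair #|Y|)%:R * (#|bits r|%:R ^+ (#|Y|./2 + size Ms))^-1.
Proof.
move=> uM dM sM sY nd.
pose mt (T : TT r) (M : seq (X * X)) := all (fun p => shifted_stab sq level_shift T p.1 == shifted_stab sq level_shift T p.2) M.
pose pw := pairings (size (enum Y)) (enum Y).
apply: (@le_trans _ _ (Ex (fun T => \sum_(M <- pw) (mt T (M ++ Ms))%:R))).
  apply: Ex_le => T; case: (boolP (_ && _)) => [/andP [e aM]|_]; last exact: sumr_ge0.
  have [|M Mp mM] := @pairings_even _ _ (shifted_stab sq level_shift T) (size (enum Y)) (enum Y) (leqnn _).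
    move=> a; have := forallP e a; congr (~~ odd _).
    rewrite -size_filter -(card_uniqP (filter_uniq _ (enum_uniq _))).
    by apply: eq_card => x; rewrite !inE mem_filter mem_enum andbC.
  by rewrite (big_rem M Mp) /mt all_cat mM /= aM lerDl sumr_ge0.
rewrite Ex_sum cardE -(size_pairings (leqnn (size (enum Y)))) -/pw mulr_natl.
rewrite -(count_predT pw) -iter_addr_0 -big_const_seq big_seq [leRHS]big_seq.
apply: ler_sum => M Mpw; have pM := pairings_perm Mpw.
have uM' : uniq (unpair M) by rewrite (perm_uniq pM) enum_uniq.
have memM x : (x \in unpair M) = (x \in Y) by rewrite (perm_mem pM) mem_enum.
have -> : (size (enum Y))./2 = size M by rewrite -(perm_size pM) size_unpair doubleK.
rewrite -size_cat; apply: pairs_prob.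
  rewrite /unpair map_cat flatten_cat cat_uniq uM' uM andbT; apply/hasPn => x /dM.
  by rewrite memM.
move=> M' /unpair_subseq /mem_subseq sub M0; apply: contra nd => z.
apply/existsP; exists [set x in unpair M']; apply/and3P; split=> //.
  apply/subsetP => x; rewrite inE => /sub.
  rewrite /unpair map_cat flatten_cat mem_cat => /orP [|/sM//].
  by rewrite memM => /(subsetP sY).
case: M' M0 {sub z} => // p M' _; apply/set0Pn; exists p.1.
by rewrite inE mem_head.
Qed.

End Indep.

(** A value taken an odd number of times on [B] must occur again on [w :\: B]. So the parity vector
    of the values on [B], which are independent and uniform, has support at most [s]. *)
Lemma large_prob (k : nat) (X : finType) (sq : X -> seq (bits k)) (j : nat)
  (level_shift : X -> bits k) (w B : {set X}) (s t : nat) (x : Rt) :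
  0 < x -> x <= 1 -> B \subset w -> ~~ dep sq j B -> (#|w :\: B| <= s)%N -> (t.*2 <= #|B|)%N ->
  Ex (fun T : {ffun 'I_j -> {ffun bits k -> bits k}} => (even_values (shifted_stab sq level_shift T) w)%:R)
  <= (1 + x) ^+ #|bits k| / x ^+ s * ((npair t.*2)%:R / #|bits k|%:R ^+ t).
Proof.
move=> x0 x1 sB nd ws tB.
have n0 : (0 < #|bits k|)%N by apply/card_gt0P; exists 0.
rewrite cardE in tB; apply: le_trans (parity_ball s x0 x1 tB n0).
rewrite -(@indep_uniform k k X sq j level_shift (enum B) (fun u => (support_size (parity u) <= s)%N)) ?enum_uniq//.
  apply: Ex_le => T; rewrite ler_nat; case: (boolP (even_values _ _)) => // /forallP ev.
  rewrite lt0b; apply: leq_trans ws; apply: leq_trans (leq_imset_card (shifted_stab sq level_shift T) _).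
  apply: subset_leq_card; apply/subsetP => a; rewrite inE ffunE F2_natr_eq0 negbK => oB.
  have := ev a; rewrite -(cardsID B) oddD.
  have -> : #|[set x in w | shifted_stab sq level_shift T x == a] :&: B|
          = count_mem a [seq shifted_stab sq level_shift T x | x <- enum B].
    rewrite count_map -size_filter -(card_uniqP (filter_uniq _ (enum_uniq _))).
    apply: eq_card => y; rewrite !inE mem_filter mem_enum /=.
    by case: (boolP (y \in B)) => [/(subsetP sB) ->|_]; rewrite ?andbT ?andbF.
  rewrite oB addTb negbK => /odd_gt0 /card_gt0P [y]; rewrite !inE => /and3P [yB yw /eqP <-].
  by apply: imset_f; rewrite !inE yB.
by rewrite (_ : [set x in enum B] = B)//; apply/setP => y; rewrite inE mem_enum.
Qed.

End WithField.

(** * Derived characters, level by level *)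

Section FoldRcons.
Variables (T I : Type) (g : I -> seq T -> T).
Let F s0 l := foldl (fun s i => rcons s (g i s)) s0 l.

Lemma size_foldl_rcons s0 l : size (F s0 l) = (size s0 + size l)%N.
Proof. by rewrite /F; elim: l s0 => [|i l IH] s0 /=; rewrite ?addn0// IH size_rcons addSnnS. Qed.

Lemma nth_foldl_rcons x0 s0 l p : (p < size s0)%N -> nth x0 (F s0 l) p = nth x0 s0 p.
Proof.
rewrite /F; elim: l s0 => [|i l IH] s0 //= ps.
by rewrite IH ?size_rcons ?(ltn_trans ps)// nth_rcons ps.
Qed.
End FoldRcons.

Lemma even_values_sum (k : nat) (X : finType) (v : X -> bits k) (w : {set X}) :
  even_values v w -> \sum_(x in w) v x = 0.
Proof.
move=> /forallP ev; rewrite (partition_big v predT)//= big1// => a _.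
rewrite (eq_bigr (fun=> a)) => [|x /andP [_ /eqP]//].
rewrite sumr_const -(odd_double_half #|_|).
have -> : odd #|[pred i in w | v i == a]| = false.
  by have := ev a; rewrite cardsE => /negPf.
by rewrite add0n -mul2n mulrnA mulr2n addrr2 mul0rn.
Qed.

Lemma even_values_comp (X A B : finType) (f : A -> B) (v : X -> A) (w : {set X}) :
  even_values v w -> even_values (f \o v) w.
Proof.
move=> /forallP ev; apply/forallP => b.
rewrite -sum1_card (partition_big v (fun a => f a == b)) /=; last first.
  by move=> x; rewrite inE => /andP [].
rewrite -dvdn2; apply: dvdn_sum => a /eqP fa; have := ev a.
rewrite -dvdn2 -sum1_card; congr (2 %| _)%N; apply: eq_bigl => x.
by rewrite !inE /= -fa; case: eqP => [->|]; rewrite ?eqxx ?andbT ?andbF.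
Qed.

Lemma even_values_card (X A : finType) (v : X -> A) (w : {set X}) :
  even_values v w -> ~~ odd #|w|.
Proof.
move=> /(even_values_comp (fun=> tt)) /forallP /(_ tt); congr (~~ odd _).
by apply: eq_card => x; rewrite inE eqxx andbT.
Qed.

Section Levels.
Variables (k c d : nat).
Hypotheses (hc : (0 < c)%N) (hd : (1 < d)%N).
Implicit Types (H : htil_tables k c d) (x : key k c) (i : 'I_d.-1).

(* Only the first derived character involves an input character, the last one. *)
Definition level_shift i x : bits k := if val i == 0%N then nth 0 x c.-1 else 0.

Lemma size_dseq H x : size (dseq H x) = (c.-1 + d.-1)%N.
Proof.
rewrite size_foldl_rcons size_enum_ord size_take size_tuple.
by case: (c) hc => // c' _ /=; rewrite ltnSn.
Qed.

Lemma size_take_key x : size (take c.-1 x) = c.-1.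
Proof. by rewrite size_take size_tuple; case: (c) hc => // c' _ /=; rewrite ltnSn. Qed.

Lemma dseq_base H x p : (p < c.-1)%N -> nth 0 (dseq H x) p = nth 0 x p.
Proof. by move=> pc; rewrite nth_foldl_rcons ?size_take_key// nth_take. Qed.

(** The fold never changes earlier entries, so table [i] may be applied to the final sequence
    instead of the prefix built so far. *)
Lemma dseq_level H x i : nth 0 (dseq H x) (c + i - 1) = level_shift i x + stab (H i) (dseq H x).
Proof.
have ci : (c + i - 1 = c.-1 + i)%N by lia.
pose G (i : 'I_d.-1) s := level_shift i x + stab (H i) s.
have E : enum 'I_d.-1 = take i (enum 'I_d.-1) ++ i :: drop i.+1 (enum 'I_d.-1).
  rewrite -{1}(cat_take_drop i (enum 'I_d.-1)) (drop_nth i) ?size_enum_ord//.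
  by rewrite nth_ord_enum.
have D : dseq H x = foldl (fun s i => rcons s (G i s)) (take c.-1 x) (enum 'I_d.-1) by [].
pose s1 := foldl (fun s i => rcons s (G i s)) (take c.-1 x) (take i (enum 'I_d.-1)).
have s1s : size s1 = (c + i - 1)%N.
  by rewrite size_foldl_rcons size_take_key size_takel ?size_enum_ord 1?ltnW.
have D2 : dseq H x = foldl (fun s i => rcons s (G i s)) (rcons s1 (G i s1)) (drop i.+1 (enum 'I_d.-1)).
  by rewrite D {1}E foldl_cat.
rewrite {1}D2 nth_foldl_rcons; last by rewrite size_rcons s1s.
rewrite nth_rcons s1s ltnn eqxx.
rewrite /G /stab; congr (_ + _); apply: eq_bigr => p _; congr (H i p _).
rewrite D2 (@nth_foldl_rcons _ _ _ _ (rcons s1 (G i s1))); last by rewrite size_rcons s1s ltnS ltnW.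
by rewrite nth_rcons s1s ltn_ord.
Qed.

Lemma eq_stab (n : nat) (A : zmodType) (T : {ffun 'I_n -> {ffun bits k -> A}}) s s' :
  (forall p, (p < n)%N -> nth 0 s p = nth 0 s' p) -> stab T s = stab T s'.
Proof. by move=> h; apply: eq_bigr => p _; rewrite h. Qed.

Lemma dseq_split p : (p < c.-1 + d.-1)%N -> (p < c.-1)%N \/ exists i : 'I_d.-1, p = (c + i - 1)%N.
Proof.
move=> h; have [|pc] := ltnP p c.-1; [by left|right].
have hi : (p - c.-1 < d.-1)%N by lia.
by exists (Ordinal hi) => /=; lia.
Qed.

Lemma dseq_ext H H' x (i : nat) :
  (forall i' : 'I_d.-1, (i' < i)%N -> H i' = H' i') ->
  forall p, (p < c + i - 1)%N -> nth 0 (dseq H x) p = nth 0 (dseq H' x) p.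
Proof.
move=> HH p; elim/ltn_ind: p => p IH pi.
have [pd|pd] := ltnP p (c.-1 + d.-1); last by rewrite !nth_default ?size_dseq.
have [pc|[i' pE]] := dseq_split pd; first by rewrite !dseq_base.
rewrite pE !dseq_level HH; last by lia.
by congr (_ + _); apply: eq_stab => q hq; apply: IH; lia.
Qed.

Lemma dseq_upd H i (T : {ffun 'I_(c + i - 1) -> {ffun bits k -> bits k}}) x p :
  (p < c + i - 1)%N -> nth 0 (dseq (dfupd H T) x) p = nth 0 (dseq H x) p.
Proof.
apply: dseq_ext => i' ii'; rewrite ffunE dfwith_out//.
by apply: contraTneq ii' => ->; rewrite ltnn.
Qed.

(** The first [c.-1] derived characters are input characters; they determine the mask on the last
    input character, which can then be cancelled. *)
Lemma dseq_inj H x y :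
  (forall p, (p < c)%N -> nth 0 (dseq H x) p = nth 0 (dseq H y) p) -> x = y.
Proof.
move=> e; have z : (0 < d.-1)%N by lia.
have c1 : (c + Ordinal z - 1 = c.-1)%N by rewrite /= addn0 subn1.
have eb p : (p < c.-1)%N -> nth 0 x p = nth 0 y p.
  by move=> pc; rewrite -!(dseq_base H) ?e// (leq_trans pc) ?leq_pred.
apply/val_inj/(@eq_from_nth _ 0); rewrite !size_tuple// => p pc.
have [|pc'] := ltnP p c.-1; first exact: eb.
have -> : p = c.-1 by lia.
have lx u : nth 0 (dseq H u) c.-1 = nth 0 u c.-1 + stab (H (Ordinal z)) (dseq H u).
  by rewrite -{1}c1 dseq_level.
have := e c.-1; rewrite prednK// leqnn => /(_ isT); rewrite !lx.
rewrite (@eq_stab _ _ _ (dseq H x) (dseq H y)); first exact: addIr.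
by move=> q hq; rewrite e//; lia.
Qed.

(** A necessary condition for zero sets that mentions no table and determines any key of the set
    from the others. *)
Definition key_sum0 (w : {set key k c}) : bool :=
  [forall p : 'I_c, \sum_(x in w) nth 0 x p == 0].

Lemma zero_set_nth H j w p : (p < j)%N -> zero_set (dseq H) j w -> even_values (fun x => nth 0 (dseq H x) p) w.
Proof. by move=> pj /forallP /(_ (Ordinal pj)). Qed.

(** At the last input position the contributions of the first table cancel, because all positions
    below are even. *)
Lemma zero_set_key_sum0 H w : zero_set (dseq H) c w -> key_sum0 w.
Proof.
move=> z; apply/forallP => p; apply/eqP.
have [pc|pc] := ltnP p c.-1.
  rewrite -[RHS](even_values_sum (zero_set_nth (ltn_ord p) z)).
  by apply: eq_bigr => x _; rewrite dseq_base.
have z0 : (0 < d.-1)%N by lia.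
have pE : (p : nat) = (c + Ordinal z0 - 1)%N by rewrite /= addn0 subn1; have := ltn_ord p; lia.
have := even_values_sum (zero_set_nth (ltn_ord p) z).
under eq_bigr do rewrite {1}pE dseq_level.
rewrite big_split /= [X in _ + X]exchange_big /= [X in _ + X]big1.
  rewrite addr0 => s0; rewrite -[RHS]s0; apply: eq_bigr => x _; rewrite /level_shift /=; congr (nth _ _ _).
  by rewrite pE /= addn0 subn1.
move=> q _; have qc : (q < c)%N by have := ltn_ord q; rewrite /=; lia.
exact: (even_values_sum (even_values_comp (H (Ordinal z0) q) (zero_set_nth qc z))).
Qed.

(** Size 2 is excluded by [dseq_inj]: the two keys would agree in the first [c] derived
    characters. *)
Lemma zero_set_card H w : zero_set (dseq H) c w -> w != set0 -> (4 <= #|w|)%N && ~~ odd #|w|.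
Proof.
move=> z w0; have ev := even_values_card (zero_set_nth hc z).
rewrite ev andbT.
have n2 : #|w| != 2%N.
  apply/negP => /cards2P [x [y [xy wE]]].
  case/eqP: xy; apply: (@dseq_inj H) => p pc.
  have /forallP /(_ (nth 0 (dseq H x) p)) := zero_set_nth pc z.
  rewrite wE; apply: contraNeq => ne.
  rewrite (_ : [set _ in _ | _] = [set x]) ?cards1//.
  apply/setP => u; rewrite !inE; case: (eqVneq u x) => [->|_] /=; first by rewrite eqxx.
  by case: (eqVneq u y) => [->|//]; rewrite eq_sym (negPf ne).
by move: w0 ev n2; rewrite -card_gt0; case: #|w| => [|[|[|[|]]]].
Qed.

Lemma zero_set_upd H i (T : {ffun 'I_(c + i - 1) -> {ffun bits k -> bits k}}) w :
  zero_set (dseq (dfupd H T)) (c + i) w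
  = zero_set (dseq H) (c + i - 1) w && even_values (shifted_stab (dseq H) (level_shift i) T) w.
Proof.
have e : (c + i = (c + i - 1).+1)%N by lia.
transitivity (zero_set (dseq (dfupd H T)) (c + i - 1).+1 w); first by rewrite -e.
rewrite zero_setS; congr (_ && _); first by apply: eq_zset => x p; apply: dseq_upd.
apply: eq_forallb => a; congr (~~ odd _); apply: eq_card => x; rewrite !inE.
rewrite dseq_level /shifted_stab ffunE dfwith_in; congr (_ && (_ + _ == _)).
by apply: eq_stab => p; apply: dseq_upd.
Qed.

End Levels.

Section WithField.
Variable Rt : realFieldType.
Local Notation Ex := (@Ex Rt _).

Lemma Pr_le1 (T : finType) (P : pred T) : Ex (fun t => (P t)%:R) <= 1.
Proof. by apply: Ex_le_const => // t; case: (P t). Qed.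

Lemma Pr_ge0 (T : finType) (P : pred T) : 0 <= Ex (fun t => (P t)%:R).
Proof. by apply: Ex_ge0 => t. Qed.

Section LevelProb.
Variables (k c d : nat).
Hypotheses (hc : (0 < c)%N) (hd : (1 < d)%N).
Local Notation n := (#|bits k|%:R : Rt).
Local Notation tabs i := {ffun 'I_(c + i - 1) -> {ffun bits k -> bits k}}.

(* A minimal zero set of size [a] has [npair a] matchings of its new characters, and the
   differences along all pairs but one are independent. *)
Definition match_rate (a : nat) : Rt := (npair a)%:R * (n ^+ (a./2.-1))^-1.

Lemma match_rate_ge0 a : 0 <= match_rate a.
Proof. by rewrite mulr_ge0// invr_ge0 exprn_ge0. Qed.

Lemma circuit_upd (i : 'I_d.-1) (H : htil_tables k c d) (T : tabs i) (w : {set key k c}) :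
  circuit (zero_set (dseq (dfupd H T)) (c + i)) w
  = circuit (fun w => zero_set (dseq H) (c + i - 1) w && even_values (shifted_stab (dseq H) (level_shift i) T) w) w.
Proof. by apply: circuit_eq => w'; apply: zero_set_upd. Qed.

Lemma circuit_level (i : 'I_d.-1) (w : {set key k c}) :
  Ex (fun H : htil_tables k c d => (circuit (zero_set (dseq H) (c + i)) w)%:R)
  <= match_rate #|w| * Ex (fun H : htil_tables k c d => (dep (dseq H) (c + i - 1) w)%:R).
Proof.
rewrite (Ex_resample i) -ExZ; apply: Ex_le => H.
under eq_Ex do rewrite circuit_upd.
have r0 b : 0 <= match_rate #|w| * b%:R by rewrite mulr_ge0 ?match_rate_ge0 ?ler0n.
have [z|z] := boolP (zero_set (dseq H) (c + i - 1) w).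
  have [w0|w0] := eqVneq w set0.
    by apply: Ex_le_const => // T; rewrite /circuit w0 eqxx -w0.
  rewrite (_ : dep _ _ _ = true) ?mulr1; first exact: circuit_prob.
  by apply/existsP; exists w; rewrite subxx w0.
by apply: Ex_le_const => // T; rewrite /circuit (negPf z) andbF.
Qed.

(* If [V1] is independent one level below, a zero set inside [V] is determined by its trace on
   [V :\: V1], so that there are at most [2 ^ s] of them. *)
Lemma split_level (i : 'I_d.-1) (V V1 : {set key k c}) (s U t : nat) (rb x : Rt) :
  0 <= rb -> 0 < x -> x <= 1 ->
  (forall a, (14 < a)%N -> ~~ odd a -> (a <= U)%N -> match_rate a <= rb) ->
  (s + t.*2 <= U)%N ->
  V1 \subset V -> (#|V :\: V1| <= s)%N ->
  Ex (fun H : htil_tables k c d =>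
    [exists w : {set key k c}, [&& w \subset V, (14 < #|w|)%N & circuit (zero_set (dseq H) (c + i)) w]]%:R)
  <= Ex (fun H : htil_tables k c d => (dep (dseq H) (c + i - 1) V1)%:R)
   + 2%:R ^+ s * (rb + (1 + x) ^+ #|bits k| / x ^+ s * ((npair t.*2)%:R / n ^+ t))
     * Ex (fun H : htil_tables k c d => (dep (dseq H) (c + i - 1) V)%:R).
Proof.
move=> rb0 x0 x1 hrb hU sV hs.
set q := (1 + x) ^+ _ / _ * _; set eta := 2%:R ^+ s * _.
have q0 : 0 <= q.
  have x0' := ltW x0.
  by rewrite /q !mulr_ge0 ?invr_ge0 ?exprn_ge0 ?addr_ge0.
have eta0 : 0 <= eta by rewrite mulr_ge0 ?exprn_ge0 ?addr_ge0.
rewrite (Ex_resample i) -ExZ -ExD; apply: Ex_le => H.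
pose j := (c + i - 1)%N.
pose Cw (w : {set key k c}) (T : tabs i) :=
  circuit (fun w => zero_set (dseq H) j w && even_values (shifted_stab (dseq H) (level_shift i) T) w) w.
rewrite (eq_Ex (g := fun T : tabs i => [exists w : {set key k c},
   [&& w \subset V, (14 < #|w|)%N & Cw w T]]%:R)); last first.
  move=> T; congr (nat_of_bool _)%:R; apply: eq_existsb => w.
  by rewrite circuit_upd.
have [d1|d1] := boolP (dep (dseq H) j V1).
  by apply: le_trans (Pr_le1 _) _; rewrite lerDl mulr_ge0.
rewrite add0r.
pose Ws := [set w : {set key k c} | [&& w \subset V, (14 < #|w|)%N, ~~ odd #|w| & zero_set (dseq H) j w]].
have [dV|dV] := boolP (dep (dseq H) j V); last first.
  rewrite mulr0; apply: Ex_le_const => // T.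
  case: existsP => // -[w /and3P [wV _ /and3P [w0 /andP [zw _] _]]].
  by case/negP: dV; apply/existsP; exists w; rewrite wV w0.
rewrite mulr1.
apply: (@le_trans _ _ (Ex (fun T : tabs i => \sum_(w in Ws) (Cw w T)%:R))).
  apply: Ex_le => T; case: existsP => [[w /and3P [wV w14 cw]]|_]; last first.
    exact: sumr_ge0.
  have /and3P [w0 /andP [zw ev] _] := cw.
  rewrite (bigD1 w) /= ?inE ?wV ?w14 ?zw ?(even_values_card ev)// cw.
  by rewrite lerDl sumr_ge0.
rewrite Ex_sum.
have cardW : (#|Ws| <= 2 ^ s)%N.
  apply: (@leq_trans (2 ^ #|V :\: V1|)); last by rewrite leq_pexp2l.
  rewrite -card_powerset -(@card_in_imset _ _ (fun w => w :\: V1)).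
    apply: subset_leq_card; apply/subsetP => u /imsetP [w]; rewrite !inE => /and4P [wV _ _ _] ->.
    exact: setSD.
  move=> w w'; rewrite !inE => /and4P [wV _ _ zw] /and4P [wV' _ _ zw'] e.
  apply/eqP; rewrite -sym_diff_eq0; apply: contraNT d1 => ne.
  apply/existsP; exists (sym_diff w w'); rewrite ne zero_set_sym_diff// !andbT.
  apply/subsetP => y; move/setP/(_ y): e; rewrite !inE.
  by case: (y \in V1) => //=; case: (y \in w); case: (y \in w').
apply: (@le_trans _ _ (\sum_(w in Ws) (rb + q))); last first.
  rewrite sumr_const -[leLHS]mulr_natl /eta ler_wpM2r ?addr_ge0//.
  by rewrite -natrX ler_nat.
apply: ler_sum => w; rewrite inE => /and4P [wV w14 we zw].
(* Up to [U] keys the count of matchings suffices; beyond, at least [t.*2] keys of [w] lie in [V1]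
   and the parity bound applies. *)
have [wU|wU] := leqP #|w| U.
  apply: le_trans (circuit_prob Rt _ _ _ _) _.
  by apply: le_trans (hrb _ w14 we wU) _; rewrite lerDl.
have wD : (#|w :\: (w :&: V1)| <= s)%N.
  apply: leq_trans hs; apply: subset_leq_card; apply/subsetP => y; rewrite !inE negb_and.
  by case: (boolP (y \in w)) => //= yw; rewrite andbT => ->; rewrite (subsetP wV).
have nd : ~~ dep (dseq H) j (w :&: V1) by apply: contra d1; apply: depS; apply: subsetIr.
have tB : (t.*2 <= #|w :&: V1|)%N.
  rewrite -(leq_add2l s); apply: leq_trans hU (leq_trans (ltnW wU) _).
  by rewrite -(cardsID (w :&: V1) w) setIA setIid addnC leq_add2r.
have := @large_prob Rt k _ (dseq H) j (level_shift i) w (w :&: V1) s t x x0 x1 (subsetIl _ _) nd wD tB.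
rewrite -/q => hq; apply: (@le_trans _ _ q); last by rewrite lerDr.
apply: le_trans hq; apply: Ex_le => T; rewrite ler_nat.
by rewrite /Cw /circuit; case: (even_values _ w); rewrite ?andbF//; case: (_ && _).
Qed.

End LevelProb.

End WithField.
#[global] Arguments match_rate {Rt} k a.

(** * Dependence on the lower characters *)

Section WithField.
Variable Rt : realFieldType.
Local Notation Ex := (@Ex Rt _).

(* [small_coef a * (3 / n) ^ j] bounds the probability that a fixed set of [a] keys becomes a
   minimal zero set after [j] levels; the values solve the recursion in [match_rate_sub_coef]. *)
Definition small_num (a : nat) : nat :=
  match a with
  | 4 => 100 * 100 | 6 => 3200 | 8 => 450 | 10 => 60 | 12 => 7 | 14 => 1 | _ => 0
  end.

(** The denominator 10000 and the numerator for [a = 4] are written as products to avoid large unary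
    numerals. *)
Definition small_coef (a : nat) : Rt := (small_num a)%:R / (100%:R * 100%:R).

Definition small_sizes := [:: 4; 6; 8; 10; 12; 14]%N.

(** The cost of a union bound over the circuits of at most 14 keys among [l] keys, in the units of
    [small_coef]. *)
Definition sub_coef (l : nat) : Rt := \sum_(a <- small_sizes) ('C(l, a))%:R * small_coef a.

Lemma small_coef_ge0 a : 0 <= small_coef a.
Proof. exact: (divr_ge0 (ler0n _ _) (mulr_ge0 (ler0n _ _) (ler0n _ _))). Qed.

Lemma small_sizesP a : (a <= 14)%N -> (4 <= a)%N -> ~~ odd a -> a \in small_sizes.
Proof. by do 15! [case: a => [//|a]]. Qed.

Lemma small_coef_values :
  [/\ small_coef 4 = 1, small_coef 6 = 32%:R / 100%:R, small_coef 8 = 45%:R / 1000%:R &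
  [/\ small_coef 10 = 6%:R / 1000%:R, small_coef 12 = 7%:R / (100%:R * 100%:R) &
      small_coef 14 = 1 / (100%:R * 100%:R)]].
Proof.
rewrite /small_coef /small_num natrM; split; [| | | split]; [|lra|lra|lra|lra|lra].
have h : (100%:R : Rt) != 0 by rewrite pnatr_eq0.
exact: (divff (mulf_neq0 h h)).
Qed.

Lemma sub_coef_values :
  [/\ sub_coef 4 = 1, sub_coef 6 = 15%:R + 32%:R / 100%:R,
      sub_coef 8 = 70%:R + 28%:R * (32%:R / 100%:R) + 45%:R / 1000%:R &
  [/\ sub_coef 10 = 210%:R + 210%:R * (32%:R / 100%:R) + 45%:R * (45%:R / 1000%:R) + 6%:R / 1000%:R,
      sub_coef 12 = 495%:R + 924%:R * (32%:R / 100%:R) + 495%:R * (45%:R / 1000%:R)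
        + 66%:R * (6%:R / 1000%:R) + 7%:R / (100%:R * 100%:R) &
      sub_coef 14 = 1001%:R + 3003%:R * (32%:R / 100%:R) + 3003%:R * (45%:R / 1000%:R)
        + 1001%:R * (6%:R / 1000%:R) + 91%:R * (7%:R / (100%:R * 100%:R))
        + 1 / (100%:R * 100%:R)]].
Proof.
have [c4 c6 c8 [c10 c12 c14]] := small_coef_values.
have bE m p q : 'C(m, p) == q -> 'C(m, p) = q by move/eqP.
have b0 m p : (m < p)%N -> 'C(m, p) = 0%N by move/bin_small.
rewrite /sub_coef /small_sizes; split; [| | | split]; rewrite !big_cons big_nil c4 c6 c8 c10 c12 c14.
- rewrite !binn (b0 4%N 6%N isT) (b0 4%N 8%N isT) (b0 4%N 10%N isT) (b0 4%N 12%N isT) (b0 4%N 14%N isT); clear; lra.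
- rewrite (bE 6%N 4%N 15%N isT) !binn (b0 6%N 8%N isT) (b0 6%N 10%N isT) (b0 6%N 12%N isT) (b0 6%N 14%N isT); clear; lra.
- rewrite (bE 8%N 4%N 70%N isT) (bE 8%N 6%N 28%N isT) !binn (b0 8%N 10%N isT) (b0 8%N 12%N isT) (b0 8%N 14%N isT); clear; lra.
- rewrite (bE 10%N 4%N 210%N isT) (bE 10%N 6%N 210%N isT) (bE 10%N 8%N 45%N isT) !binn (b0 10%N 12%N isT) (b0 10%N 14%N isT); clear; lra.
- rewrite (bE 12%N 4%N 495%N isT) (bE 12%N 6%N 924%N isT) (bE 12%N 8%N 495%N isT) (bE 12%N 10%N 66%N isT) !binn (b0 12%N 14%N isT); clear; lra.
- rewrite (bE 14%N 4%N 1001%N isT) (bE 14%N 6%N 3003%N isT) (bE 14%N 8%N 3003%N isT) (bE 14%N 10%N 1001%N isT) (bE 14%N 12%N 91%N isT) !binn; clear; lra.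
Qed.

Lemma sub_coef_ge0 l : 0 <= sub_coef l.
Proof. by apply: sumr_ge0 => a _; rewrite mulr_ge0 ?ler0n ?small_coef_ge0. Qed.

Lemma sub_coef0 : sub_coef 0 = 0.
Proof.
rewrite /sub_coef big_seq big1// => a aa; rewrite bin0n (_ : (a == 0)%N = false) ?mul0r//.
by case: a aa.
Qed.

Lemma sum_card_sub (T : finType) (V : {set T}) (g : nat -> Rt) :
  (forall a, a \notin small_sizes -> g a = 0) ->
  \sum_(w : {set T} | w \subset V) g #|w| = \sum_(a <- small_sizes) ('C(#|V|, a))%:R * g a.
Proof.
move=> g0; rewrite (eq_bigr (fun w : {set T} => \sum_(a <- small_sizes) (#|w| == a)%:R * g a)).
  rewrite exchange_big; apply: eq_bigr => a _ /=; rewrite -mulr_suml; congr (_ * _).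
  rewrite -cards_draws -sum1_card natr_sum.
  rewrite [RHS](eq_bigl (fun w : {set T} => (w \subset V) && (#|w| == a))) => [|w]; last first.
    by rewrite inE.
  by rewrite [RHS]big_mkcondr; apply: eq_bigr => w _; case: eqP.
move=> w _; have [wa|wa] := boolP (#|w| \in small_sizes); last first.
  rewrite g0// big_seq big1// => a aa; rewrite (_ : (_ == _) = false) ?mul0r//.
  by apply: contraNF wa => /eqP ->.
rewrite (bigD1_seq _ wa)//= eqxx mul1r big1 ?addr0// => a.
by rewrite eq_sym => /negPf ->; rewrite mul0r.
Qed.

Lemma small_coef_out a : a \notin small_sizes -> small_coef a = 0.
Proof.
move=> h; have -> : small_coef a = 0; last by [].
rewrite /small_coef (_ : small_num a = 0%N) ?mul0r; first by [].
move: h; by do 15! [case: a => [//|a]].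
Qed.

(** The recursion for an alphabet of size 256. It is an equality at [a = 4]: four keys have three
    matchings, which is the origin of the 3 in [3 / n]. *)
Lemma npair_sub_coef a : a \in small_sizes ->
  (npair a)%:R * sub_coef a <= 3%:R * small_coef a * 256%:R ^+ a./2.-2 /\ 1 <= sub_coef a.
Proof.
have np a' : (npair a'.+2)%:R = a'.+1%:R * (npair a')%:R :> Rt by rewrite -natrM.
have [c4 c6 c8 [c10 c12 c14]] := sub_coef_values.
have [d4 d6 d8 [d10 d12 d14]] := small_coef_values.
have np0 : (npair 0)%:R = 1 :> Rt by [].
rewrite !inE => /or4P [/eqP ->|/eqP ->|/eqP ->|/or3P [/eqP ->|/eqP ->|/eqP ->]];
  rewrite ?c4 ?c6 ?c8 ?c10 ?c12 ?c14 !np np0 ?d4 ?d6 ?d8 ?d10 ?d12 ?d14 /=;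
  clear; split; lra.
Qed.

Section Small.
Variables (k c d : nat).
Hypotheses (hk : (8 <= k)%N) (hc : (0 < c)%N) (hd : (1 < d)%N).
Local Notation n := (#|bits k|%:R : Rt).

Lemma card_bits r : #|bits r| = (2 ^ r)%N.
Proof. by rewrite card_mx card_Fp// mul1n. Qed.

Lemma n_ge : 256%:R <= n.
Proof. by rewrite card_bits ler_nat (@leq_pexp2l 2 8 k). Qed.

Lemma n_gt0 : 0 < n.
Proof. exact: lt_le_trans n_ge. Qed.

(** Larger alphabets only help, because 256 occurs with a nonnegative exponent on the favourable
    side. *)
Lemma match_rate_sub_coef a : a \in small_sizes -> match_rate k a * sub_coef a <= small_coef a * (3%:R / n).
Proof.
move=> ha; have [h _] := npair_sub_coef ha; have n0 := n_gt0.
have np : (npair a)%:R * sub_coef a <= 3%:R * small_coef a * n ^+ a./2.-2.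
  have e : 256%:R ^+ a./2.-2 <= n ^+ a./2.-2 by rewrite lerXn2r ?nnegrE ?ler0n ?n_ge.
  exact: (le_trans h (ler_wpM2l (mulr_ge0 (ler0n _ _) (small_coef_ge0 _)) e)).
have a2 : (a./2.-1 = a./2.-2.+1)%N.
  by move: ha; rewrite !inE => /or4P [/eqP ->|/eqP ->|/eqP ->|/or3P [/eqP ->|/eqP ->|/eqP ->]].
have -> : small_coef a * (3%:R / n) = 3%:R * small_coef a * n ^+ a./2.-2 * (n ^+ a./2.-1)^-1.
  by rewrite a2 exprS; field; rewrite ?expf_neq0 ?lt0r_neq0.
by rewrite /match_rate mulrAC ler_wpM2r// invr_ge0 exprn_ge0// ltW.
Qed.

Lemma match_rate_le a : a \in small_sizes -> match_rate k a <= small_coef a * (3%:R / n).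
Proof.
move=> ha; apply: le_trans (match_rate_sub_coef ha); rewrite ler_peMr ?match_rate_ge0//.
by have [] := npair_sub_coef ha.
Qed.

Lemma dep_circuit (H : htil_tables k c d) j V :
  (c <= j)%N -> dep (dseq H) j V ->
  exists w : {set key k c}, [/\ w \subset V, circuit (zero_set (dseq H) j) w, (4 <= #|w|)%N, ~~ odd #|w| & key_sum0 w].
Proof.
move=> cj /existsP [w /and3P [wV w0 zw]].
have [w' cw' ww'] := circuit_exists w0 zw.
have /and3P [w'0 zw' _] := cw'.
have /andP [w4 we] := zero_set_card hc hd (zero_setW cj zw') w'0.
by exists w'; rewrite (subset_trans ww' wV) (zero_set_key_sum0 hc hd (zero_setW cj zw')).
Qed.

Lemma circuit_out (H : htil_tables k c d) j (w : {set key k c}) :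
  (c <= j)%N -> circuit (zero_set (dseq H) j) w -> [/\ (4 <= #|w|)%N, ~~ odd #|w| & key_sum0 w].
Proof.
move=> cj /and3P [w0 zw _].
have /andP [w4 we] := zero_set_card hc hd (zero_setW cj zw) w0.
by split=> //; apply: (zero_set_key_sum0 hc hd (zero_setW cj zw)).
Qed.

Let x3 := 3%:R / n.
Lemma x3_ge0 : 0 <= x3.
Proof. by rewrite divr_ge0// ltW ?n_gt0. Qed.

Lemma x3n_ge0 j : 0 <= x3 ^+ j.
Proof. exact: exprn_ge0 x3_ge0. Qed.

Lemma dep_small (i : 'I_d.-1) (V : {set key k c}) (C : Rt) : 0 <= C -> (#|V| <= 14)%N ->
  (forall w : {set key k c}, (#|w| <= 14)%N ->
    Ex (fun H : htil_tables k c d => (circuit (zero_set (dseq H) (c + i)) w)%:R) <= small_coef #|w| * C) ->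
  Ex (fun H : htil_tables k c d => (dep (dseq H) (c + i) V)%:R) <= sub_coef #|V| * C.
Proof.
move=> C0 V14 hZ.
apply: (@le_trans _ _ (Ex (fun H : htil_tables k c d =>
   \sum_(w : {set key k c} | w \subset V) (circuit (zero_set (dseq H) (c + i)) w)%:R))).
  apply: Ex_le => H; case: (boolP (dep _ _ _)) => [h|_]; last exact: sumr_ge0.
  have [w [wV cw _ _ _]] := dep_circuit (leq_addr _ _) h.
  by rewrite (bigD1 w)//= cw lerDl sumr_ge0.
rewrite Ex_sum /sub_coef -(sum_card_sub V small_coef_out) mulr_suml; apply: ler_sum => w wV.
by apply: hZ; apply: leq_trans V14; apply: subset_leq_card.
Qed.

(** Induction on the level: the newest table costs [match_rate], and dependence of [w] one level
    below costs [sub_coef #|w|] by a union bound; [match_rate_sub_coef] turns the product into one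
    more factor [x3]. *)
Lemma circuit_small (i : nat) (hi : (i < d.-1)%N) (w : {set key k c}) : (#|w| <= 14)%N ->
  Ex (fun H : htil_tables k c d => (circuit (zero_set (dseq H) (c + i)) w)%:R)
  <= (key_sum0 w)%:R * small_coef #|w| * x3 ^+ i.+1.
Proof.
elim/ltn_ind: i hi w => i IH hi w.
have bnd0 i' w' : 0 <= (key_sum0 w')%:R * small_coef #|w' : {set key k c}| * x3 ^+ i'.
  exact: (mulr_ge0 (mulr_ge0 (ler0n _ _) (small_coef_ge0 _)) (x3n_ge0 _)).
move=> w14; have [/and3P [w4 we wk]|out] := boolP [&& 4 <= #|w|, ~~ odd #|w| & key_sum0 w]%N; last first.
  apply: Ex_le_const => [|H]; first exact: bnd0.
  case: (boolP (circuit _ _)) => [cw|_]; last exact: bnd0.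
  by have [w4 we wk] := circuit_out (leq_addr _ _) cw; case/negP: out; rewrite w4 we.
have wa := small_sizesP w14 w4 we; rewrite wk mul1r.
case: i hi IH => [|i] hi IH.
  rewrite expr1; apply: le_trans (match_rate_le wa).
  apply: le_trans (circuit_level Rt hc hd (Ordinal hi) w) _.
  by rewrite -[leRHS]mulr1 ler_wpM2l ?match_rate_ge0 ?Pr_le1.
apply: le_trans (circuit_level Rt hc hd (Ordinal hi) w) _.
have ci : (c + Ordinal hi - 1 = c + i)%N by rewrite /=; lia.
rewrite (eq_Ex (g := fun H : htil_tables k c d => (dep (dseq H) (c + i) w)%:R)); last first.
  by move=> H; rewrite ci.
have hi' : (i < d.-1)%N := ltn_trans (ltnSn i) hi.
apply: (@le_trans _ _ (match_rate k #|w| * (sub_coef #|w| * x3 ^+ i.+1))).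
  rewrite ler_wpM2l ?match_rate_ge0//.
  apply: (@dep_small (Ordinal hi')) => // [|w' w'14]; first exact: x3n_ge0.
  apply: le_trans (IH i (ltnSn i) hi' w' w'14) _; rewrite -mulrA ler_piMl//; first exact: (mulr_ge0 (small_coef_ge0 _) (x3n_ge0 _)).
  by case: (key_sum0 w').
by rewrite mulrA (exprS x3 i.+1) mulrA ler_wpM2r ?x3n_ge0 ?match_rate_sub_coef.
Qed.

(** In contrast to [sub_coef] this remembers which subsets satisfy the sum condition, so that a
    later sum over the last key can save a factor mu. *)
Definition small_sum (V : {set key k c}) : Rt :=
  \sum_(w : {set key k c} | w \subset V) (key_sum0 w)%:R * small_coef #|w|.

Lemma small_sum_ge0 V : 0 <= small_sum V.
Proof. by apply: sumr_ge0 => w _; rewrite mulr_ge0 ?ler0n ?small_coef_ge0. Qed.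

Lemma small_sum_sub_coef V : small_sum V <= sub_coef #|V|.
Proof.
rewrite /sub_coef -(sum_card_sub V small_coef_out); apply: ler_sum => w _.
by rewrite ler_piMl ?ler0n ?small_coef_ge0//; case: (key_sum0 w).
Qed.

Variables (s : nat) (e : Rt).
Hypothesis e0 : 0 <= e.
Hypothesis Hsplit : forall (i : 'I_d.-1) (V V1 : {set key k c}),
  V1 \subset V -> (#|V :\: V1| <= s)%N ->
  Ex (fun H : htil_tables k c d =>
    [exists w : {set key k c}, [&& w \subset V, (14 < #|w|)%N & circuit (zero_set (dseq H) (c + i)) w]]%:R)
  <= Ex (fun H : htil_tables k c d => (dep (dseq H) (c + i - 1) V1)%:R)
   + e * Ex (fun H : htil_tables k c d => (dep (dseq H) (c + i - 1) V)%:R).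

(* [seq_bound] collects the circuits of at most 14 keys, [long_bound] what remains when the splits
   are unrolled down to level 0. *)
Fixpoint seq_bound (j : nat) (xs : seq (key k c)) : Rt :=
  if j is j'.+1 then small_sum [set x in xs] * x3 ^+ j + seq_bound j' (take (size xs - s) xs) + e * seq_bound j' xs
  else 0.

Lemma seq_bound_ge0 j xs : 0 <= seq_bound j xs.
Proof.
by elim: j xs => //= j IH xs; rewrite !addr_ge0 ?(mulr_ge0 e0)// mulr_ge0 ?small_sum_ge0 ?x3n_ge0.
Qed.

Fixpoint long_bound (j : nat) (l : nat) : Rt :=
  if j is j'.+1 then long_bound j' (l - s) + e * long_bound j' l else (0 < l)%:R.

Lemma long_bound_ge0 j l : 0 <= long_bound j l.
Proof. by elim: j l => //= j IH l; rewrite !addr_ge0 ?mulr_ge0. Qed.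

Lemma card_take_setD (xs : seq (key k c)) :
  (#|[set x in xs] :\: [set x in take (size xs - s) xs]| <= s)%N.
Proof.
have sub : [set x in xs] :\: [set x in take (size xs - s) xs] \subset drop (size xs - s) xs.
  apply/subsetP => x; rewrite !inE => /andP [nt].
  by rewrite -{1}(cat_take_drop (size xs - s) xs) mem_cat (negPf nt).
by apply: leq_trans (subset_leq_card sub) _; apply: leq_trans (card_size _) _; rewrite size_drop leq_subLR addnC -leq_subLR.
Qed.

Lemma take_subset (xs : seq (key k c)) p : [set x in take p xs] \subset [set x in xs].
Proof. by apply/subsetP => x; rewrite !inE; apply: mem_take. Qed.

(** At each level [circuit_small] pays for circuits of at most 14 keys and [Hsplit] for longer ones;
    the latter leads one level down, to the shortened and to the full sequence. *)
Lemma dep_bound (j : nat) (xs : seq (key k c)) : (j <= d.-1)%N ->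
  Ex (fun H : htil_tables k c d => (dep (dseq H) (c + j - 1) [set x in xs])%:R)
  <= seq_bound j xs + long_bound j (size xs).
Proof.
elim: j xs => [|j IH] xs hj.
  (* At level 0 only the empty sequence is surely independent, hence the value [(0 < l)%:R] of
     [long_bound]. *)
  rewrite /= add0r; case: xs => [|x xs] /=; last exact: Pr_le1.
  apply: Ex_le_const => // H; case: (boolP (dep _ _ _)) => // /existsP [w /and3P [ws /set0Pn [y yw] _]].
  by have := subsetP ws y yw; rewrite inE.
pose i := Ordinal hj; have hj' : (j <= d.-1)%N := ltnW hj.
have ci : (c + j.+1 - 1 = c + i)%N by rewrite /=; lia.
rewrite (eq_Ex (g := fun H : htil_tables k c d => (dep (dseq H) (c + i) [set x in xs])%:R)); last first.
  by move=> H; rewrite ci.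
pose V := [set x in xs]; pose V1 := [set x in take (size xs - s) xs].
have sp := Hsplit i (take_subset xs _) (card_take_setD xs).
apply: (@le_trans _ _ (Ex (fun H : htil_tables k c d =>
  \sum_(w : {set key k c} | (w \subset V) && (#|w| <= 14)%N) (circuit (zero_set (dseq H) (c + i)) w)%:R +
    [exists w : {set key k c}, [&& w \subset V, (14 < #|w|)%N & circuit (zero_set (dseq H) (c + i)) w]]%:R))).
  apply: Ex_le => H; case: (boolP (dep _ _ _)) => [h|_]; last by rewrite addr_ge0 ?sumr_ge0.
  have [w [wV cw _ _ _]] := dep_circuit (leq_addr _ _) h.
  have [w14|w14] := leqP #|w| 14.
    by rewrite (bigD1 w) ?wV//= cw -addrA lerDl addr_ge0 ?sumr_ge0.
  rewrite (_ : [exists _, _] = true) ?lerDr ?sumr_ge0//.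
  by apply/existsP; exists w; rewrite wV w14.
rewrite ExD Ex_sum /=.
have -> : small_sum [set x in xs] * x3 ^+ j.+1 + seq_bound j (take (size xs - s) xs) + e * seq_bound j xs +
   (long_bound j (size xs - s) + e * long_bound j (size xs)) =
   small_sum [set x in xs] * x3 ^+ j.+1 + ((seq_bound j (take (size xs - s) xs) + long_bound j (size xs - s)) +
    e * (seq_bound j xs + long_bound j (size xs))) by ring.
apply: lerD.
  rewrite /small_sum mulr_suml big_mkcondr /=; apply: ler_sum => w _; case: ifP => w14.
    exact: (circuit_small hj w14).
  exact: (mulr_ge0 (mulr_ge0 (ler0n _ _) (small_coef_ge0 _)) (x3n_ge0 _)).
apply: le_trans sp _.
have st : size (take (size xs - s) xs) = (size xs - s)%N by rewrite size_takel ?leq_subr.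
have := IH (take (size xs - s) xs) hj'; rewrite st => IH1.
by apply: lerD; [exact: IH1 | rewrite ler_wpM2l// IH].
Qed.

Local Notation keyt := (key k c).
(** The bound for circuits of more than 14 keys at the top level; the [long_bound] terms of the two
    sequences below it recombine into a single one at [d.-1]. *)
Definition tail_bound (xs : seq keyt) : Rt :=
  seq_bound d.-2 (take (size xs - s) xs) + e * seq_bound d.-2 xs + long_bound d.-1 (size xs).

Definition small_sum_last (ys : seq keyt) (z : keyt) : Rt :=
  \sum_(w : {set keyt} | (w \subset [set x in rcons ys z]) && (z \in w)) (key_sum0 w)%:R * small_coef #|w|.

Lemma large_tail (i : 'I_d.-1) (xs : seq keyt) : val i = d.-2 ->
  Ex (fun H : htil_tables k c d => [exists w : {set keyt},
     [&& w \subset [set x in xs], (14 < #|w|)%N & circuit (zero_set (dseq H) (c + i)) w]]%:R)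
  <= (14 < size xs)%N%:R * tail_bound xs.
Proof.
move=> iE; have [l14|l14] := leqP (size xs) 14.
  rewrite mul0r; apply: Ex_le_const => // H.
  case: (boolP [exists w : {set keyt}, _]) => // /existsP [w /and3P [wV w14 _]].
  have cx : (#|[set x in xs]| <= size xs)%N by rewrite cardsE card_size.
  by have := leq_trans w14 (leq_trans (subset_leq_card wV) (leq_trans cx l14)); rewrite ltnn.
rewrite mul1r; apply: le_trans (Hsplit i (take_subset xs _) (card_take_setD xs)) _.
have st : size (take (size xs - s) xs) = (size xs - s)%N by rewrite size_takel ?leq_subr.
have hj : (d.-2 <= d.-1)%N := leq_pred _.
have := dep_bound (take (size xs - s) xs) hj; rewrite st => IH1.
have IH2 := dep_bound xs hj.
have -> : tail_bound xs = (seq_bound d.-2 (take (size xs - s) xs) + long_bound d.-2 (size xs - s))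
    + e * (seq_bound d.-2 xs + long_bound d.-2 (size xs)).
  have d2 : (d.-1 = d.-2.+1)%N by lia.
  by rewrite /tail_bound [in X in long_bound X]d2 /=; ring.
by rewrite iE; apply: lerD; [exact: IH1 | rewrite ler_wpM2l].
Qed.

(** As [ys] is independent, every circuit passes through [z], so only [small_sum_last] is
    charged. *)
Lemma top_dep (ys : seq keyt) (z : keyt) :
  Ex (fun H : htil_tables k c d => (~~ dep (dseq H) (c + d - 2) [set x in ys] &&
        dep (dseq H) (c + d - 2) [set x in rcons ys z])%:R)
  <= small_sum_last ys z * x3 ^+ d.-1 + (14 < (size ys).+1)%N%:R * tail_bound (rcons ys z).
Proof.
have hi : (d.-2 < d.-1)%N by lia.
pose i := Ordinal hi; have ci : (c + d - 2 = c + i)%N by rewrite /=; lia.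
pose V := [set x in rcons ys z].
have lt := @large_tail i (rcons ys z) erefl; rewrite size_rcons in lt.
apply: (@le_trans _ _ (Ex (fun H : htil_tables k c d =>
  \sum_(w : {set keyt} | [&& w \subset V, z \in w & (#|w| <= 14)%N]) (circuit (zero_set (dseq H) (c + i)) w)%:R +
    [exists w : {set keyt}, [&& w \subset V, (14 < #|w|)%N & circuit (zero_set (dseq H) (c + i)) w]]%:R))).
  apply: Ex_le => H; case: (boolP (_ && _)) => [/andP [nd h]|_]; last by rewrite addr_ge0 ?sumr_ge0.
  rewrite ci in nd h; have [w [wV cw _ _ _]] := dep_circuit (leq_addr _ _) h.
  have zw : z \in w.
    apply: contraNT nd => zw; have /and3P [w0 zsw _] := cw.
    apply/existsP; exists w; rewrite w0 zsw !andbT; apply/subsetP => x xw.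
    have := subsetP wV x xw; rewrite !inE mem_rcons inE => /orP [/eqP xz|//].
    by move: zw; rewrite -xz xw.
  have [w14|w14] := leqP #|w| 14.
    by rewrite (bigD1 w) ?wV ?zw//= cw -addrA lerDl addr_ge0 ?sumr_ge0.
  rewrite (_ : [exists _, _] = true) ?lerDr ?sumr_ge0//.
  by apply/existsP; exists w; rewrite wV w14.
rewrite ExD Ex_sum /=; apply: lerD; last exact: lt.
rewrite /small_sum_last mulr_suml.
under eq_bigl do rewrite andbA.
rewrite big_mkcondr /=; apply: ler_sum => w _; case: ifP => w14.
  have := circuit_small hi w14; have -> : d.-2.+1 = d.-1 by lia.
  by [].
exact: (mulr_ge0 (mulr_ge0 (ler0n _ _) (small_coef_ge0 _)) (x3n_ge0 _)).
Qed.

(** The whole sequence is then a circuit: a proper nonempty zero subset would contain [z], and its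
    symmetric difference with the whole would be a nonempty zero set inside [ys]. So a single
    circuit is charged, and its sum condition remains available to determine [z]. *)
Lemma top_full (ys : seq keyt) (z : keyt) : uniq (rcons ys z) ->
  Ex (fun H : htil_tables k c d => (~~ dep (dseq H) (c + d - 2) [set x in ys] &&
        zero_set (dseq H) (c + d - 2) [set x in rcons ys z])%:R)
  <= (key_sum0 [set x in rcons ys z])%:R *
     (small_coef (size ys).+1 * x3 ^+ d.-1 + (14 < (size ys).+1)%N%:R * tail_bound (rcons ys z)).
Proof.
move=> uz; have hi : (d.-2 < d.-1)%N by lia.
pose i := Ordinal hi; have ci : (c + d - 2 = c + i)%N by rewrite /=; lia.
pose V := [set x in rcons ys z].
have cV : #|V| = (size ys).+1 by rewrite cardsE (card_uniqP uz) size_rcons.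
have lt := @large_tail i (rcons ys z) erefl; rewrite size_rcons in lt.
have [ks|ks] := boolP (key_sum0 V); last first.
  rewrite mul0r; apply: Ex_le_const => // H; case: (boolP (_ && _)) => // /andP [_ zs].
  by case/negP: ks; apply: (zero_set_key_sum0 hc hd (zero_setW _ zs)); lia.
have circ (H : htil_tables k c d) : ~~ dep (dseq H) (c + d - 2) [set x in ys] -> zero_set (dseq H) (c + d - 2) V ->
    circuit (zero_set (dseq H) (c + i)) V.
  rewrite ci => nd zV; apply/and3P; split=> //; first by rewrite -card_gt0 cV.
  have nod (w : {set keyt}) : w \subset [set x in ys] -> zero_set (dseq H) (c + i) w -> w = set0.
    move=> wy zw; apply/eqP; apply: contraNT nd => w0; apply/existsP; exists w.
    by rewrite wy w0.
  have sub (w : {set keyt}) : w \subset V -> z \notin w -> w \subset [set x in ys].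
    move=> wV zw; apply/subsetP => x xw; have := subsetP wV x xw.
    by rewrite !inE mem_rcons inE => /orP [/eqP xz|//]; rewrite -xz xw in zw.
  apply/forallP => w; apply/implyP => /andP [/properP [wV [x xV xw]] zw].
  have [zin|zin] := boolP (z \in w); last by rewrite (nod w (sub w wV zin) zw).
  have s0 : sym_diff V w = set0.
    apply: nod; last exact: zero_set_sym_diff.
    apply: sub; last by rewrite !inE zin mem_rcons inE eqxx.
    by apply/subsetP => y; rewrite !inE => /orP [/andP []//|/andP [/negP ny /(subsetP wV)]]; rewrite inE.
  by move/setP/(_ x): s0; rewrite !inE xw; move: xV; rewrite inE => ->.
rewrite mul1r; have [l14|l14] := leqP (size ys).+1 14.
  apply: (@le_trans _ _ (Ex (fun H : htil_tables k c d => (circuit (zero_set (dseq H) (c + i)) V)%:R))).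
    apply: Ex_le => H; rewrite ler_nat; case: (boolP (_ && _)) => // /andP [nd zs].
    by rewrite (circ H nd zs).
  rewrite mul0r addr0; have := @circuit_small _ hi V; rewrite cV ks mul1r => /(_ l14).
  by have -> : d.-2.+1 = d.-1 by lia.
apply: (@le_trans _ _ (Ex (fun H : htil_tables k c d => [exists w : {set keyt},
     [&& w \subset V, (14 < #|w|)%N & circuit (zero_set (dseq H) (c + i)) w]]%:R))).
  apply: Ex_le => H; rewrite ler_nat; case: (boolP (_ && _)) => // /andP [nd zs].
  rewrite lt0b; apply/existsP; exists V; rewrite subxx cV l14 /=; exact: circ.
apply: le_trans lt _; rewrite l14 lerDr.
exact: (mulr_ge0 (small_coef_ge0 _) (x3n_ge0 _)).
Qed.

Lemma key_sum0_uniq (A : {set keyt}) (z z' : keyt) : z \notin A -> z' \notin A ->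
  key_sum0 (z |: A) -> key_sum0 (z' |: A) -> z = z'.
Proof.
move=> zA z'A /forallP h /forallP h'.
apply/val_inj/(@eq_from_nth _ 0); rewrite !size_tuple// => p pc.
have /eqP := h (Ordinal pc); have /eqP := h' (Ordinal pc).
rewrite !big_setU1//= => e' e1.
have : nth 0 z p + \sum_(x in A) nth 0 x p = nth 0 z' p + \sum_(x in A) nth 0 x p by rewrite e1 e'.
exact: addIr.
Qed.

(** The share of [sub_coef] due to circuits through the last of [l] keys; [sub_coefS] is Pascal's
    rule. *)
Definition sub_coef_last (l : nat) : Rt := \sum_(a <- small_sizes) ('C(l.-1, a.-1))%:R * small_coef a.

Lemma sub_coef_last_ge0 l : 0 <= sub_coef_last l.
Proof. by apply: sumr_ge0 => a _; rewrite (mulr_ge0 (ler0n _ _) (small_coef_ge0 _)). Qed.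

Lemma sub_coefS l : sub_coef l.+1 = sub_coef l + sub_coef_last l.+1.
Proof.
rewrite /sub_coef /sub_coef_last -big_split; apply: eq_big_seq => a aa /=; rewrite -mulrDl -natrD.
by case: a aa => [//|a] _; rewrite binS.
Qed.

(** * Sums over key sequences weighted by selection probabilities *)

Section Weights.
Variable p : keyt -> Rt.
Hypotheses (p0 : forall x, 0 <= p x) (p1 : forall x, p x <= 1).
Local Notation mu := (\sum_x p x).

Definition weight (xs : seq keyt) : Rt := \prod_(x <- xs) p x.

Lemma weight_ge0 xs : 0 <= weight xs. Proof. exact: prodr_ge0. Qed.

Lemma weight_rcons ys z : weight (rcons ys z) = weight ys * p z.
Proof. by rewrite /weight -cats1 big_cat big_seq1. Qed.

Lemma mu_ge0 : 0 <= mu. Proof. exact: sumr_ge0. Qed.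

(** For each subset of [ys] the sum condition leaves at most one [z], so the sum over all keys costs
    no factor mu. *)
Lemma sum_small_last ys :
  \sum_(z | uniq (rcons ys z)) small_sum_last ys z <= sub_coef_last (size ys).+1.
Proof.
have [uy|uy] := boolP (uniq ys); last first.
  by rewrite big1 ?sub_coef_last_ge0// => z; rewrite rcons_uniq (negPf uy) andbF.
apply: (@le_trans _ _ (\sum_(z | uniq (rcons ys z))
   \sum_(A : {set keyt} | A \subset [set x in ys]) (key_sum0 (z |: A))%:R * small_coef #|A|.+1)).
  apply: ler_sum => z; rewrite rcons_uniq => /andP [zy _].
  rewrite /small_sum_last (reindex_onto (fun A => z |: A) (fun w => w :\ z)) /=; last first.
    by move=> w /andP [_ zw]; rewrite setD1K.
  rewrite le_eqVlt; apply/orP; left; apply/eqP; apply: eq_big => [A|A].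
    rewrite !inE eqxx andbT; apply/andP/idP => [[wV /eqP <-]|Ay].
      apply/subsetP => x; rewrite !inE => /andP [xz /orP [/eqP xz'|xA]]; first by rewrite xz' eqxx in xz.
      have /(subsetP wV) : x \in z |: A by rewrite !inE xA orbT.
      by rewrite inE mem_rcons inE (negPf xz).
    have zA : z \notin A by apply: contra zy => /(subsetP Ay); rewrite inE.
    split; last by rewrite setU1K.
    apply/subsetP => x; rewrite !inE mem_rcons inE => /orP [->//|/(subsetP Ay)].
    by rewrite inE => ->; rewrite orbT.
  move=> /andP [/andP [_ _] /eqP zA]; congr (_ * small_coef _).
  by rewrite cardsU1 -zA !inE eqxx zA.
rewrite exchange_big /=.
rewrite /sub_coef_last (_ : \sum_(a <- small_sizes) _ = \sum_(A : {set keyt} | A \subset [set x in ys]) small_coef #|A|.+1).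
  apply: ler_sum => A As; rewrite -mulr_suml ler_piMl ?small_coef_ge0//.
  have [/existsP [z0 /andP [u0 k0]]|no] :=
    boolP [exists z : keyt, uniq (rcons ys z) && key_sum0 (z |: A)]; last first.
    rewrite big1 ?ler01// => z uz; rewrite (_ : key_sum0 _ = false)//.
    by apply: contraNF no => kz; apply/existsP; exists z; rewrite uz.
  have nA z : uniq (rcons ys z) -> z \notin A.
    by rewrite rcons_uniq => /andP [zy _]; apply: contra zy => /(subsetP As); rewrite inE.
  rewrite (bigD1 z0)//= k0 big1 ?addr0// => z /andP [uz zz0].
  rewrite (_ : key_sum0 _ = false)//; apply: contraNF zz0 => kz.
  by apply/eqP; apply: key_sum0_uniq kz k0; apply: nA.
rewrite (eq_bigr (fun A : {set keyt} => \sum_(a <- small_sizes) (#|A| == a.-1)%:R * small_coef a)); last first.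
  move=> A _; have [Aa|Aa] := boolP (#|A|.+1 \in small_sizes).
    rewrite (bigD1_seq _ Aa)//= eqxx mul1r big_seq_cond big1 ?addr0// => a /andP [aa ne].
    rewrite (_ : (_ == _) = false) ?mul0r//; apply: contraNF ne => /eqP ->.
    by case: a aa.
  rewrite small_coef_out// big_seq big1// => a aa; rewrite (_ : (_ == _) = false) ?mul0r//.
  by apply: contraNF Aa => /eqP ->; case: a aa.
rewrite exchange_big /=; apply: eq_bigr => a _; rewrite -mulr_suml; congr (_ * _).
have -> : size ys = #|[set x in ys]| by rewrite cardsE (card_uniqP uy).
rewrite -cards_draws -sum1_card natr_sum.
rewrite [LHS](eq_bigl (fun w : {set keyt} => (w \subset [set x in ys]) && (#|w| == a.-1))) => [|w]; last first.
  by rewrite inE.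
by rewrite [LHS]big_mkcondr; apply: eq_bigr => w _; case: eqP.
Qed.

Lemma sum_seqs_rcons (R : nmodType) (T : finType) b (F : seq T -> R) :
  \sum_(t <- seqs T b.+1) F t = \sum_(t <- seqs T b) \sum_x F (rcons t x).
Proof.
elim: b F => [|b IH] F.
  by rewrite sum_seqsS big_seq1; apply: eq_bigr => x _; rewrite big_seq1.
rewrite sum_seqsS; under eq_bigr do rewrite IH.
by rewrite sum_seqsS.
Qed.

Lemma sum_weight b : \sum_(xs <- seqs keyt b) weight xs = mu ^+ b.
Proof.
elim: b => [|b IH]; first by rewrite big_seq1 /weight big_nil.
rewrite sum_seqs_rcons; under eq_bigr do under eq_bigr do rewrite weight_rcons.
by under eq_bigr do rewrite -mulr_sumr; rewrite -mulr_suml IH exprSr.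
Qed.

Lemma sum_wp_take b b' (F : seq keyt -> Rt) :
  \sum_(xs <- seqs keyt (b + b')) weight xs * F (take b xs)
  = mu ^+ b' * \sum_(xs <- seqs keyt b) weight xs * F xs.
Proof.
elim: b' => [|b' IH].
  rewrite addn0 expr0 mul1r big_seq [RHS]big_seq; apply: eq_bigr => xs.
  by rewrite mem_seqs => /eqP h; rewrite take_oversize// h.
rewrite addnS sum_seqs_rcons exprS -mulrA -IH mulr_sumr.
apply: eq_big_seq => xs; rewrite mem_seqs => /eqP h.
under eq_bigr do rewrite weight_rcons -cats1 takel_cat ?h ?leq_addr// mulrAC.
by rewrite -mulr_sumr mulrC.
Qed.

Lemma sum_small_last_weight b :
  \sum_(ys <- seqs keyt b) \sum_(z | uniq (rcons ys z)) weight ys * small_sum_last ys z <= mu ^+ b * sub_coef_last b.+1.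
Proof.
rewrite -sum_weight mulr_suml big_seq [leRHS]big_seq; apply: ler_sum => ys.
rewrite mem_seqs => /eqP h; rewrite -mulr_sumr ler_wpM2l ?weight_ge0//.
by rewrite -h; apply: sum_small_last.
Qed.

Lemma small_sum_rcons ys z : small_sum [set x in rcons ys z] = small_sum [set x in ys] + small_sum_last ys z
  \/ ~~ uniq (rcons ys z).
Proof.
have [uz|] := boolP (uniq (rcons ys z)); last by right.
left; rewrite /small_sum (bigID (fun w : {set keyt} => z \in w)) /= addrC; congr (_ + _).
apply: eq_bigl => w; apply/andP/idP => [[wV zw]|wy].
  apply/subsetP => x xw; have := subsetP wV x xw; rewrite !inE mem_rcons inE.
  by case/orP => // /eqP xz; rewrite -xz xw in zw.
split; first by apply: subset_trans wy _; apply/subsetP => x; rewrite !inE mem_rcons inE => ->; rewrite orbT.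
by move: uz; rewrite rcons_uniq => /andP [zy _]; apply: contra zy => /(subsetP wy); rewrite inE.
Qed.

(** A subset without the last key leaves that key free and gives a factor mu. One with the last key
    determines it, and there the factor [p z] is bounded by 1. *)
Lemma sum_small_weight b :
  \sum_(xs <- seqs keyt b | uniq xs) weight xs * small_sum [set x in xs] <= mu ^+ b.-1 * sub_coef b.
Proof.
elim: b => [|b IH].
  rewrite big_cons big_nil /= addr0 /weight big_nil mul1r mul1r (le_trans (small_sum_sub_coef _))//.
  by rewrite (_ : [set x in [::]] = set0) ?cards0//; apply/setP => x; rewrite !inE.
rewrite big_mkcond sum_seqs_rcons /=.
apply: (@le_trans _ _ (\sum_(ys <- seqs keyt b) \sum_z
   ((if uniq ys then weight ys * small_sum [set x in ys] else 0) * p z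
     + (if uniq (rcons ys z) then weight ys * small_sum_last ys z else 0)))).
  apply: ler_sum => ys _; apply: ler_sum => z _; rewrite weight_rcons.
  case: (small_sum_rcons ys z) => [e1|/negPf ->]; last first.
    by rewrite addr0; case: ifP => // _; rewrite !mulr_ge0 ?weight_ge0 ?small_sum_ge0.
  have smt0 : 0 <= small_sum_last ys z.
    by apply: sumr_ge0 => w _; rewrite (mulr_ge0 (ler0n _ _) (small_coef_ge0 _)).
  case: (boolP (uniq (rcons ys z))) => [uz|_]; last first.
    by rewrite addr0; case: ifP => // _; rewrite !mulr_ge0 ?weight_ge0 ?small_sum_ge0.
  have -> : uniq ys by move: uz; rewrite rcons_uniq => /andP [].
  rewrite e1 mulrDr mulrAC lerD2l -mulrA ler_wpM2l ?weight_ge0// ler_piMl ?small_sum_ge0 ?p1//.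
under [leLHS]eq_bigr do rewrite big_split /=.
rewrite big_split /= sub_coefS mulrDr; apply: lerD.
  under eq_bigr do rewrite -mulr_sumr.
  rewrite -mulr_suml -big_mkcond /=.
  (* The exponent [b.-1] truncates at [b = 0], where [sub_coef 0] vanishes. *)
  case: b IH => [|b] IH.
    have := ler_wpM2r mu_ge0 IH; rewrite sub_coef0 !mulr0 mul0r; exact.
  by rewrite exprSr mulrAC; apply: ler_wpM2r => //; apply: mu_ge0.
apply: le_trans (sum_small_last_weight b); apply: ler_sum => ys _.
by rewrite -big_mkcond.
Qed.

Fixpoint size_bound (j l : nat) : Rt :=
  if j is j'.+1 then sub_coef l * x3 ^+ j + size_bound j' (l - s) + e * size_bound j' l else 0.

Lemma size_bound_ge0 j l : 0 <= size_bound j l.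
Proof.
by elim: j l => //= j IH l; rewrite !addr_ge0 ?(mulr_ge0 e0)// (mulr_ge0 (sub_coef_ge0 _) (x3n_ge0 _)).
Qed.

Lemma size_bound0 j : size_bound j 0 = 0.
Proof. by elim: j => //= j IH; rewrite sub_coef0 sub0n IH mul0r mulr0 !addr0. Qed.

Lemma seq_bound_size j xs : seq_bound j xs <= size_bound j (size xs).
Proof.
elim: j xs => //= j IH xs; have st : size (take (size xs - s) xs) = (size xs - s)%N.
  by rewrite size_takel ?leq_subr.
apply: lerD; first apply: lerD.
- rewrite ler_wpM2r ?x3n_ge0//; apply: le_trans (small_sum_sub_coef _) _; rewrite cardsE.
  apply: ler_sum => a _; rewrite ler_wpM2r ?small_coef_ge0// ler_nat.
  by apply: leq_bin2l; apply: card_size.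
- by apply: le_trans (IH _) _; rewrite st.
- by rewrite ler_wpM2l.
Qed.

(** The [s] keys set aside are summed freely and give [mu ^+ s]. If there are at most [s] keys, the
    prefix is empty and its bound is 0. *)
Lemma sum_seq_bound_take j b :
  (forall b', \sum_(xs <- seqs keyt b' | uniq xs) weight xs * seq_bound j xs <= mu ^+ b'.-1 * size_bound j b') ->
  \sum_(xs <- seqs keyt b | uniq xs) weight xs * seq_bound j (take (size xs - s) xs)
  <= mu ^+ b.-1 * size_bound j (b - s).
Proof.
move=> IH; have [bs|sb] := leqP b s.
  rewrite (_ : b - s = 0)%N; last by apply/eqP.
  rewrite size_bound0 mulr0 big_seq_cond big1// => xs /andP [hx _]; move: hx; rewrite mem_seqs => /eqP ->.
  rewrite (_ : b - s = 0)%N; last by apply/eqP.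
  have := seq_bound_size j [::]; rewrite size_bound0 => h.
  by rewrite take0 (_ : seq_bound j [::] = 0) ?mulr0//; apply/eqP; rewrite eq_le h seq_bound_ge0.
apply: (@le_trans _ _ (\sum_(xs <- seqs keyt b) weight xs * (uniq (take (b - s) xs))%:R * seq_bound j (take (b - s) xs))).
  rewrite big_mkcond big_seq [leRHS]big_seq; apply: ler_sum => xs; rewrite mem_seqs => /eqP ->.
  case: ifP => [u|_]; first by rewrite take_uniq// mulr1.
  by rewrite !mulr_ge0 ?weight_ge0 ?seq_bound_ge0 ?ler0n.
rewrite -{1}(subnK (ltnW sb)); under [leLHS]eq_bigr do rewrite -mulrA.
rewrite (sum_wp_take _ _ (fun xs => (uniq xs)%:R * seq_bound j xs)).
have -> : b.-1 = (s + (b - s).-1)%N by lia.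
rewrite exprD -mulrA ler_wpM2l ?exprn_ge0 ?mu_ge0//.
apply: le_trans (IH (b - s)%N); rewrite [leRHS]big_mkcond; apply: ler_sum => xs _.
by case: ifP; rewrite ?mul1r ?mul0r ?mulr0.
Qed.

Lemma sum_seq_bound_weight j b :
  \sum_(xs <- seqs keyt b | uniq xs) weight xs * seq_bound j xs <= mu ^+ b.-1 * size_bound j b.
Proof.
elim: j b => [|j IH] b; first by rewrite /= mulr0 big1// => xs _; rewrite mulr0.
rewrite /= !mulrDr; under eq_bigr do rewrite !mulrDr.
rewrite !big_split /=; apply: lerD; first apply: lerD.
- by under eq_bigr do rewrite mulrA; rewrite -mulr_suml mulrA ler_wpM2r ?x3n_ge0 ?sum_small_weight.
- exact: sum_seq_bound_take.
- under [leLHS]eq_bigr do rewrite mulrCA.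
  by rewrite -mulr_sumr mulrCA ler_wpM2l.
Qed.

Definition split_bound (l : nat) : Rt := size_bound d.-2 (l - s) + e * size_bound d.-2 l.

Lemma split_bound_ge0 l : 0 <= split_bound l.
Proof. by rewrite addr_ge0 ?(mulr_ge0 e0) ?size_bound_ge0. Qed.

Lemma tail_bound_le xs : tail_bound xs <= split_bound (size xs) + long_bound d.-1 (size xs).
Proof.
rewrite lerD2r lerD//; last by rewrite ler_wpM2l ?seq_bound_size.
by apply: le_trans (seq_bound_size _ _) _; rewrite size_takel ?leq_subr.
Qed.

(** Terms coming from circuits of at most 14 keys keep the saved factor mu; [long_bound] carries no
    sum condition and gets the full power. *)
Lemma sum_tail_weight b :
  \sum_(xs <- seqs keyt b | uniq xs) weight xs * tail_bound xs <= mu ^+ b.-1 * split_bound b + mu ^+ b * long_bound d.-1 b.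
Proof.
under [leLHS]eq_bigr do rewrite /tail_bound !mulrDr.
rewrite !big_split /= /split_bound mulrDr; apply: lerD; first apply: lerD.
- by apply: sum_seq_bound_take => b'; apply: sum_seq_bound_weight.
- under [leLHS]eq_bigr do rewrite mulrCA.
  by rewrite -mulr_sumr mulrCA ler_wpM2l ?sum_seq_bound_weight.
rewrite -sum_weight mulr_suml big_mkcond big_seq [leRHS]big_seq; apply: ler_sum => xs.
rewrite mem_seqs => /eqP ->; case: ifP => // _.
by rewrite mulr_ge0 ?weight_ge0 ?long_bound_ge0.
Qed.

Lemma sum_top_dep b :
  \sum_(ys <- seqs keyt b) \sum_(z | uniq (rcons ys z)) weight (rcons ys z) *
     (small_sum_last ys z * x3 ^+ d.-1 + (14 < b.+1)%N%:R * tail_bound (rcons ys z))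
  <= mu ^+ b * (sub_coef_last b.+1 * x3 ^+ d.-1)
     + (14 < b.+1)%N%:R * (mu ^+ b * split_bound b.+1 + mu ^+ b.+1 * long_bound d.-1 b.+1).
Proof.
apply: (@le_trans _ _ (\sum_(ys <- seqs keyt b) \sum_(z | uniq (rcons ys z)) (weight ys * small_sum_last ys z) * x3 ^+ d.-1
  + (14 < b.+1)%N%:R * \sum_(ys <- seqs keyt b) \sum_(z | uniq (rcons ys z)) weight (rcons ys z) * tail_bound (rcons ys z))).
  rewrite mulr_sumr -big_split /=; apply: ler_sum => ys _.
  rewrite mulr_sumr -big_split /=; apply: ler_sum => z _.
  rewrite mulrDr (mulrCA (weight (rcons ys z)) (_ < _)%:R) lerD2r weight_rcons mulrA.
  rewrite ler_wpM2r ?x3n_ge0// mulrAC ler_piMr ?p1// mulr_ge0 ?weight_ge0//.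
  by apply: sumr_ge0 => w _; rewrite (mulr_ge0 (ler0n _ _) (small_coef_ge0 _)).
apply: lerD; last first.
  rewrite ler_wpM2l ?ler0n//; apply: le_trans (sum_tail_weight b.+1).
  rewrite [leRHS]big_mkcond sum_seqs_rcons; apply: ler_sum => ys _.
  by rewrite -big_mkcond.
under [leLHS]eq_bigr do rewrite -mulr_suml.
by rewrite -mulr_suml mulrA ler_wpM2r ?x3n_ge0 ?sum_small_last_weight.
Qed.

(** The last key carries no weight here: at most one [z] completes [ys] to a set with zero sums. *)
Lemma sum_top_full b :
  \sum_(ys <- seqs keyt b) \sum_(z | uniq (rcons ys z)) weight ys *
     ((key_sum0 [set x in rcons ys z])%:R *
       (small_coef b.+1 * x3 ^+ d.-1 + (14 < b.+1)%N%:R * tail_bound (rcons ys z)))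
  <= mu ^+ b * (small_coef b.+1 * x3 ^+ d.-1 + (14 < b.+1)%N%:R * (split_bound b.+1 + long_bound d.-1 b.+1)).
Proof.
set C := small_coef b.+1 * _ + _.
have C0 : 0 <= C.
  rewrite addr_ge0 ?(mulr_ge0 (small_coef_ge0 _) (x3n_ge0 _))// (mulr_ge0 (ler0n _ _))//.
  by rewrite addr_ge0 ?split_bound_ge0 ?long_bound_ge0.
rewrite -sum_weight mulr_suml big_seq [leRHS]big_seq; apply: ler_sum => ys.
rewrite mem_seqs => /eqP hb; rewrite -mulr_sumr ler_wpM2l ?weight_ge0//.
apply: (@le_trans _ _ (\sum_(z | uniq (rcons ys z)) (key_sum0 [set x in rcons ys z])%:R * C)).
  apply: ler_sum => z _; rewrite ler_wpM2l ?ler0n// lerD2l ler_wpM2l ?ler0n//.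
  by apply: le_trans (tail_bound_le _) _; rewrite size_rcons hb.
rewrite -mulr_suml ler_piMl//.
have setE z : [set x in rcons ys z] = z |: [set x in ys].
  by apply/setP => x; rewrite !inE mem_rcons inE.
have [/existsP [z0 /andP [u0 k0]]|no] :=
  boolP [exists z : keyt, uniq (rcons ys z) && key_sum0 [set x in rcons ys z]]; last first.
  rewrite big1 ?ler01// => z uz; rewrite (_ : key_sum0 _ = false)//.
  by apply: contraNF no => kz; apply/existsP; exists z; rewrite uz.
have nA z : uniq (rcons ys z) -> z \notin [set x in ys].
  by rewrite rcons_uniq inE => /andP [].
rewrite (bigD1 z0)//= k0 big1 ?addr0// => z /andP [uz zz0].
rewrite (_ : key_sum0 _ = false)//; apply: contraNF zz0 => kz.
by apply/eqP; rewrite !setE in kz k0; apply: key_sum0_uniq kz k0; apply: nA.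
Qed.

End Weights.

End Small.

End WithField.

#[global] Arguments small_coef {Rt} a.
#[global] Arguments sub_coef {Rt} l.
#[global] Arguments sub_coef_last {Rt} l.

(** * Certificates *)

Fixpoint alternating (X : Type) (A : eqType) (f g : X -> A) (q : seq X) : bool :=
  if q is x :: q' then
    (if q' is y :: _ then f x == f y else true) && alternating g f q'
  else true.

Section Alternating.
Variables (X A : finType).
Implicit Types (f g : X -> A) (q : seq X) (Z C : {set X}).

(** Along the path [f] pairs the keys 1-2, 3-4 and so on, so only a last key in odd position is left
    over. *)
Lemma alternating_parity f g x0 q : alternating f g q ->
  parity [seq f x | x <- q] = if odd (size q) then delta (f (last x0 q)) else 0.
Proof.
have p0 : parity [::] = 0 :> {ffun A -> _} by apply/ffunP => a; rewrite !ffunE.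
elim/ltn_ind: {q}(size q) {-2}q (erefl (size q)) => m IH q qm.
case: q qm => [|x [|y q]] qm; first by [].
  by rewrite /= parity_cons p0 addr0.
move=> /= /andP [/eqP e /andP [_ aq]].
rewrite !parity_cons e addrA addff2 add0r negbK (IH (size q))//; last by rewrite -qm /= leqnSn.
by case: q {aq qm}.
Qed.

Lemma alternating_rcons f g x0 q y : q != [::] ->
  alternating f g (rcons q y) = alternating f g q &&
    (if odd (size q) then f (last x0 q) == f y else g (last x0 q) == g y).
Proof.
elim: q f g => // x [|z q] IH f g _; first by rewrite /= !andbT.
rewrite !rcons_cons -[alternating f g _]/((f x == f z) && alternating g f (rcons (z :: q) y)) IH//.
rewrite -[alternating f g _]/((f x == f z) && alternating g f (z :: q)) -andbA.
by congr [&& _, _ & _]; rewrite /=; case: (odd (size q)).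
Qed.

Lemma alternating_rev f g q : alternating f g q ->
  if odd (size q) then alternating g f (rev q) else alternating f g (rev q).
Proof.
elim: q f g => // x [|y q] IH f g //.
rewrite -[alternating f g _]/((f x == f y) && alternating g f (y :: q)) => /andP [e /IH].
rewrite [rev (x :: _)]rev_cons -[size (x :: _)]/(size (y :: q)).+1 oddS.
have ne : rev (y :: q) != [::] by rewrite rev_cons; case: rev.
have ly : last x (rev (y :: q)) = y by rewrite rev_cons last_rcons.
by case: (boolP (odd _)) => /= o ar;
  rewrite (alternating_rcons _ _ x _ ne) ar size_rev ly (eqP e) ?(negPf o) ?o /= ?(negPf o) ?o /= eqxx.
Qed.

Lemma alternating_take f g q p : alternating f g q -> alternating f g (take p q).
Proof.
elim: q f g p => [|x q IH] f g [|p] //= /andP [e /IH h]; rewrite h andbT.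
by case: q e {IH h} => [|y q] //; case: p.
Qed.

Lemma even_values_parity f q : uniq q -> even_values f [set x in q] = (parity [seq f x | x <- q] == 0).
Proof.
move=> uq; have E a : (parity [seq f x | x <- q] a == 0) = ~~ odd #|[set x in [set x in q] | f x == a]|.
  rewrite ffunE F2_natr_eq0 count_map -size_filter -(card_uniqP (filter_uniq _ uq)).
  by congr (~~ odd _); apply: eq_card => x; rewrite !inE mem_filter andbC.
apply/forallP/eqP => [h|/ffunP h a]; last by rewrite -E h ffunE.
by apply/ffunP => a; apply/eqP; rewrite [X in _ == X]ffunE E.
Qed.

Lemma even_valuesD f Z C : C \subset Z -> even_values f Z -> even_values f C -> even_values f (Z :\: C).
Proof.
move=> sC /forallP eZ /forallP eC; apply/forallP => a.
have := eZ a; rewrite -(cardsID C) oddD.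
have -> : [set x in Z | f x == a] :&: C = [set x in C | f x == a].
  by apply/setP => x; rewrite !inE; case: (boolP (x \in C)) => [/(subsetP sC) ->|]; rewrite ?andbT ?andbF.
rewrite (negPf (eC a)) /=; congr (~~ odd _).
by apply: eq_card => x; rewrite !inE andbA.
Qed.

Lemma even_valuesU f Z C : [disjoint Z & C] -> even_values f Z -> even_values f C -> even_values f (Z :|: C).
Proof.
move=> dZC /forallP eZ /forallP eC; apply/forallP => a.
rewrite -(cardsID Z) oddD.
have -> : [set x in Z :|: C | f x == a] :&: Z = [set x in Z | f x == a].
  by apply/setP => x; rewrite !inE; case: (x \in Z); rewrite ?andbF ?andbT.
have -> : [set x in Z :|: C | f x == a] :\: Z = [set x in C | f x == a].
  apply/setP => x; rewrite !inE; case: (boolP (x \in Z)) => //= xZ.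
  by rewrite (disjointFr dZC xZ).
by rewrite (negPf (eZ a)) eC.
Qed.

(** The path takes the value [a] an odd number of times and [Z] an even number, so some other key of
    [Z] takes it. *)
Lemma even_values_ext f Z q a : even_values f Z -> uniq q -> {subset q <= Z} ->
  parity [seq f x | x <- q] a != 0 -> exists2 y, y \in Z & (y \notin q) && (f y == a).
Proof.
move=> /forallP /(_ a) eZ uq sq; rewrite ffunE F2_natr_eq0 negbK count_map => oq.
have /card_gt0P [y] : (0 < #|[set x in Z | f x == a] :\: [set x in q]|)%N; last first.
  by rewrite !inE => /and3P [nq yZ fy]; exists y; rewrite ?nq.
apply: odd_gt0; move: eZ; rewrite -(cardsID [set x in q]) oddD.
have -> : #|[set x in Z | f x == a] :&: [set x in q]| = count (preim f (pred1 a)) q.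
  rewrite -size_filter -(card_uniqP (filter_uniq _ uq)); apply: eq_card => x.
  rewrite !inE mem_filter /= andbC; case: (boolP (x \in q)) => [/sq ->|]; rewrite ?andbT ?andbF//.
by rewrite oq addTb negbK.
Qed.

Lemma greedy f g Z z : even_values f Z -> even_values g Z -> z \in Z ->
  exists q, [/\ uniq (z :: q), {subset z :: q <= Z}, alternating f g (z :: q), odd (size q)
     & even_values f [set x in z :: q] && even_values g [set x in z :: q] ].
Proof.
move=> eF eG zZ.
suff H m q : (#|Z| - size q <= m)%N -> uniq (z :: q) -> {subset z :: q <= Z} -> alternating f g (z :: q) ->
  exists q, [/\ uniq (z :: q), {subset z :: q <= Z}, alternating f g (z :: q), odd (size q)
     & even_values f [set x in z :: q] && even_values g [set x in z :: q] ].
  by apply: (H #|Z| [::]); rewrite ?leq_subr// => x; rewrite inE => /eqP ->.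
elim: m q => [|m IH] q hm uq sq aq.
  have : (size (z :: q) <= #|Z|)%N.
    by rewrite cardE; apply: uniq_leq_size => // x /sq; rewrite mem_enum.
  by rewrite /=; lia.
have parf := alternating_parity z aq.
have parg : parity [seq g x | x <- z :: q] = delta (g z) + if odd (size q) then delta (g (last z q)) else 0.
  by move: aq => /= /andP [_ /(alternating_parity z) h]; rewrite parity_cons h.
have step y : y \in Z -> y \notin z :: q ->
   (if odd (size (z :: q)) then f (last z (z :: q)) == f y else g (last z (z :: q)) == g y) ->
   exists q, [/\ uniq (z :: q), {subset z :: q <= Z}, alternating f g (z :: q), odd (size q)
     & even_values f [set x in z :: q] && even_values g [set x in z :: q] ].
  move=> yZ yq hy; apply: (IH (rcons q y)).
  - have : (size (z :: q) <= #|Z|)%N.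
      by rewrite cardE; apply: uniq_leq_size => // x /sq; rewrite mem_enum.
    by rewrite size_rcons /=; lia.
  - by rewrite -rcons_cons rcons_uniq yq.
  - by move=> x; rewrite -rcons_cons mem_rcons inE => /orP [/eqP ->|/sq].
  - by rewrite -rcons_cons (alternating_rcons _ _ z) // aq.
have [oq|oq] := boolP (odd (size q)); last first.
  have [|y yZ /andP [yq /eqP fy]] := @even_values_ext f Z (z :: q) (f (last z q)) eF uq sq.
    by rewrite parf /= oq ffunE eqxx oner_eq0.
  by apply: (step y yZ yq); rewrite /= oq fy.
have [e|ne] := eqVneq (g z) (g (last z q)).
  exists q; split=> //; rewrite !even_values_parity// parf parg /= oq /= eqxx e addff2 eqxx//.
have [|y yZ /andP [yq /eqP gy]] := @even_values_ext g Z (z :: q) (g (last z q)) eG uq sq.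
  by rewrite parg oq !ffunE eqxx (negPf ne) add0r oner_eq0.
by apply: (step y yZ yq); rewrite /= oq /= gy.
Qed.

End Alternating.

Section Top.
Variables (k N : nat) (X A : finType) (sq : X -> seq (bits k)) (f g : X -> A).
Implicit Types (Q S Z M Y : {set X}).
Local Notation zs := (zero_set sq N).
Local Notation dp := (dep sq N).

Definition full_zero Z := [&& zs Z, even_values f Z & even_values g Z].

(** For [M] disjoint from [Q]: linear independence of the full incidence vectors of [M] modulo the
    span of those of [Q]. *)
Definition indep_mod Q M : bool :=
  ~~ [exists Z : {set X}, [&& Z \subset M :|: Q, Z :&: M != set0 & full_zero Z]].

(* [Yl] is a list rather than a set so that the union bound can divide by its orderings. *)
Definition certificate (Yl : seq X) (P : seq X) (z : X) : bool :=
  [&& uniq (Yl ++ rcons P z), even_values f [set x in Yl], even_values g [set x in Yl],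
      alternating f g (rcons P z), ~~ dp [set x in Yl ++ P] & dp [set x in Yl ++ rcons P z]].

(* Take a zero set [Z] of selected keys with [#|Z :\: Q|] minimal and follow an alternating path in
   it from a key outside [Q] until it closes; [Yl] is a maximal independent even set among the other
   keys. If [Yl] exhausts them, the path completes it to [Z]; otherwise a second closed path
   avoiding both does. Sets that miss a key of [Z :\: Q] are independent modulo [Q] by minimality. *)
Lemma top_exists Q S Z0 : Q \subset S -> Z0 \subset S -> Z0 != set0 -> full_zero Z0 ->
  exists Yl P z, [/\ certificate Yl P z, {subset Yl ++ rcons P z <= S} &
    indep_mod Q ([set x in Yl ++ rcons P z] :\: Q) ||
    zs [set x in Yl ++ rcons P z] && indep_mod Q ([set x in Yl ++ P] :\: Q)].
Proof.
move=> QS Z0S Z00 fZ0.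
pose pr Z := [&& Z \subset S, Z != set0 & full_zero Z].
have pr0 : pr Z0 by rewrite /pr Z0S Z00.
case: (arg_minnP (fun Z => #|Z :\: Q|) pr0) => Z /and3P [ZS Zn0 fZ] minZ.
have [zsZ fe ge] := and3P fZ.
(* A relation meeting [M] would be a selected zero set with fewer keys outside [Q] than [Z]. *)
have ind M : M :&: Q = set0 -> (M == set0) || (M \subset S) && (#|M| < #|Z :\: Q|)%N -> indep_mod Q M.
  move=> MQ hM; apply/negP => /existsP [Z' /and3P [sZ' nZ' fZ']].
  case/orP: hM => [/eqP M0|/andP [MS lt]]; first by move: nZ'; rewrite M0 setI0 eqxx.
  have prZ' : pr Z'.
    rewrite /pr fZ' andbT; apply/andP; split.
      by apply: subset_trans sZ' _; rewrite subUset MS.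
    by apply: contraNneq nZ' => ->; rewrite set0I.
  have := minZ _ prZ'; rewrite leqNgt => /negP []; apply: leq_ltn_trans lt.
  apply: subset_leq_card; apply/subsetP => x; rewrite !inE => /andP [xQ /(subsetP sZ')].
  by rewrite inE (negPf xQ) orbF.
(* If [Z] lies inside [Q], any start will do, since no key outside [Q] remains whose hash value has
   to be independent. *)
have [zst [zstZ zstQ]] : exists z, z \in Z /\ ((z \notin Q) || (Z \subset Q)).
  have [ZQ|] := boolP (Z \subset Q); first by have /set0Pn [z zZ] := Zn0; exists z; rewrite orbT.
  by move=> /subsetPn [z zZ zQ]; exists z; rewrite zQ.
have indE (E : {set X}) : E \subset Z -> zst \notin E -> indep_mod Q (E :\: Q).
  move=> EZ zE; apply: ind; first by rewrite setIDAC setDIl setDv setI0.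
  case/orP: zstQ => [zQ|ZQ]; last by rewrite setD_eq0 (subset_trans EZ ZQ).
  apply/orP; right; rewrite (subset_trans (subsetDl _ _) (subset_trans EZ ZS)).
  apply: proper_card; rewrite properE setSD//; apply/subsetPn; exists zst; rewrite !inE ?zQ//.
have [q [uq sub aq oq /andP [ef eg]]] := greedy fe ge zstZ.
pose C := [set x in zst :: q].
have CZ : C \subset Z by apply/subsetP => x; rewrite inE => /sub.
(* Cut the path [PP] at the first key that creates a dependence on the Sigma-characters; [r] is the
   discarded end. *)
have cutP Y (PP : seq X) : Y \subset Z -> even_values f Y -> even_values g Y -> ~~ dp Y -> uniq PP -> alternating f g PP ->
   {subset PP <= Z} -> (forall x, x \in PP -> x \notin Y) -> dp (Y :|: [set x in PP]) ->
   exists P z, [/\ exists r, rcons P z ++ r = PP, certificate (enum Y) P z & {subset enum Y ++ rcons P z <= Z}].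
  move=> YZ Yf Yg Yn uP aP sP dP dd.
  have ex : exists p, dp (Y :|: [set x in take p PP]) by exists (size PP); rewrite take_size.
  case: (ex_minnP ex) => p hp minp.
  have Yd : [set x in enum Y] = Y by apply/setP => x; rewrite inE mem_enum.
  have catE s : [set x in enum Y ++ s] = Y :|: [set x in s].
    by apply/setP => x; rewrite !inE mem_cat mem_enum.
  case: p hp minp => [|p] hp minp.
    by case/negP: Yn; move: hp; rewrite take0 (_ : [set x in [::]] = set0) ?setU0//; apply/setP => x; rewrite !inE.
  have psz : (p < size PP)%N.
    rewrite ltnNge; apply/negP => le; have := minp (size PP); rewrite take_size dd => /(_ isT).
    by rewrite leqNgt ltnS le.
  case: PP => [|z0 PP'] in uP aP sP dP dd ex hp minp psz *; first by [].
  move: (z0 :: PP') => PP in uP aP sP dP dd ex hp minp psz *.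
  have tk : take p.+1 PP = rcons (take p PP) (nth z0 PP p) by rewrite (take_nth z0).
  exists (take p PP), (nth z0 PP p); rewrite /certificate -tk; split.
  - by exists (drop p.+1 PP); apply: cat_take_drop.
  - rewrite !catE hp alternating_take// Yd Yf Yg cat_uniq enum_uniq take_uniq// andbT /=.
    rewrite andbT; apply/andP; split; last by apply/negP => /minp; rewrite ltnn.
    by apply/hasPn => x /mem_take /dP; rewrite mem_enum.
  - by move=> x; rewrite mem_cat mem_enum => /orP [/(subsetP YZ)|/mem_take /sP].
have fD := even_valuesD CZ fe ef; have gD := even_valuesD CZ ge eg.
pose pY Y := [&& Y \subset Z :\: C, even_values f Y, even_values g Y & ~~ dp Y].
have ev0 (h : X -> A) : even_values h set0.
  by apply/forallP => a; rewrite (_ : [set x in set0 | _] = set0) ?cards0//; apply/setP => x; rewrite !inE.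
have pY0 : pY set0.
  rewrite /pY sub0set !ev0; apply/negP => /existsP [w /and3P [ws w0 _]].
  by move: w0; rewrite -subset0 ws.
have [Y /maxsetP [/and4P [YZ Yf Yg Yn] maxY] _] := maxset_exists pY0.
have YZ' : Y \subset Z by apply: subset_trans YZ (subsetDl _ _).
have zY : zst \notin Y by apply/negP => /(subsetP YZ); rewrite !inE eqxx.
have YC x : x \in Y -> x \notin zst :: q by move=> /(subsetP YZ); rewrite in_setD inE => /andP [].
have [YE|YE] := eqVneq Y (Z :\: C).
  (* Reversed, the path ends in [zst]: either the cut discards [zst], or [zst] is the last key of
     the certificate and only the keys before it need to be independent modulo [Q]. *)
  have ar : alternating f g (rev (zst :: q)) by have := alternating_rev aq; rewrite /= oq.
  have [||||P [z [[r Pr] ce sPZ]]] := cutP Y (rev (zst :: q)) YZ' Yf Yg Yn _ ar.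
  - by rewrite rev_uniq.
  - by move=> x; rewrite mem_rev => /sub.
  - by move=> x; rewrite mem_rev; apply: contraL => /YC.
  - rewrite (_ : _ :|: _ = Z); first by apply/existsP; exists Z; rewrite subxx Zn0.
    rewrite YE -[RHS](setID Z C) setUC (setIidPr CZ); congr (_ :|: _).
    by apply/setP => x; rewrite !inE mem_rev.
  exists (enum Y), P, z; split=> //; first by move=> x /sPZ /(subsetP ZS).
  case/lastP: r Pr => [|r l] Pr.
    rewrite cats0 in Pr.
    have zE : z = zst by move/(congr1 (last z)): Pr; rewrite last_rcons rev_cons last_rcons.
    have EZ : [set x in enum Y ++ rcons P z] = Z.
      rewrite Pr; apply/setP => x; rewrite inE mem_cat mem_enum mem_rev YE in_setD inE.
      by case: (boolP (x \in _ :: _)) => [/sub ->|_]//=; rewrite orbF.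
    rewrite EZ zsZ /=; apply/orP; right; apply: indE.
      by apply/subsetP => x; rewrite inE mem_cat => h; apply: sPZ; rewrite mem_cat mem_rcons inE; case/orP: h => ->; rewrite ?orbT.
    rewrite inE mem_cat mem_enum (negPf zY) /= -zE.
    by move: ce => /and4P [+ _ _ _]; rewrite cat_uniq rcons_uniq => /and4P [_ _ ].
  apply/orP; left; apply: indE; first by apply/subsetP => x; rewrite inE; apply: sPZ.
  rewrite inE mem_cat mem_enum (negPf zY) /=.
  have ur : uniq (rev (zst :: q)) by rewrite rev_uniq.
  move: ur (ur); rewrite -{1}Pr => ur; rewrite rev_cons in Pr *.
  have -> : zst = l by move/(congr1 (last l)): Pr; rewrite last_cat !last_rcons.
  by move: ur; rewrite cat_uniq => /and3P [_ /hasPn /(_ l) h _] _; apply: h; rewrite mem_rcons inE eqxx.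
have [x xD] : exists x, x \in (Z :\: C) :\: Y.
  by apply/set0Pn; rewrite setD_eq0; move: YE; rewrite eqEsubset YZ.
have [q' [uq' sub' aq' _ /andP [ef' eg']]] := greedy (even_valuesD YZ fD Yf) (even_valuesD YZ gD Yg) xD.
have dYq : [disjoint Y & [set y in x :: q']].
  rewrite disjoint_sym disjoint_subset; apply/subsetP => y; rewrite inE => /sub'.
  by rewrite 3!inE => /andP [].
(* Otherwise [Y] and the second path together would be a larger independent even set. *)
have dd : dp (Y :|: [set y in x :: q']).
  apply: contraT => nd.
  have sqZ : [set y in x :: q'] \subset Z :\: C.
    by apply/subsetP => y; rewrite inE => /sub'; rewrite inE => /andP [].
  have e : Y :|: [set y in x :: q'] = Y.
    by apply: maxY; [rewrite /pY nd !even_valuesU// subUset YZ sqZ | apply: subsetUl].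
  have : x \in Y by rewrite -e !inE eqxx orbT.
  by move: xD; rewrite inE => /andP [/negPf ->].
have sub'' y : y \in x :: q' -> y \in Z :\: C by move=> /sub'; rewrite inE => /andP [].
have [||P [z [[r Pr] ce sPZ]]] := cutP Y (x :: q') YZ' Yf Yg Yn uq' aq' _ _ dd.
- by move=> y /sub''; rewrite inE => /andP [].
- by move=> y /sub'; rewrite inE => /andP [].
exists (enum Y), P, z; split=> //; first by move=> y /sPZ /(subsetP ZS).
apply/orP; left; apply: indE; first by apply/subsetP => y; rewrite inE; apply: sPZ.
rewrite inE mem_cat mem_enum (negPf zY) /=; apply/negP => zP.
have /sub'' : zst \in x :: q' by rewrite -Pr mem_cat zP.
by rewrite !inE eqxx.
Qed.

End Top.

(** * Selection probabilities *)

Section WithField.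
Variable Rt : realFieldType.

Lemma Ex_prod (t : nat) (U : finType) (h : 'I_t -> U -> Rt) :
  Ex (fun u : {ffun 'I_t -> U} => \prod_i h i (u i)) = \prod_i Ex (h i).
Proof.
rewrite /Ex card_ffun card_ord natrX -bigA_distr_bigA /=.
by rewrite big_split /= prodr_const card_ord exprVn.
Qed.

Local Notation Ex := (@Ex Rt _).

Section Hash.
Variables (k k' r N : nat) (X : finType) (sq : X -> seq (bits k)) (f g : X -> bits k').
Let TT := ({ffun 'I_N -> {ffun bits k -> bits r}} *
           ({ffun bits k' -> bits r} * {ffun bits k' -> bits r}))%type.
Let D := ('I_N * bits k + (bits k' + bits k'))%type.

Definition hash_value (T : TT) (x : X) : bits r := stab T.1 (sq x) + T.2.1 (f x) + T.2.2 (g x).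

Definition dpred (x : X) (e : D) : bool :=
  match e with
  | inl p => nth 0 (sq x) p.1 == p.2
  | inr (inl a) => f x == a
  | inr (inr b) => g x == b
  end.

Definition full_char_vec (x : X) : 'rV['F_2]_#|{: D}| := indicator (dpred x).

Lemma full_zero_char_vec (Z : {set X}) : \sum_(x in Z) full_char_vec x = 0 -> full_zero N sq f g Z.
Proof.
move=> s0; have E (e : D) : ~~ odd #|[set x in Z | dpred x e]|.
  rewrite -F2_natr_eq0; move/rowP/(_ (enum_rank e)): s0.
  rewrite summxE mxE => <-; apply/eqP; rewrite -sum1_card natr_sum.
  rewrite (eq_bigl _ _ (fun x => in_set _ x)) /= big_mkcondr /=.
  by apply: eq_bigr => x _; rewrite mxE enum_rankK; case: (dpred x e).
apply/and3P; split.
- by apply/forallP => p; apply/forallP => a; apply: (E (inl (p, a))).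
- by apply/forallP => a; apply: (E (inr (inl a))).
- by apply/forallP => a; apply: (E (inr (inr a))).
Qed.

Definition hsec (t : nat) (K : 'M['F_2]_(#|{: D}|, t)) (u : {ffun 'I_t -> bits r}) : TT :=
  ([ffun j => [ffun a => \sum_x K (enum_rank (inl (j, a) : D)) x *: u x]],
   ([ffun a => \sum_x K (enum_rank (inr (inl a) : D)) x *: u x],
    [ffun a => \sum_x K (enum_rank (inr (inr a) : D)) x *: u x])).

Lemma sum_sumType (A B : finType) (V : nmodType) (F : A + B -> V) :
  \sum_(x : A + B) F x = \sum_a F (inl a) + \sum_b F (inr b).
Proof. by rewrite big_sumType. Qed.

Lemma hsecE (t : nat) (K : 'M['F_2]_(#|{: D}|, t)) (u : {ffun 'I_t -> bits r}) x :
  hash_value (hsec K u) x = \sum_i (full_char_vec x *m K) 0 i *: u i.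
Proof.
have one (B : finType) (b : B) (G : B -> 'F_2) : \sum_a (b == a)%:R * G a = G b.
  rewrite (bigD1 b)//= eqxx mul1r big1 ?addr0// => a.
  by rewrite eq_sym => /negPf ->; rewrite mul0r.
rewrite /hash_value /stab /= !ffunE.
under eq_bigr do rewrite !ffunE.
rewrite exchange_big -!big_split; apply: eq_bigr => i _ /=.
rewrite -scaler_suml -!scalerDl; congr (_ *: _); rewrite mxE.
rewrite (reindex (@enum_rank {: D})) /=; last first.
  by exists enum_val => ? _; rewrite (enum_rankK, enum_valK).
under [RHS]eq_bigr do rewrite mxE enum_rankK.
rewrite !sum_sumType /= !one -addrA; congr (_ + _).
rewrite (eq_bigr (fun p : 'I_N * bits k =>
  (nth 0 (sq x) p.1 == p.2)%:R * K (enum_rank (inl (p.1, p.2) : D)) i)) => [|[]//].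
rewrite -(pair_bigA _ (fun (j : 'I_N) a => (nth 0 (sq x) j == a)%:R * K (enum_rank (inl (j, a) : D)) i)) /=.
by apply: eq_bigr => j _; rewrite one.
Qed.

Lemma hvalD (T T' : TT) x : hash_value (T + T') x = hash_value T x + hash_value T' x.
Proof. by rewrite /hash_value stabD !ffunE (addrACA (stab _ _)) (addrACA (_ + _)). Qed.

(** The functionals in [K] vanish on the vectors of [Q] and are dual to those of [M], so shifting by
    [hsec K] moves the hash values on [M] freely and fixes the query hashes. Given the latter, the
    tests on [M] are independent. *)
Lemma hash_prob (M Q : {set X}) (p : X -> Rt)
  (test : X -> bits r -> {ffun {x : X | x \in Q} -> bits r} -> bool) :
  M :&: Q = set0 -> indep_mod N sq f g Q M ->
  (forall x phi, Ex (fun u => (test x u phi)%:R) <= p x) ->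
  Ex (fun T : TT => [forall x in M, test x (hash_value T x) [ffun q => hash_value T (val q)]]%:R)
  <= \prod_(x in M) p x.
Proof.
move=> MQ ind hp; pose t := #|M|.
pose G : 'M_(t, _) := \matrix_(i < t) full_char_vec (enum_val i).
pose R : 'M_(#|Q|, _) := \matrix_(i < #|Q|) full_char_vec (enum_val i).
have rowS (S : {set X}) (u : 'rV['F_2]_#|S|) :
    u *m (\matrix_(i < #|S|) full_char_vec (enum_val i)) = \sum_(x in [set enum_val i | i in [set i | u 0 i != 0]]) full_char_vec x.
  rewrite mulmx_sum_row big_imset /=; last by move=> a b _ _ /enum_val_inj.
  rewrite [RHS](eq_bigl (fun i => u 0 i != 0)) => [|i]; last by rewrite inE.
  by rewrite -sum_F2_scale; apply: eq_bigr => i _; rewrite rowK.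
have imS (S : {set X}) (u : 'rV['F_2]_#|S|) : [set enum_val i | i in [set i | u 0 i != 0]] \subset S.
  by apply/subsetP => x /imsetP [i _ ->]; apply: enum_valP.
have [K [GK RK]] : exists K, G *m K = 1%:M /\ R *m K = 0.
  apply: dual_family => u /submxP [v uv]; apply/eqP; apply: contraT => u0.
  case/negP: ind; pose Z1 := [set enum_val i | i in [set i | u 0 i != 0]].
  pose Z2 := [set enum_val i | i in [set i | v 0 i != 0]].
  have Z1M : Z1 \subset M := imS _ _; have Z2Q : Z2 \subset Q := imS _ _.
  apply/existsP; exists (Z1 :|: Z2); apply/and3P; split.
  - by rewrite subUset (subset_trans Z1M) ?subsetUl// (subset_trans Z2Q) ?subsetUr.
  - have [i ui] : exists i, u 0 i != 0.
      apply/existsP; move: u0; apply: contraR => /existsPn h; apply/eqP/rowP => i.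
      by rewrite mxE; apply/eqP; rewrite -[_ == _]negbK; apply: h.
    apply/set0Pn; exists (enum_val i); rewrite !inE enum_valP andbT.
    by apply/orP; left; apply: imset_f; rewrite inE.
  apply: full_zero_char_vec; rewrite (_ : Z1 :|: Z2 = sym_diff Z1 Z2).
    by rewrite sum_sym_diff -!rowS -/G -/R uv addrr2.
  have d x : (x \in Z1) && (x \in Z2) = false.
    apply/negP => /andP [/(subsetP Z1M) xM /(subsetP Z2Q) xQ].
    by move/setP/(_ x): MQ; rewrite !inE xM xQ.
  by apply/setP => x; have := d x; rewrite !inE; case: (x \in Z1); case: (x \in Z2).
have dG (i j : 'I_t) : (full_char_vec (enum_val i) *m K) 0 j = (i == j)%:R.
  by rewrite -(rowK (fun i : 'I_t => full_char_vec (enum_val i))) -row_mul GK rowE mulmx1 mxE eqxx eq_sym.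
have dR x : x \in Q -> full_char_vec x *m K = 0.
  move=> xQ; rewrite -(enum_rankK_in xQ xQ) -(rowK (fun i : 'I_#|Q| => full_char_vec (enum_val i))).
  by rewrite -row_mul RK row0.
pose U := {ffun 'I_t -> bits r}; pose I := {ffun {x : X | x \in Q} -> bits r}.
pose F (phi : I) (u : U) : Rt := \prod_i (test (enum_val i) (u i) phi)%:R.
apply: (@le_trans _ _ (Ex (fun T : TT => F [ffun q => hash_value T (val q)] [ffun i => hash_value T (enum_val i)]))).
  apply: Ex_le => T; rewrite /F; case: (boolP [forall x in M, _]) => [/forall_inP h|_].
    by rewrite big1// => i _; rewrite ffunE h// enum_valP.
  by apply: prodr_ge0.
rewrite (@Ex_section Rt TT I U U id id
   (fun T : TT => [ffun i => hash_value T (enum_val i)]) (fun T : TT => [ffun q => hash_value T (val q)])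
   (fun (u : U) (T : TT) => T + hsec K u) F 0) //; first last.
- by move=> u T; apply/ffunP => q; rewrite !ffunE hvalD hsecE dR ?(valP q)// big1 ?addr0// => i _; rewrite mxE scale0r.
- move=> u T; apply/ffunP => i; rewrite !ffunE hvalD hsecE; congr (_ + _).
  rewrite (bigD1 i)//= dG eqxx scale1r big1 ?addr0// => j ji.
  by rewrite dG eq_sym (negPf ji) scale0r.
- by move=> u; apply: addIr.
have pr0 : 0 <= \prod_(x in M) p x.
  by apply: prodr_ge0 => x _; apply: le_trans (hp x 0); apply: Ex_ge0.
apply: Ex_le_const => // T; set phi := [ffun q => _].
rewrite (Ex_prod (fun i v => (test (enum_val i) v phi)%:R)) [leRHS]big_enum_val /=.
by apply: ler_prod => i _; rewrite Ex_ge0//= hp.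
Qed.

End Hash.
End WithField.

(** * Numerical bounds *)

Lemma npair_prod t : npair t.*2 = (\prod_(i < t) i.*2.+1)%N.
Proof.
elim: t => [|t IH]; first by rewrite big_ord0.
by rewrite big_ord_recr /= -IH mulnC.
Qed.

(** In the square of the product, pair the factors 2i + 1 and 2j + 1 with i + j + 1 = t: their sum
    is 2t, so their product is at most t^2. *)
Lemma npair_le t : (npair t.*2 <= t ^ t)%N.
Proof.
rewrite -leq_sqr npair_prod -!mulnn {2}(reindex_inj rev_ord_inj) /= -big_split /=.
rewrite -expnMn -[X in (_ <= _ ^ X)%N]card_ord -prod_nat_const.
apply: leq_prod => i _ /=; have := nat_Cauchy i (t - i.+1).
have : (t = i + (t - i.+1) + 1)%N by have := ltn_ord i; lia.
by move: (t - i.+1)%N (nat_of_ord i) => j i' -> [h _]; move: h; rewrite -!mulnn; nia.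
Qed.

Lemma npair_odd a : odd a -> npair a = 0%N.
Proof.
elim/ltn_ind: a => -[|[|a]] IH //= h; rewrite IH ?muln0//.
by rewrite negbK in h.
Qed.

(** Passing from a to a + 2 multiplies the left side by (a + 1)^2 and the right side by (a + 1)(a +
    2). *)
Lemma npair_sqr a : (0 < a)%N -> ((npair a ^ 2).*2 <= a`!)%N.
Proof.
elim/ltn_ind: a => -[|[|[|a]]] IH // _; have := IH a.+1 (ltnW (ltnSn _)) isT.
rewrite -[npair a.+3]/(a.+2 * npair a.+1)%N 2!factS expnMn doubleMr => h.
apply: leq_trans (leq_mul (leqnn _) h) _.
by rewrite -mulnn -mulnA !leq_mul.
Qed.

Section WithField.
Variable Rt : realFieldType.
Local Notation Ex := (@Ex Rt _).

(* The even part of a certificate has [npair b] pairings in each of the two Psi-characters and is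
   counted in all of its [b`!] orderings. *)
Definition pairing_sum (l : nat) : Rt := \sum_(0 <= b < l.+1) ((npair b)%:R ^+ 2 / (b`!)%:R).

Lemma gterm (b : nat) : (0 < b)%N -> (npair b)%:R ^+ 2 / (b`!)%:R <= (~~ odd b)%:R / 2%:R :> Rt.
Proof.
move=> b0; have [o|o] := boolP (odd b); first by rewrite npair_odd// expr0n mul0r mul0r.
have f0 : 0 < (b`!)%:R :> Rt by rewrite ltr0n fact_gt0.
rewrite ler_pdivrMr//; have := npair_sqr b0; rewrite -(ler_nat Rt) -mul2n natrM natrX => h.
by rewrite mulr1n; lra.
Qed.

Lemma pairing_sumS l : pairing_sum l.+1 = pairing_sum l + (npair l.+1)%:R ^+ 2 / (l.+1`!)%:R.
Proof. by rewrite /pairing_sum big_nat_recr. Qed.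

(** Besides the 1 at [b = 0] only even [b] contribute, each at most 1 / 2. *)
Lemma pairing_sum_le l : pairing_sum l <= (l + 4)%:R / 4%:R.
Proof.
elim/ltn_ind: l => -[|[|l]] IH.
- rewrite /pairing_sum big_nat1 fact0 expr1n divr1 add0n divff ?pnatr_eq0//.
- rewrite /pairing_sum big_nat_recr// big_nat1 fact0 expr1n divr1 (_ : npair 1 = 0%N)// expr0n mul0r /= addr0.
  clear; lra.
have h := IH l (ltnW (ltnSn _)); rewrite !pairing_sumS.
have g1 := gterm (ltn0Sn l); have g2 := gterm (ltn0Sn l.+1).
have e : (~~ odd l.+1)%:R + (~~ odd l.+2)%:R = 1 :> Rt.
  by rewrite /= negbK; case: (odd l); rewrite ?addr0 ?add0r.
have -> : (l.+2 + 4)%:R = (l + 4)%:R + 2%:R :> Rt by rewrite -natrD; congr (_%:R); lia.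
by lra.
Qed.

(** Repeated squaring, rounded up to hundredths. The exponent is 16 because n = 16 * 2^(k - 4). *)
Lemma pow98 : (1 + 1 / 8%:R : Rt) ^+ 16 <= 8%:R.
Proof.
have sq (a b : Rt) : 0 <= a -> a <= b -> a ^+ 2 <= b ^+ 2.
  by move=> a0 ab; rewrite lerXn2r ?nnegrE ?(le_trans a0 ab).
have z1 : (1 + 1 / 8%:R : Rt) ^+ 2 <= 127%:R / 100%:R by rewrite expr2; clear; lra.
have z0 : 0 <= 1 + 1 / 8%:R :> Rt by clear; lra.
move: (1 + 1 / 8%:R) z0 z1 => z z0 z1.
have z2 : z ^+ 4 <= 162%:R / 100%:R.
  rewrite (exprM z 2 2); apply: le_trans (sq _ _ (exprn_ge0 _ z0) z1) _.
  by rewrite expr2; clear; lra.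
have z3 : z ^+ 8 <= 263%:R / 100%:R.
  rewrite (exprM z 4 2); apply: le_trans (sq _ _ (exprn_ge0 _ z0) z2) _.
  by rewrite expr2; clear; lra.
rewrite (exprM z 8 2); apply: le_trans (sq _ _ (exprn_ge0 _ z0) z3) _.
by rewrite expr2; clear; lra.
Qed.

Lemma pow14 : (1 / 4%:R) ^+ 4 * 8%:R <= 32%:R^-1 :> Rt.
Proof. by rewrite 3!exprS expr1; clear; lra. Qed.

Section Split.
Variable k : nat.
Hypothesis hk : (8 <= k)%N.
Local Notation n := (#|bits k|%:R : Rt).
Local Notation s := (3 * k - 8)%N.

Lemma card_bits_split : #|bits k| = (16 * 2 ^ (k - 4))%N.
Proof. by rewrite card_bits -(expnD 2 4); congr (_ ^ _)%N; lia. Qed.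

(** Both are equalities at k = 8. The first compares the exponents in [large_le], the second puts
    the threshold n / 2 + s of [split_cost_prob] below n. *)
Lemma k_le : (14 * k - 32 <= 5 * 2 ^ (k - 4))%N /\ (32 * k <= 2 ^ k)%N.
Proof.
elim: k hk => // k' IH; rewrite leq_eqVlt => /orP [/eqP <-//|k8].
have [h1 h2] := IH k8; rewrite (_ : k'.+1 - 4 = (k' - 4).+1)%N ?expnS; last by lia.
by split; nia.
Qed.

(** Two more keys multiply the rate by (a + 1) / n, which is at most 1 in this range. *)
Lemma match_rate_antimono a : (16 <= a)%N -> ~~ odd a -> (a <= #|bits k|)%N ->
  match_rate k a <= match_rate k 16 :> Rt.
Proof.
elim/ltn_ind: a => -[|[|a]] IH // a16 ae an.
have [->//|a14] := eqVneq a.+2 16%N.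
have ea : ~~ odd a by move: ae; rewrite /= negbK.
have h : (16 <= a)%N by have := odd_double_half a; rewrite (negPf ea); move: a16 a14; move: (a./2) => b; lia.
apply: le_trans (IH a (ltnW (ltnSn _)) h ea (ltnW (ltnW an))).
have n0 := @n_gt0 Rt k hk.
have an' : a.+1%:R <= n by rewrite ler_nat ltnW.
rewrite /match_rate -[npair a.+2]/(a.+1 * npair a)%N natrM.
have -> : (a.+2./2.-1 = (a./2.-1).+1)%N by move: h; case: a {IH a16 ae an a14 ea an'} => [|[|a]].
rewrite exprS invfM mulrACA -[leRHS]mul1r ler_wpM2r ?ler_pdivrMr ?mul1r//.
by rewrite mulr_ge0 ?invr_ge0 ?exprn_ge0.
Qed.

(* [split_level] with [x = 1 / 8] and [t = n / 4]. *)
Definition split_cost : Rt := 2%:R ^+ s * (match_rate k 16 + (1 + 1 / 8%:R) ^+ #|bits k| / (1 / 8%:R) ^+ s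
   * ((npair (4 * 2 ^ (k - 4)).*2)%:R / n ^+ (4 * 2 ^ (k - 4)))).

(** With u = n / 16 the factors are at most 8^u, 8^s and 4^(-4u). It remains to see n^2 * 16^s <=
    32^u, that is 14 k - 32 <= 5 u. *)
Lemma large_le : n ^+ 2 * (2%:R ^+ s * ((1 + 1 / 8%:R) ^+ #|bits k| / (1 / 8%:R) ^+ s
   * ((npair (4 * 2 ^ (k - 4)).*2)%:R / n ^+ (4 * 2 ^ (k - 4))))) <= 1.
Proof.
set u := (2 ^ (k - 4))%N; set t := (4 * u)%N.
have n0 := @n_gt0 Rt k hk.
have nE : n = 4%:R * t%:R by rewrite card_bits_split -natrM; congr (_%:R); rewrite /t -/u; lia.
have t0 : 0 < t%:R :> Rt by rewrite nE in n0; lra.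
have h1 : (1 + 1 / 8%:R : Rt) ^+ #|bits k| <= 8%:R ^+ u.
  rewrite card_bits_split exprM lerXn2r ?nnegrE ?exprn_ge0 ?pow98//; lra.
have h2 : (npair t.*2)%:R / n ^+ t <= (1 / 4%:R) ^+ t.
  rewrite nE exprMn invfM mulrCA -(ler_pM2r (exprn_gt0 t t0)) -mulrA divfK ?expf_neq0 ?lt0r_neq0//.
  have : (npair t.*2)%:R <= t%:R ^+ t :> Rt by rewrite -natrX ler_nat npair_le.
  move=> h; rewrite div1r exprVn ler_wpM2l// invr_ge0 exprn_ge0//.
have h3 : ((1 / 8%:R : Rt) ^+ s)^-1 = 8%:R ^+ s by rewrite div1r exprVn invrK.
rewrite h3.
have q1 : (1 + 1 / 8%:R) ^+ #|bits k| * 8%:R ^+ s * ((npair t.*2)%:R / n ^+ t)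
   <= 8%:R ^+ s / 32%:R ^+ u.
  apply: (@le_trans _ _ (8%:R ^+ u * 8%:R ^+ s * (1 / 4%:R) ^+ t)).
    have e0 : 0 <= 1 + 1 / 8%:R :> Rt := addr_ge0 ler01 (divr_ge0 ler01 (ler0n _ _)).
    apply: ler_pM; last exact: h2.
    - exact: (mulr_ge0 (exprn_ge0 _ e0) (exprn_ge0 _ (ler0n _ _))).
    - by apply: (mulr_ge0 (ler0n _ _)); rewrite invr_ge0 exprn_ge0 ?ltW.
    - exact: (ler_wpM2r (exprn_ge0 _ (ler0n _ _)) h1).
  rewrite mulrC mulrA /t exprM -exprMn mulrC ler_wpM2l ?exprn_ge0//.
  have e1 := pow14.
  rewrite -exprVn lerXn2r ?nnegrE ?invr_ge0 ?ler0n// (mulr_ge0 _ (ler0n _ _))// exprn_ge0//.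
  exact: (divr_ge0 ler01 (ler0n _ _)).
have q2 : n ^+ 2 * (2%:R ^+ s * (8%:R ^+ s / 32%:R ^+ u)) <= 1.
  rewrite !mulrA ler_pdivrMr ?exprn_gt0// mul1r -!natrX -!natrM ler_nat.
  rewrite card_bits -(expnM 2 k 2) -[8%N]/(2 ^ 3)%N -[32%N]/(2 ^ 5)%N -!expnM -!expnD leq_exp2l//.
  have [h _] := k_le; rewrite -/u in h; lia.
apply: le_trans q2; apply: (ler_wpM2l (exprn_ge0 _ (ltW n0))).
exact: (ler_wpM2l (exprn_ge0 _ (ler0n _ _)) q1).
Qed.

(** The factor by which setting aside [s] keys shrinks the weighted sums, see [wsum_shift]. *)
Definition shift_cost : Rt := (1 + s%:R / 4%:R) / 2%:R ^+ s.

Lemma split_cost_ge0 : 0 <= split_cost.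
Proof.
have e0 : 0 <= 1 + 1 / 8%:R :> Rt := addr_ge0 ler01 (divr_ge0 ler01 (ler0n _ _)).
have e8 : 0 <= 1 / 8%:R :> Rt := divr_ge0 ler01 (ler0n _ _).
apply: (mulr_ge0 (exprn_ge0 _ (ler0n _ _)) (addr_ge0 (match_rate_ge0 _ _ _) _)).
apply: (mulr_ge0 (divr_ge0 (exprn_ge0 _ e0) (exprn_ge0 _ e8))).
exact: (divr_ge0 (ler0n _ _) (exprn_ge0 _ (ler0n _ _))).
Qed.

Lemma shift_cost_exp : (3 * k - 4 <= 20 * 2 ^ (k - 8))%N.
Proof.
elim: k hk => // k' IH; rewrite leq_eqVlt => /orP [/eqP <-//|k8].
have h := IH k8; rewrite (_ : k'.+1 - 8 = (k' - 8).+1)%N ?expnS; last by lia.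
have : (0 < 2 ^ (k' - 8))%N by rewrite expn_gt0.
by move: (2 ^ _)%N h; lia.
Qed.

Lemma shift_cost_le : n ^+ 2 * shift_cost <= 5%:R.
Proof.
have p0 : 0 < 2%:R ^+ s :> Rt by rewrite exprn_gt0.
rewrite /shift_cost mulrA ler_pdivrMr//.
have -> : 1 + s%:R / 4%:R = (4 + s)%:R / 4%:R :> Rt by rewrite natrD mulrDl divff ?pnatr_eq0.
rewrite mulrA ler_pdivrMr ?ltr0n// -!natrX -!natrM ler_nat card_bits.
have -> : (4 + s = 3 * k - 4)%N by lia.
apply: leq_trans (leq_mul (leqnn _) shift_cost_exp) _.
rewrite (_ : s = k * 2 + (k - 8))%N; last by lia.
rewrite expnD expnM; lia.
Qed.

Lemma match_rate16_le : n ^+ 2 * (2%:R ^+ s * match_rate k 16) <= 1.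
Proof.
have n0 := @n_gt0 Rt k hk.
rewrite /match_rate !mulrA ler_pdivrMr ?exprn_gt0// mul1r -!natrX -!natrM ler_nat.
apply: leq_trans (leq_mul (leqnn _) (npair_le 8)) _.
rewrite card_bits -[8%N]/(2 ^ 3)%N -!expnM -!expnD leq_exp2l//=; lia.
Qed.

(** In units of n^(-2) the three costs are at most 5, 1 and 1, and 7 <= 9. The choice of s makes 2^s
    = n^3 / 256: large enough for the shift cost, small enough for 2^s remaining zero sets. *)
Lemma split_shift_cost_le : shift_cost + split_cost <= (3%:R / n) ^+ 2.
Proof.
have n0 := @n_gt0 Rt k hk.
rewrite expr_div_n ler_pdivlMr ?exprn_gt0// mulrC mulrDr /split_cost !mulrDr.
have h1 := shift_cost_le; have h2 := match_rate16_le; have h3 := large_le.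
apply: le_trans (lerD h1 (lerD h2 h3)) _.
by rewrite -natrX -[1]/(1%:R) -!natrD ler_nat.
Qed.

Lemma split_cost_prob (c d : nat) (hc : (0 < c)%N) (hd : (1 < d)%N)
  (i : 'I_d.-1) (V V1 : {set key k c}) :
  V1 \subset V -> (#|V :\: V1| <= s)%N ->
  Ex (fun H : htil_tables k c d =>
    [exists w : {set key k c}, [&& w \subset V, (14 < #|w|)%N & circuit (zero_set (dseq H) (c + i)) w]]%:R)
  <= Ex (fun H : htil_tables k c d => (dep (dseq H) (c + i - 1) V1)%:R)
   + split_cost * Ex (fun H : htil_tables k c d => (dep (dseq H) (c + i - 1) V)%:R).
Proof.
have [_ k32] := k_le; have cb := card_bits k; have cs := card_bits_split.
(* The threshold is n / 2 + s: a larger zero set keeps 2 t = n / 2 keys after losing [s]. *)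
apply: (@split_level Rt k c d hc hd i V V1 s (2 * (4 * 2 ^ (k - 4)) + s)%N).
- exact: match_rate_ge0.
- by rewrite divr_gt0 ?ltr0n.
- by rewrite ler_pdivrMr ?ltr0n// mul1r ler1n.
- move=> a a14 ae aU; apply: match_rate_antimono => //; last first.
    by apply: leq_trans aU _; rewrite cs in cb *; move: k32; rewrite -cb; lia.
  by have := odd_double_half a; rewrite (negPf ae); move: a14; move: (a./2) => b; lia.
- by lia.
Qed.

End Split.

End WithField.

(** * Series with geometric weights *)

Section WithField.
Variable Rt : realFieldType.
Local Notation hf := (2%:R^-1 : Rt).

Lemma hf_ge0 j : 0 <= hf ^+ j.
Proof. by rewrite exprn_ge0// invr_ge0. Qed.

(** By Pascal's rule the full series S_j satisfy S_(j+1) = (S_(j+1) + S_j) / 2, so all equal S_0 =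
    2. *)
Lemma sum_bin_geom L j : \sum_(l < L) 'C(l, j)%:R * hf ^+ l <= 2%:R.
Proof.
have half : hf * 2%:R = 1 by rewrite mulVf ?pnatr_eq0.
have h0 : 0 <= hf by rewrite invr_ge0.
elim: L j => [|L IH] j; first by rewrite big_ord0.
rewrite big_ord_recl expr0 mulr1; case: j => [|j].
  rewrite bin0 (eq_bigr (fun l : 'I_L => hf * ('C(l, 0)%:R * hf ^+ l))) => [|l _]; last first.
    by rewrite !bin0 exprS mulrCA.
  rewrite -mulr_sumr; have := ler_wpM2l h0 (IH 0%N).
  by rewrite half => h; apply: le_trans (lerD (lexx _) h) _; exact: lexx.
rewrite bin0n mulr0n add0r.
rewrite (eq_bigr (fun l : 'I_L => hf * ('C(l, j.+1)%:R * hf ^+ l) + hf * ('C(l, j)%:R * hf ^+ l))) => [|l _]; last first.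
  by rewrite lift0 binS natrD exprS; ring.
rewrite big_split -!mulr_sumr /=.
have := lerD (ler_wpM2l h0 (IH j.+1)) (ler_wpM2l h0 (IH j)).
by rewrite half; apply: le_trans; exact: lexx.
Qed.

(* The number of terms [L] plays no role: all bounds are those of the infinite series. *)
Definition wsum (L : nat) (f : nat -> Rt) : Rt := \sum_(l < L) (l + 3)%:R * hf ^+ l * f l.

Lemma wsum_le L f g : (forall l, f l <= g l) -> wsum L f <= wsum L g.
Proof. by move=> h; apply: ler_sum => l _; rewrite ler_wpM2l// mulr_ge0 ?hf_ge0. Qed.

Lemma wsumD L f g : wsum L (fun l => f l + g l) = wsum L f + wsum L g.
Proof. by rewrite -big_split; apply: eq_bigr => l _; rewrite mulrDr. Qed.

Lemma wsumZ L a f : wsum L (fun l => a * f l) = a * wsum L f.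
Proof. by rewrite mulr_sumr; apply: eq_bigr => l _; rewrite mulrCA. Qed.

Lemma wsum_sum L (I : Type) (r : seq I) (F : I -> nat -> Rt) :
  wsum L (fun l => \sum_(i <- r) F i l) = \sum_(i <- r) wsum L (F i).
Proof. by rewrite exchange_big; apply: eq_bigr => l _; rewrite mulr_sumr. Qed.

Lemma wsum_ge0 L f : (forall l, 0 <= f l) -> 0 <= wsum L f.
Proof. by move=> f0; apply: sumr_ge0 => l _; rewrite !mulr_ge0 ?hf_ge0. Qed.

Lemma hf2 : 2%:R * hf = 1. Proof. by rewrite divff ?pnatr_eq0. Qed.

(** Since (l + 1) C(l, a) = (a + 1) C(l + 1, a + 1), the factor l + 3 is absorbed into two series of
    [sum_bin_geom]. *)
Lemma wsum_bin L a : wsum L (fun l => 'C(l, a)%:R) <= (4 * a + 8)%:R.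
Proof.
have b1 := sum_bin_geom L a; have b2 := sum_bin_geom L.+1 a.+1.
rewrite big_ord_recl bin0n mulr0n mul0r add0r in b2.
rewrite /wsum (eq_bigr (fun l : 'I_L => a.+1%:R * (2%:R * ('C(l.+1, a.+1)%:R * hf ^+ l.+1))
    + 2%:R * ('C(l, a)%:R * hf ^+ l))) => [|l _]; last first.
  have h : (l + 3)%:R * 'C(l, a)%:R = a.+1%:R * 'C(l.+1, a.+1)%:R + 2%:R * 'C(l, a)%:R :> Rt.
    rewrite -!natrM -natrD; congr (_%:R); have := mul_bin_diag l.+1 a; rewrite /=; lia.
  by rewrite mulrAC h exprS; have := hf2; move: (hf ^+ l) => z e; ring: e.
rewrite big_split -!mulr_sumr /=.
have c := lerD (ler_wpM2l (ler0n _ a.+1) (ler_wpM2l (ler0n _ 2) b2)) (ler_wpM2l (ler0n _ 2) b1).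
apply: le_trans c _; rewrite -!natrM -natrD ler_nat; lia.
Qed.

Lemma wsum_bin_pred L a : (1 < a)%N -> wsum L (fun l => 'C(l.-1, a.-1)%:R) <= (2 * a + 3)%:R.
Proof.
case: a => [|[|a]] // _; have b1 := sum_bin_geom L a.+2; have b2 := sum_bin_geom L.-1 a.+1.
case: L b1 b2 => [|L] b1 b2; first by rewrite /wsum big_ord0.
rewrite /wsum (eq_bigr (fun l : 'I_L.+1 => a.+2%:R * ('C(l, a.+2)%:R * hf ^+ l)
    + 3%:R * ('C(l.-1, a.+1)%:R * hf ^+ l))) => [|l _]; last first.
  have h : (l + 3)%:R * 'C(l.-1, a.+1)%:R = a.+2%:R * 'C(l, a.+2)%:R + 3%:R * 'C(l.-1, a.+1)%:R :> Rt.
    rewrite -!natrM -natrD; congr (_%:R); have := mul_bin_diag l a.+1; lia.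
  by rewrite /= mulrAC h; ring.
rewrite big_split -!mulr_sumr /= [X in _ + _ * X]big_ord_recl /= bin0n mulr0n mul0r add0r.
rewrite (eq_bigr (fun l : 'I_L => hf * ('C(l, a.+1)%:R * hf ^+ l))) => [|l _]; last first.
  by rewrite exprS mulrCA.
rewrite -mulr_sumr.
have h0 : 0 <= hf by rewrite invr_ge0.
have c := lerD (ler_wpM2l (ler0n _ a.+2) b1) (ler_wpM2l (ler0n _ 3) (ler_wpM2l h0 b2)).
rewrite (mulrC hf 2%:R) hf2 mulr1 in c.
by apply: le_trans c _; rewrite -!natrM -natrD ler_nat; lia.
Qed.

Lemma wsum_sub_coef L : wsum L sub_coef <= 37%:R.
Proof.
have [c4 c6 c8 [c10 c12 c14]] := @small_coef_values Rt.
rewrite /sub_coef wsum_sum (eq_bigr (fun a => small_coef a * wsum L (fun l => 'C(l, a)%:R))) => [|a _]; last first.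
  by rewrite -wsumZ; apply: eq_bigr => l _; rewrite [X in _ * X]mulrC.
apply: (@le_trans _ _ (\sum_(a <- small_sizes) small_coef a * (4 * a + 8)%:R)).
  by apply: ler_sum => a _; rewrite ler_wpM2l ?small_coef_ge0 ?wsum_bin.
by rewrite !big_cons big_nil c4 c6 c8 c10 c12 c14 !natrD !natrM; clear; lra.
Qed.

Lemma wsum_sub_coef_last L : wsum L sub_coef_last <= 17%:R.
Proof.
have [c4 c6 c8 [c10 c12 c14]] := @small_coef_values Rt.
rewrite /sub_coef_last wsum_sum (eq_bigr (fun a => small_coef a * wsum L (fun l => 'C(l.-1, a.-1)%:R))) => [|a _]; last first.
  by rewrite -wsumZ; apply: eq_bigr => l _; rewrite [X in _ * X]mulrC.
apply: (@le_trans _ _ (\sum_(a <- small_sizes) small_coef a * (2 * a + 3)%:R)).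
  rewrite big_seq [leRHS]big_seq; apply: ler_sum => a aa.
  by rewrite ler_wpM2l ?small_coef_ge0 ?wsum_bin_pred//; move: aa; case: a => [|[|]].
by rewrite !big_cons big_nil c4 c6 c8 c10 c12 c14 !natrD !natrM; clear; lra.
Qed.

Lemma wsum_small_coef L : wsum L small_coef <= 2%:R.
Proof.
have [c4 c6 c8 [c10 c12 c14]] := @small_coef_values Rt.
have h1 a : (4 <= a)%N -> (a + 3)%:R * hf ^+ a <= 1.
  move=> a4; rewrite exprVn ler_pdivrMr ?exprn_gt0// mul1r -natrX ler_nat.
  elim: a a4 => // a IH; rewrite leq_eqVlt => /orP [/eqP <-//|a4]; rewrite expnS.
  by have := IH a4; lia.
have h2 a : (4 <= a)%N -> wsum L (fun l => (l == a)%:R) <= 1.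
  move=> a4; have [aL|La] := ltnP a L.
    rewrite /wsum (bigD1 (Ordinal aL))//= eqxx mulr1 big1 ?addr0 ?h1// => l ne.
    by rewrite (_ : (_ == _) = false) ?mulr0//; apply: contraNF ne => /eqP e; apply/eqP/val_inj.
  rewrite /wsum big1 ?ler01// => l _; rewrite (_ : (_ == _) = false) ?mulr0//.
  by apply/negP => /eqP e; have := ltn_ord l; rewrite e ltnNge La.
apply: (@le_trans _ _ (\sum_(a <- small_sizes) small_coef a * 1)); last first.
  by rewrite !big_cons big_nil c4 c6 c8 c10 c12 c14; clear; lra.
apply: (@le_trans _ _ (\sum_(a <- small_sizes) small_coef a * wsum L (fun l => (l == a)%:R))); last first.
  rewrite big_seq [leRHS]big_seq; apply: ler_sum => a aa; rewrite ler_wpM2l ?small_coef_ge0 ?h2//.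
  by move: aa; case: a => [|[|[|[|]]]].
under [leRHS]eq_bigr do rewrite -wsumZ.
rewrite -wsum_sum; apply: wsum_le => l.
have [la|la] := boolP (l \in small_sizes); last first.
  by rewrite small_coef_out// sumr_ge0// => a _; exact: (mulr_ge0 (small_coef_ge0 _ _) (ler0n _ _)).
rewrite (bigD1_seq l)//= eqxx mulr1 lerDl sumr_ge0// => a _.
exact: (mulr_ge0 (small_coef_ge0 _ _) (ler0n _ _)).
Qed.

(** For l >= 1 one has l + s + 3 <= (1 + s / 4)(l + 3); the case l = 0 is excluded by [f 0 = 0],
    which is why empty sequences must have bound 0. *)
Lemma wsum_shift L s f : f 0%N = 0 -> (forall l, 0 <= f l) ->
  wsum L (fun l => f (l - s)%N) <= (1 + s%:R / 4%:R) / 2%:R ^+ s * wsum L f.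
Proof.
move=> f00 f0; have t0 l : 0 <= (l + 3)%:R * hf ^+ l * f (l - s)%N by rewrite !mulr_ge0 ?hf_ge0.
apply: (@le_trans _ _ (wsum (s + L) (fun l => f (l - s)%N))).
  rewrite /wsum -!(big_mkord xpredT (fun l => (l + 3)%:R * hf ^+ l * f (l - s)%N)).
  by rewrite [leRHS](big_cat_nat (leq0n L) (leq_addl _ _)) lerDl sumr_ge0.
rewrite /wsum big_split_ord /= big1 ?add0r => [|l _]; last first.
  by rewrite (_ : l - s = 0)%N ?f00 ?mulr0//; apply/eqP; rewrite subn_eq0 ltnW.
rewrite mulr_sumr; apply: ler_sum => l _; rewrite addKn mulrA.
case: (nat_of_ord l) => [|l']; first by rewrite f00 !mulr0.
rewrite ler_wpM2r// exprD -exprVn.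
have -> : (1 + s%:R / 4%:R) * hf ^+ s * ((l'.+1 + 3)%:R * hf ^+ l'.+1)
   = (1 + s%:R / 4%:R) * (l'.+1 + 3)%:R * (hf ^+ s * hf ^+ l'.+1) by ring.
rewrite ler_wpM2r ?(mulr_ge0 (hf_ge0 _) (hf_ge0 _))//.
have -> : 1 + s%:R / 4%:R = (4 + s)%:R / 4%:R :> Rt by rewrite natrD mulrDl divff ?pnatr_eq0.
by rewrite mulrAC ler_pdivlMr ?ltr0n// -!natrM ler_nat; nia.
Qed.

Section Bounds.
Variables (k s : nat) (e : Rt).
Hypotheses (hk : (8 <= k)%N) (e0 : 0 <= e).
Local Notation n := (#|bits k|%:R : Rt).
Local Notation x3 := (3%:R / n).
Let ta : Rt := (1 + s%:R / 4%:R) / 2%:R ^+ s.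
(** A split costs at most as much as two levels of circuits of at most 14 keys; supplied by
    [split_shift_cost_le]. *)
Hypothesis hte : ta + e <= x3 ^+ 2.

Lemma x3_le : x3 <= 3%:R / 256%:R.
Proof. by rewrite ler_pM2l ?ltr0n// lef_pV2 ?posrE ?n_gt0 ?n_ge ?ltr0n. Qed.

Lemma te_ge0 : 0 <= ta + e.
Proof.
apply: addr_ge0 => //; apply: (divr_ge0 (addr_ge0 ler01 (divr_ge0 (ler0n _ _) (ler0n _ _)))).
exact: (exprn_ge0 _ (ler0n _ _)).
Qed.

Lemma wsum_step L f : f 0%N = 0 -> (forall l, 0 <= f l) ->
  wsum L (fun l => f (l - s)%N + e * f l) <= (ta + e) * wsum L f.
Proof. by move=> f00 f0; rewrite wsumD wsumZ mulrDl lerD2r wsum_shift. Qed.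

Lemma wsum_long_bound L j : wsum L (long_bound s e j) <= 8%:R * (ta + e) ^+ j.
Proof.
have N0 i : long_bound s e i 0 = 0 by elim: i => //= i IH; rewrite sub0n IH mulr0 addr0.
elim: j => [|j IH].
  rewrite expr0 mulr1; apply: le_trans (wsum_bin L 0); apply: wsum_le => l.
  by rewrite bin0 /=; case: l.
apply: le_trans (wsum_step L (N0 j) (long_bound_ge0 s e0 j)) _.
by rewrite exprS mulrCA ler_wpM2l ?te_ge0.
Qed.

(** The newest level contributes 37; everything older is smaller by the factor 38 * 3 / n < 1 and
    fits into the remaining 1. *)
Lemma wsum_size_bound L j : wsum L (size_bound k s e j) <= 38%:R * x3 ^+ j.
Proof.
have x0 : 0 <= x3 := x3_ge0 Rt k.
elim: j => [|j IH].
  by rewrite /wsum big1 ?mulr_ge0 ?exprn_ge0// => l _; rewrite mulr0.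
have -> : wsum L (size_bound k s e j.+1) = x3 ^+ j.+1 * wsum L sub_coef
    + wsum L (fun l => size_bound k s e j (l - s) + e * size_bound k s e j l).
  rewrite -wsumZ -wsumD; apply: eq_bigr => l _; congr (_ * _).
  by rewrite /= -addrA [X in X + _]mulrC.
have h1 := ler_wpM2l (exprn_ge0 j.+1 x0) (wsum_sub_coef L).
have h2 := wsum_step L (size_bound0 k s e j) (size_bound_ge0 k s e0 j).
have h3 : (ta + e) * wsum L (size_bound k s e j) <= x3 ^+ j.+1.
  apply: (@le_trans _ _ (x3 ^+ 2 * (38%:R * x3 ^+ j))).
    apply: ler_pM => //; first exact: te_ge0.
    by apply: wsum_ge0 => l; apply: size_bound_ge0.
  rewrite expr2 exprS -mulrA ler_wpM2l// mulrCA mulrA ler_piMl ?exprn_ge0//.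
  have := x3_le; move: x3 => z; lra.
apply: le_trans (lerD h1 (le_trans h2 h3)) _.
have -> : 38%:R = 37%:R + 1 :> Rt by rewrite natr1.
by rewrite (mulrC _ 37%:R) [leRHS]mulrDl mul1r.
Qed.

Lemma wsum_split_bound L d : (1 < d)%N -> wsum L (split_bound k d s e) <= x3 ^+ d.-1.
Proof.
move=> hd; have x0 : 0 <= x3 := x3_ge0 Rt k.
apply: le_trans (wsum_step L (size_bound0 k s e _) (size_bound_ge0 k s e0 _)) _.
apply: (@le_trans _ _ (x3 ^+ 2 * (38%:R * x3 ^+ d.-2))).
  apply: ler_pM => //; [exact: te_ge0| |exact: wsum_size_bound].
  by apply: wsum_ge0 => l; apply: size_bound_ge0.
have -> : d.-1 = d.-2.+1 by case: d hd => [|[|]].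
rewrite expr2 exprS -mulrA ler_wpM2l// mulrCA mulrA ler_piMl ?exprn_ge0//.
have := x3_le; move: x3 => z; lra.
Qed.

Variables (d : nat) (m mu : Rt).
Hypotheses (hd : (1 < d)%N) (m0 : 0 < m) (mu0 : 0 <= mu) (mum : mu <= m / 2%:R).
Local Notation y := (mu / m).
Local Notation A := (mu * y ^+ 2).

Lemma y_ge0 : 0 <= y. Proof. exact: (divr_ge0 mu0 (ltW m0)). Qed.

Lemma y_hf l j : (j <= l)%N -> y ^+ l <= y ^+ (l - j) * hf ^+ j.
Proof.
move=> jl; rewrite -{1}(subnK jl) exprD ler_wpM2l ?exprn_ge0 ?y_ge0//.
by rewrite lerXn2r ?nnegrE ?y_ge0 ?invr_ge0// ler_pdivrMr// mulrC.
Qed.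

Lemma hf_inv j : (2 ^ j)%:R * hf ^+ j = 1.
Proof. by rewrite exprVn -natrX divff// pnatr_eq0 expn_eq0. Qed.

(** Three keys make up the factor mu * (mu / m)^2; every further one brings mu / m <= 1 / 2. *)
Lemma scale_main l : (3 <= l)%N -> mu ^+ l / m ^+ l.-1 <= A * (16%:R * hf ^+ l.+1).
Proof.
case: l => // l l2; have -> : mu ^+ l.+1 / m ^+ l = mu * y ^+ l by rewrite exprS expr_div_n mulrA.
rewrite -mulrA ler_wpM2l//; apply: le_trans (y_hf (leq_subr 2 l)) _.
rewrite subKn// ler_wpM2l ?exprn_ge0 ?y_ge0//.
have -> : l.+2 = (4 + (l - 2))%N by lia.
by rewrite exprD mulrA (hf_inv 4) mul1r.
Qed.

(** With one more factor mu, five keys are needed to reach the square of the main factor. *)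
Lemma scale_rest l : (5 <= l)%N -> mu ^+ l.+1 / m ^+ l.-1 <= A ^+ 2 * (64%:R * hf ^+ l.+1).
Proof.
case: l => // l l4; have -> : mu ^+ l.+2 / m ^+ l = mu ^+ 2 * y ^+ l.
  by rewrite -addn2 addnC exprD expr_div_n mulrA.
have -> : A ^+ 2 = mu ^+ 2 * y ^+ 4 by move: y => y'; ring.
rewrite -mulrA ler_wpM2l ?exprn_ge0//; apply: le_trans (y_hf (leq_subr 4 l)) _.
rewrite subKn// ler_wpM2l ?exprn_ge0 ?y_ge0//.
have -> : l.+2 = (6 + (l - 4))%N by lia.
by rewrite exprD mulrA (hf_inv 6) mul1r.
Qed.

(** The right sides of [sum_top_dep] and [sum_top_full]: all certificates with [l] keys besides the
    last, up to the cost of the Psi-characters. *)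
Definition layer (l : nat) : Rt :=
  mu ^+ l * (sub_coef_last l.+1 * x3 ^+ d.-1)
    + (14 < l.+1)%N%:R * (mu ^+ l * split_bound k d s e l.+1 + mu ^+ l.+1 * long_bound s e d.-1 l.+1)
  + mu ^+ l * (small_coef l.+1 * x3 ^+ d.-1 + (14 < l.+1)%N%:R * (split_bound k d s e l.+1 + long_bound s e d.-1 l.+1)).

Lemma layer_le l :
  pairing_sum Rt l / m ^+ l.-1 * layer l <=
  4%:R * A * ((l.+1 + 3)%:R * hf ^+ l.+1 * ((sub_coef_last l.+1 + small_coef l.+1) * x3 ^+ d.-1
     + 2%:R * split_bound k d s e l.+1 + long_bound s e d.-1 l.+1))
  + 16%:R * A ^+ 2 * ((l.+1 + 3)%:R * hf ^+ l.+1 * long_bound s e d.-1 l.+1).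
Proof.
have x0 : 0 <= x3 := x3_ge0 Rt k.
have S0 := split_bound_ge0 k d s e0 l.+1; have N0 := long_bound_ge0 s e0 d.-1 l.+1.
have c0 : 0 <= (sub_coef_last l.+1 + small_coef l.+1) * x3 ^+ d.-1.
  exact: (mulr_ge0 (addr_ge0 (sub_coef_last_ge0 _ _) (small_coef_ge0 _ _)) (exprn_ge0 _ x0)).
have A0 : 0 <= A := mulr_ge0 mu0 (exprn_ge0 _ y_ge0).
set c := (sub_coef_last _ + _) * _ in c0 *.
(* With fewer than four keys in all there is no zero set, and the layer vanishes. *)
have [l3|l3] := ltnP l 3.
  have ca : sub_coef_last l.+1 = 0 :> Rt.
    rewrite /sub_coef_last big_seq big1// => a aa; rewrite bin_small ?mul0r//.
    by apply: leq_trans l3 _; move: aa; case: a => [|[|[|[|]]]].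
  have cz : small_coef l.+1 = 0 :> Rt by rewrite small_coef_out//; case: l l3 {S0 N0 c0 c ca} => [|[|[|]]].
  have -> : layer l = 0.
    have l14 : (14 < l.+1)%N = false by apply/negbTE; rewrite -leqNgt; apply: leq_trans l3 _.
    by rewrite /layer ca cz l14 !(mul0r, mulr0, addr0).
  rewrite mulr0; apply: addr_ge0.
    apply: (mulr_ge0 (mulr_ge0 (ler0n _ _) A0)); apply: (mulr_ge0 (mulr_ge0 (ler0n _ _) (hf_ge0 _))).
    by rewrite !addr_ge0// mulr_ge0.
  apply: (mulr_ge0 (mulr_ge0 (ler0n _ _) (exprn_ge0 _ A0))).
  by rewrite !mulr_ge0 ?hf_ge0.
pose b : Rt := (14 < l.+1)%N%:R.
have -> : pairing_sum Rt l / m ^+ l.-1 * layer l =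
    pairing_sum Rt l * (mu ^+ l / m ^+ l.-1 * (c + b * (2%:R * split_bound k d s e l.+1 + long_bound s e d.-1 l.+1))
     + (b * (mu ^+ l.+1 / m ^+ l.-1)) * long_bound s e d.-1 l.+1).
  by rewrite /layer -/b /c; move: (m ^+ l.-1)^-1 => im; ring.
have b0 : 0 <= b by rewrite ler0n.
have b1 : b <= 1 by rewrite /b; case: (_ < _)%N.
have T0 : 0 <= 2%:R * split_bound k d s e l.+1 + long_bound s e d.-1 l.+1 by rewrite addr_ge0// mulr_ge0.
have h0 := hf_ge0 l.+1.
have h1 : mu ^+ l / m ^+ l.-1 * (c + b * (2%:R * split_bound k d s e l.+1 + long_bound s e d.-1 l.+1))
   <= A * (16%:R * hf ^+ l.+1) * (c + (2%:R * split_bound k d s e l.+1 + long_bound s e d.-1 l.+1)).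
  apply: ler_pM; [exact: (divr_ge0 (exprn_ge0 _ mu0) (exprn_ge0 _ (ltW m0)))| |exact: scale_main|].
    exact: (addr_ge0 c0 (mulr_ge0 b0 T0)).
  by rewrite lerD2l ler_piMl.
have h2 : b * (mu ^+ l.+1 / m ^+ l.-1) * long_bound s e d.-1 l.+1
   <= A ^+ 2 * (64%:R * hf ^+ l.+1) * long_bound s e d.-1 l.+1.
  rewrite ler_wpM2r// /b; have [l14|_] := ltnP 14 l.+1; last first.
    by rewrite mul0r (mulr_ge0 (exprn_ge0 _ A0))// mulr_ge0.
  rewrite mul1r; apply: scale_rest; rewrite ltnS in l14; exact: leq_trans l14.
have g1 := pairing_sum_le Rt l.
apply: (@le_trans _ _ ((l + 4)%:R / 4%:R *
  (A * (16%:R * hf ^+ l.+1) * (c + (2%:R * split_bound k d s e l.+1 + long_bound s e d.-1 l.+1))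
   + A ^+ 2 * (64%:R * hf ^+ l.+1) * long_bound s e d.-1 l.+1))).
  apply: ler_pM => //; [|apply: addr_ge0|exact: lerD].
  - apply: sumr_ge0 => i _; exact: (divr_ge0 (exprn_ge0 _ (ler0n _ _)) (ler0n _ _)).
  - apply: (mulr_ge0 (divr_ge0 (exprn_ge0 _ mu0) (exprn_ge0 _ (ltW m0)))).
    exact: (addr_ge0 c0 (mulr_ge0 b0 T0)).
  - apply: (mulr_ge0 (mulr_ge0 b0 _) N0).
    exact: (divr_ge0 (exprn_ge0 _ mu0) (exprn_ge0 _ (ltW m0))).
rewrite le_eqVlt; apply/orP; left; apply/eqP.
have -> : (l.+1 + 3)%:R = (l + 4)%:R :> Rt by rewrite addSnnS.
move: (split_bound _ _ _ _ _) ((l + 4)%:R : Rt) (hf ^+ _) (long_bound _ _ _ _) A => S g h N A'; field => //.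
Qed.

(** With X = x3^(d-1) the linear part is 4 * (17 + 2 + 2) = 84 times A X. The [long_bound] parts 32
    A X^2 and 128 (A X)^2 add at most 32 and, by the smallness assumption, 128 / 126, so the total
    stays below 126 = 14 * 9. *)
Lemma layers_le L : 126%:R * (A * x3 ^+ d.-1) <= 1 ->
  \sum_(l < L) pairing_sum Rt l / m ^+ l.-1 * layer l <= 126%:R * (A * x3 ^+ d.-1).
Proof.
move=> small; have x0 : 0 <= x3 := x3_ge0 Rt k.
have A0 : 0 <= A := mulr_ge0 mu0 (exprn_ge0 _ y_ge0).
have xd0 : 0 <= x3 ^+ d.-1 := exprn_ge0 _ x0.
pose F l := (sub_coef_last l + small_coef l) * x3 ^+ d.-1 + 2%:R * split_bound k d s e l + long_bound s e d.-1 l.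
have N0 l : 0 <= long_bound s e d.-1 l := long_bound_ge0 s e0 d.-1 l.
have F0 l : 0 <= F l.
  apply: (addr_ge0 (addr_ge0 _ (mulr_ge0 (ler0n _ _) (split_bound_ge0 k d s e0 l))) (N0 l)).
  exact: (mulr_ge0 (addr_ge0 (sub_coef_last_ge0 _ l) (small_coef_ge0 _ l)) xd0).
have up G : (forall l, 0 <= G l) ->
    \sum_(l < L) (l.+1 + 3)%:R * hf ^+ l.+1 * G l.+1 <= wsum L.+1 G.
  by move=> G0; rewrite /wsum big_ord_recl lerDr !mulr_ge0 ?hf_ge0.
apply: (@le_trans _ _ (4%:R * A * wsum L.+1 F + 16%:R * A ^+ 2 * wsum L.+1 (long_bound s e d.-1))).
  apply: (le_trans (ler_sum (index_enum _) (fun (l : (ordinal L)) _ => layer_le l))).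
  rewrite big_split -!mulr_sumr /=; apply: lerD.
    exact: (ler_wpM2l (mulr_ge0 (ler0n _ _) A0) (up F F0)).
  exact: (ler_wpM2l (mulr_ge0 (ler0n _ _) (exprn_ge0 _ A0)) (up _ N0)).
have x1 : x3 <= 1 by have := x3_le; move: x3 => z; lra.
have wN : wsum L.+1 (long_bound s e d.-1) <= 8%:R * (x3 ^+ d.-1) ^+ 2.
  apply: le_trans (wsum_long_bound L.+1 d.-1) _; rewrite ler_wpM2l// -exprM mulnC exprM.
  by rewrite lerXn2r ?nnegrE ?te_ge0 ?exprn_ge0.
have xx : x3 ^+ d.-1 <= x3.
  by rewrite -{1}(prednK (_ : 0 < d.-1)%N) ?exprS ?ler_piMr ?exprn_ile1// -ltnS prednK// ltnW.
have wF : wsum L.+1 F <= 17%:R * x3 ^+ d.-1 + 2%:R * x3 ^+ d.-1 + 2%:R * x3 ^+ d.-1 + 8%:R * (x3 ^+ d.-1) ^+ 2.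
  rewrite /F !wsumD wsumZ; apply: lerD wN; apply: lerD; last first.
    by rewrite ler_wpM2l// wsum_split_bound.
  have -> : wsum L.+1 (fun l => (sub_coef_last l + small_coef l) * x3 ^+ d.-1)
     = x3 ^+ d.-1 * (wsum L.+1 sub_coef_last + wsum L.+1 small_coef).
    by rewrite -wsumD -wsumZ; apply: eq_bigr => l _; congr (_ * _); rewrite mulrC.
  rewrite [leLHS]mulrC -mulrDl ler_wpM2r//.
  exact: (lerD (wsum_sub_coef_last L.+1) (wsum_small_coef L.+1)).
have x256 := x3_le.
set X := x3 ^+ d.-1 in xd0 small wN wF xx *; have A2 : 0 <= A ^+ 2 := exprn_ge0 _ A0.
have q1 : 4%:R * A * wsum L.+1 F <= 4%:R * A * (21%:R * X + 8%:R * X ^+ 2).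
  apply: (ler_wpM2l (mulr_ge0 (ler0n _ _) A0)); apply: (le_trans wF).
  by rewrite lerD2r -!mulrDl -!natrD.
have q2 : 16%:R * A ^+ 2 * wsum L.+1 (long_bound s e d.-1) <= 16%:R * A ^+ 2 * (8%:R * X ^+ 2).
  exact: (ler_wpM2l (mulr_ge0 (ler0n _ _) A2) wN).
apply: (le_trans (lerD q1 q2)).
have X1 : X <= 1 := le_trans xx x1.
have r1 : A * X ^+ 2 <= A * X by rewrite ler_wpM2l// expr2 ler_piMl.
have AX0 : 0 <= A * X by rewrite mulr_ge0.
have r2 : A ^+ 2 * X ^+ 2 * 126%:R <= A * X.
  have -> : A ^+ 2 * X ^+ 2 * 126%:R = A * X * (126%:R * (A * X)) by ring.
  exact: ler_piMr.
have -> : 4%:R * A * (21%:R * X + 8%:R * X ^+ 2) + 16%:R * A ^+ 2 * (8%:R * X ^+ 2)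
  = 84%:R * (A * X) + 32%:R * (A * X ^+ 2) + 128%:R * (A ^+ 2 * X ^+ 2) by ring.
move: (A * X ^+ 2) (A ^+ 2 * X ^+ 2) (A * X) r1 r2 AX0 => u v w r1 r2 AX0; lra.
Qed.

End Bounds.

End WithField.

(** * The union bound *)

Section PairUp.
Variable X : eqType.
Implicit Type q : seq X.

Fixpoint pairup (q : seq X) : seq (X * X) :=
  if q is x :: q1 then (if q1 is y :: q' then (x, y) :: pairup q' else [::]) else [::].

Lemma pairup_ind (P : seq X -> Prop) : P [::] -> (forall x, P [:: x]) ->
  (forall x y q, P q -> P (x :: y :: q)) -> forall q, P q.
Proof.
move=> P0 P1 P2 q; elim/ltn_ind: {q}(size q) {-2}q (erefl (size q)) => m IH [|x [|y q]] // e.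
by apply: P2; apply: (IH (size q)); rewrite // -e /= leqW.
Qed.

Lemma size_pairup q : size (pairup q) = (size q)./2.
Proof. by elim/pairup_ind: q => //= x y q ->. Qed.

Lemma unpair_pairup q : subseq (unpair (pairup q)) q.
Proof. by elim/pairup_ind: q => //= x y q IH; rewrite !eqxx. Qed.

Lemma alternating_pairup (A : eqType) (f g : X -> A) q : alternating f g q -> all (fun p => f p.1 == f p.2) (pairup q).
Proof.
elim/pairup_ind: q => //= x y q IH; case: q IH => [|z q] IH /andP [-> //=].
by case/andP => _ /IH.
Qed.

End PairUp.

(** A path of t keys has t - 1 links, alternately of the first and the second kind; [b] even keys
    give b / 2 coincidences of either kind. *)
Lemma half_bound b t : ~~ odd b -> ((b + t).-1 <= b./2 + t./2 + (b./2 + t.-1./2))%N.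
Proof.
move=> o; have := odd_double_half b; rewrite (negPf o).
have := odd_double_half t; have := odd_double_half t.-1; lia.
Qed.

Section WithField.
Variable Rt : realFieldType.
Local Notation Ex := (@Ex Rt _).

Section Psi.
Variables (k r N : nat) (X : finType) (sq : X -> seq (bits k)).
Let TT := {ffun 'I_N -> {ffun bits k -> bits r}}.
Local Notation kv0 := (shifted_stab sq (fun=> 0)).
Local Notation m := (#|bits r|%:R : Rt).

Definition psi_event (Yl P : seq X) (z : X) (T : TT * TT) : bool :=
  [&& even_values (kv0 T.1) [set x in Yl], even_values (kv0 T.2) [set x in Yl] &
      alternating (kv0 T.1) (kv0 T.2) (rcons P z)].

(** The links in the first table are the pairs of [pairup P], those in the second the pairs of
    [pairup (behead P)], and the tables are independent. The link to [z] is left out because [z]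
    depends on the other keys. *)
Lemma psi_prob Yl P z : uniq (Yl ++ P) -> ~~ dep sq N [set x in Yl ++ P] ->
  Ex (fun T => (psi_event Yl P z T)%:R) <= (npair (size Yl))%:R ^+ 2 / m ^+ (size (Yl ++ P)).-1.
Proof.
move=> u nd; move: (u); rewrite cat_uniq => /and3P [uY /hasPn dYP uP].
have m1 : 1 <= m by rewrite ler1n; apply/card_gt0P; exists 0.
pose ev (Ms : seq (X * X)) (T : TT) :=
  even_values (kv0 T) [set x in Yl] && all (fun p => kv0 T p.1 == kv0 T p.2) Ms.
have pr Ms : subseq (unpair Ms) P ->
    Ex (fun T => (ev Ms T)%:R) <= (npair (size Yl))%:R / m ^+ ((size Yl)./2 + size Ms).
  move=> sP; have cY : #|[set x in Yl]| = size Yl by rewrite cardsE; apply/card_uniqP.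
  rewrite -cY; apply: (even_pairs_prob _ _ (subseq_uniq sP uP) _ _ _ nd).
  - by move=> x /(mem_subseq sP) /dYP; rewrite inE.
  - by move=> x /(mem_subseq sP) xP; rewrite inE mem_cat xP orbT.
  - by apply/subsetP => x; rewrite !inE mem_cat => ->.
apply: (@le_trans _ _ (Ex (fun T => (ev (pairup P) T)%:R) * Ex (fun T => (ev (pairup (behead P)) T)%:R))).
  rewrite Ex_pair -ExZr; apply: Ex_le => T1; rewrite -ExZ; apply: Ex_le => T2.
  rewrite -natrM mulnb ler_nat; case: (boolP (psi_event _ _ _ _)) => // /and3P [e1 e2 al].
  have aP : alternating (kv0 T1) (kv0 T2) P by have := alternating_take (size P) al; rewrite -cats1 take_size_cat.
  rewrite lt0b /ev e1 e2 (alternating_pairup aP) /=.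
  by case: (P) aP => //= x q /andP [_ /alternating_pairup].
have b1 := pr _ (unpair_pairup P).
have sb : subseq (behead P) P by case: (P) => //= x q; apply: subseq_cons.
have b2 := pr _ (subseq_trans (unpair_pairup _) sb).
apply: le_trans (ler_pM (Pr_ge0 _ _) (Pr_ge0 _ _) b1 b2) _.
have [o|o] := boolP (odd (size Yl)); first by rewrite npair_odd// expr0n !mul0r.
rewrite mulrACA -expr2 ler_wpM2l ?exprn_ge0// -invfM -exprD.
rewrite lef_pV2 ?posrE ?exprn_gt0 ?(lt_le_trans ltr01)//; apply: ler_weXn2l => //.
rewrite !size_pairup size_cat size_behead.
exact: half_bound.
Qed.

End Psi.

Section Model.
Variables (k k' r c d : nat) (Q : {set key k c}) (f : selector k r c Q).
Hypotheses (hk : (8 <= k)%N) (hc : (0 < c)%N) (hd : (1 < d)%N).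
Local Notation keyt := (key k c).
Local Notation N := (c + d - 2)%N.
Implicit Types (w : Omega k k' r c d).

Local Notation sqw w := (dseq w.1.1).
Local Notation fw w := (shifted_stab (dseq w.1.1) (fun=> 0) w.1.2.1).
Local Notation gw w := (shifted_stab (dseq w.1.1) (fun=> 0) w.1.2.2).

Lemma hashE w x : hash w x = hash_value (sqw w) (fw w) (gw w) w.2 x.
Proof.
rewrite /hash /hash_value /shifted_stab !add0r /=; congr (_ + _ + _); apply: eq_stab => p pN.
rewrite (nth_map (Ordinal pN)) ?size_enum_ord// ffunE.
by rewrite nth_enum_ord.
Qed.

Lemma dkey_inj w : injective (dkey w).
Proof.
move=> x y [e _ _]; apply: (@dseq_inj _ _ _ hc hd w.1.1) => p pc.
have pN : (p < N)%N by apply: leq_trans pc _; lia.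
by move/ffunP/(_ (Ordinal pN)): e; rewrite !ffunE.
Qed.

Lemma lin_dep_full_zero w (S : {set keyt}) : lin_dep [set dkey w x | x in S] ->
  exists Z : {set keyt}, [/\ Z \subset S, Z != set0 & full_zero N (sqw w) (fw w) (gw w) Z].
Proof.
case/existsP => Y /and5P [YS Y0 /forallP e1 /forallP e2 /forallP e3].
pose Z := [set x in S | dkey w x \in Y].
have card (F : dkey_t k k' c d -> bool) : #|[set x in Z | F (dkey w x)]| = #|[set y in Y | F y]|.
  rewrite -(card_imset _ (@dkey_inj w)); apply: eq_card => y; rewrite !inE.
  apply/imsetP/andP => [[x]|[yY Fy]].
    by rewrite !inE => /andP [/andP [_ xY] Fx] ->.
  have /imsetP [x xS yE] := subsetP YS y yY.
  by exists x; rewrite // !inE xS -yE yY.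
exists Z; split.
- by apply/subsetP => x; rewrite inE => /andP [].
- have /set0Pn [y yY] := Y0; have /imsetP [x xS yE] := subsetP YS y yY.
  by apply/set0Pn; exists x; rewrite inE xS -yE.
apply/and3P; split.
- apply/forallP => p; apply/forallP => a.
  rewrite -(eq_card (_ : [set x in Z | (dkey w x).1 p == a] =i _)) => [|x]; last first.
    by rewrite !inE ffunE.
  by rewrite (card (fun y => y.1 p == a)); apply: (forallP (e1 p)).
- apply/forallP => a.
  rewrite -(eq_card (_ : [set x in Z | (dkey w x).2.1 == a] =i _)) => [|x]; last first.
    by rewrite !inE /shifted_stab add0r.
  by rewrite (card (fun y => y.2.1 == a)).
- apply/forallP => a.
  rewrite -(eq_card (_ : [set x in Z | (dkey w x).2.2 == a] =i _)) => [|x]; last first.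
    by rewrite !inE /shifted_stab add0r.
  by rewrite (card (fun y => y.2.2 == a)).
Qed.

(** A single sequence carries both parts, the even set in its first [b] entries and the path in the
    rest, so that the union bound runs over sequences. *)
Definition certified w (ys : seq keyt) (b : nat) (z : keyt) : bool :=
  [&& uniq (rcons ys z), certificate N (sqw w) (fw w) (gw w) (take b ys) (drop b ys) z,
      [set x in rcons ys z] \subset selected f w &
      indep_mod N (sqw w) (fw w) (gw w) Q ([set x in rcons ys z] :\: Q)
      || zero_set (sqw w) N [set x in rcons ys z] && indep_mod N (sqw w) (fw w) (gw w) Q ([set x in ys] :\: Q)].

Lemma certified_exists w : Q \subset selected f w -> lin_dep [set dkey w x | x in selected f w] ->
  exists Yl P z, forall Y, perm_eq Y Yl -> certified w (Y ++ P) (size Yl) z.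
Proof.
move=> QS /lin_dep_full_zero [Z [ZS Z0 fZ]].
have [Yl [P [z [ce sub ind]]]] := top_exists QS ZS Z0 fZ.
exists Yl, P, z => Y YYl; have eY : Y =i Yl := perm_mem YYl.
have e1 : [set x in Y] = [set x in Yl] by apply/setP => x; rewrite !inE eY.
have e2 R : [set x in Y ++ R] = [set x in Yl ++ R] by apply/setP => x; rewrite !inE !mem_cat eY.
have u : uniq (rcons (Y ++ P) z).
  rewrite rcons_cat (perm_uniq (perm_cat YYl (perm_refl _))).
  by case/and5P: ce.
rewrite /certified u -(perm_size YYl) take_size_cat// drop_size_cat// rcons_cat !e2 ind andbT /=.
have u' : uniq (Y ++ rcons P z) by rewrite -rcons_cat.
move: ce; rewrite /certificate e1 !e2 u' => /andP [_ ->] /=.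
by apply/subsetP => x; rewrite inE => /sub.
Qed.

Lemma ler_sum_seq (T : eqType) (s1 s2 : seq T) (F : T -> Rt) :
  uniq s1 -> uniq s2 -> {subset s1 <= s2} -> (forall x, 0 <= F x) ->
  \sum_(x <- s1) F x <= \sum_(x <- s2) F x.
Proof.
move=> u1 u2 sub F0; rewrite [leRHS](bigID (mem s1)) /= -[X in _ <= X + _]big_filter.
rewrite (perm_big (filter (mem s1) s2)); first by rewrite lerDl sumr_ge0.
apply: uniq_perm; rewrite ?filter_uniq// => x; rewrite mem_filter /=.
by case: (boolP (x \in s1)) => // /sub ->.
Qed.

Lemma certified_count w : Q \subset selected f w -> lin_dep [set dkey w x | x in selected f w] ->
  1 <= \sum_(l < #|{: keyt}|.+1) \sum_(0 <= b < l.+1) (b`!)%:R^-1 *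
         \sum_(ys <- seqs keyt l) \sum_z (certified w ys b z)%:R :> Rt.
Proof.
move=> QS /(certified_exists QS) [Yl [P [z hc']]].
pose b := size Yl; have := hc' _ (perm_refl Yl).
rewrite /certified => /and4P [u _ _ _]; pose l := size (Yl ++ P).
have lL : (l < #|{: keyt}|.+1)%N.
  by rewrite ltnS /l -(card_uniqP (subseq_uniq (subseq_rcons _ _) u)) max_card.
have bl : (b <= l)%N by rewrite /l size_cat leq_addr.
have F0 l' b' : 0 <= (b'`!)%:R^-1 * \sum_(ys <- seqs keyt l') \sum_z (certified w ys b' z)%:R :> Rt.
  by rewrite mulr_ge0 ?invr_ge0// sumr_ge0// => ys _; apply: sumr_ge0.
rewrite (bigD1 (Ordinal lL))//= big_mkord (bigD1 (Ordinal (bl : (b < l.+1)%N)))//=.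
rewrite -addrA; apply: ler_wpDr.
  by apply: addr_ge0; apply: sumr_ge0 => // l' _; apply: sumr_ge0.
rewrite ler_pdivlMl ?ltr0n ?fact_gt0// mulr1.
have uYl : uniq Yl by move: u; rewrite rcons_cat cat_uniq => /andP [].
have inj : injective (fun Y : seq keyt => Y ++ P).
  move=> Y1 Y2 e; have := congr1 (take (size Y1)) e; rewrite take_size_cat//.
  have -> : size Y1 = size Y2 by have := congr1 size e; rewrite !size_cat => /addIn.
  by rewrite take_size_cat.
apply: (@le_trans _ _ (\sum_(ys <- [seq Y ++ P | Y <- permutations Yl]) \sum_z (certified w ys b z)%:R)).
  rewrite big_map -(size_permutations uYl) -sum1_size natr_sum.
  rewrite big_seq [leRHS]big_seq; apply: ler_sum => Y; rewrite mem_permutations => YY.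
  by rewrite (bigD1 z)//= hc'// lerDl sumr_ge0.
apply: ler_sum_seq; rewrite ?uniq_seqs ?map_inj_uniq ?permutations_uniq//.
  move=> ys /mapP [Y]; rewrite mem_permutations mem_seqs => YY ->.
  by rewrite size_cat (perm_size YY) /l size_cat.
by move=> ys; apply: sumr_ge0.
Qed.

Variable p : keyt -> Rt.
Hypotheses (p0 : forall x, 0 <= p x) (p1 : forall x, p x <= 1).
Hypothesis pQ : forall x, x \in Q -> p x = 1.
Hypothesis hp : forall x phi, Ex (fun u : bits r => (f x u phi)%:R) <= p x.
Local Notation m := (#|bits k'|%:R : Rt).

(** Query keys have probability 1, so restricting to keys outside [Q] loses nothing. *)
Lemma weight_setD xs : uniq xs -> \prod_(x in [set x in xs] :\: Q) p x = weight p xs.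
Proof.
move=> u; rewrite /weight (big_uniq _ u) /= [RHS](bigID (mem Q)) /=.
rewrite [X in _ = X * _]big1 ?mul1r => [|x /andP [_ /pQ]//].
by apply: eq_bigl => x; rewrite !inE andbC.
Qed.

Lemma selected_prob (M : {set keyt}) (H : htil_tables k c d) (PP : psi_tables k k' c d) :
  M :&: Q = set0 ->
  Ex (fun hh : hhat_tables k k' r c d =>
     (indep_mod N (sqw (H, PP, hh)) (fw (H, PP, hh)) (gw (H, PP, hh)) Q M
      && (M \subset selected f (H, PP, hh)))%:R) <=
  \prod_(x in M) p x.
Proof.
move=> MQ; set g1 := shifted_stab (dseq H) (fun=> 0) PP.1; set g2 := shifted_stab (dseq H) (fun=> 0) PP.2.
have [ind|_] := boolP (indep_mod N (dseq H) g1 g2 Q M); last first.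
  apply: Ex_le_const => [|hh] //=; exact: prodr_ge0.
apply: le_trans (hash_prob MQ ind hp); apply: Ex_le => hh /=; rewrite ler_nat.
case: (boolP (M \subset _)) => // /subsetP MS; rewrite lt0b; apply/forall_inP => x /MS.
rewrite inE hashE /=; congr (f x _ _).
by apply/ffunP => q; rewrite !ffunE hashE.
Qed.

(** The tables are exposed in the order of evaluation: Sigma, then Psi, then final hash. The later
    conditional bounds do not depend on what was exposed before, so the factors multiply. The two
    summands are the two alternatives in [certified]. *)
Lemma certified_prob (ys : seq keyt) (b : nat) (z : keyt) : (b <= size ys)%N -> uniq (rcons ys z) ->
  Ex (fun w => (certified w ys b z)%:R) <=
  (npair b)%:R ^+ 2 / m ^+ (size ys).-1 *
   (weight p (rcons ys z) * (small_sum_last Rt ys z * (3%:R / #|bits k|%:R) ^+ d.-1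
        + (14 < (size ys).+1)%N%:R * tail_bound d (3 * k - 8) (split_cost Rt k) (rcons ys z))
    + weight p ys * ((key_sum0 [set x in rcons ys z])%:R *
       (small_coef (size ys).+1 * (3%:R / #|bits k|%:R) ^+ d.-1
        + (14 < (size ys).+1)%N%:R * tail_bound d (3 * k - 8) (split_cost Rt k) (rcons ys z)))).
Proof.
move=> bs u; set Psi := _ / _.
have uy : uniq ys by move: u; rewrite rcons_uniq => /andP [].
have bq : size (take b ys) = b by rewrite size_takel.
have Psi0 : 0 <= Psi := divr_ge0 (exprn_ge0 _ (ler0n _ _)) (exprn_ge0 _ (ler0n _ _)).
have wr : 0 <= weight p (rcons ys z) by apply: weight_ge0.
have wy : 0 <= weight p ys by apply: weight_ge0.
pose A1 (H : htil_tables k c d) := ~~ dep (dseq H) N [set x in ys] && dep (dseq H) N [set x in rcons ys z].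
pose A2 (H : htil_tables k c d) := ~~ dep (dseq H) N [set x in ys] && zero_set (dseq H) N [set x in rcons ys z].
have key1 := top_dep hk hc hd (split_cost_ge0 Rt k) (split_cost_prob Rt hk hc hd) ys z.
have key2 := top_full hk hc hd (split_cost_ge0 Rt k) (split_cost_prob Rt hk hc hd) u.
apply: (@le_trans _ _ (Psi * (weight p (rcons ys z) * Ex (fun H => (A1 H)%:R) + weight p ys * Ex (fun H => (A2 H)%:R)))); last first.
  by apply: (ler_wpM2l Psi0); apply: lerD; [exact: (ler_wpM2l wr key1) | exact: (ler_wpM2l wy key2)].
rewrite -!ExZ -ExD -ExZ 2!Ex_pair; apply: Ex_le => H.
set W := weight p (rcons ys z) * _ + _.
have W0 : 0 <= W by rewrite addr_ge0 ?mulr_ge0.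
have E1 : take b ys ++ drop b ys = ys := cat_take_drop b ys.
have E2 : take b ys ++ rcons (drop b ys) z = rcons ys z by rewrite -rcons_cat E1.
have [nd|nd] := boolP (~~ dep (dseq H) N [set x in ys]); last first.
  apply: Ex_le_const => [|PP]; first exact: mulr_ge0.
  apply: Ex_le_const => [|hh]; first exact: mulr_ge0.
  by rewrite /certified /certificate E1 (negPf nd) !andbF /= mulr_ge0.
have := @psi_prob k k' N keyt (dseq H) (take b ys) (drop b ys) z.
rewrite E1 bq => /(_ uy nd) hpsi.
apply: (@le_trans _ _ (Ex (fun PP : psi_tables k k' c d => (psi_event (dseq H) (take b ys) (drop b ys) z PP)%:R * W))); last first.
  by rewrite ExZr ler_wpM2r.
apply: Ex_le => PP.
have dis (V : {set keyt}) : (V :\: Q) :&: Q = set0 by apply/setP => x; rewrite !inE; case: (x \in Q); rewrite ?andbF.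
have s1 := selected_prob H PP (dis [set x in rcons ys z]).
have s2 := selected_prob H PP (dis [set x in ys]).
rewrite weight_setD// in s1; rewrite weight_setD// in s2.
have yr : [set x in ys] :\: Q \subset [set x in rcons ys z].
  by apply/subsetP => x; rewrite !inE mem_rcons inE => /andP [_ ->]; rewrite orbT.
set B := psi_event _ _ _ _ _.
apply: (@le_trans _ _ (Ex (fun hh => B%:R * ((A1 H)%:R * (indep_mod N (sqw (H, PP, hh)) (fw (H, PP, hh)) (gw (H, PP, hh)) Q ([set x in rcons ys z] :\: Q)
      && ([set x in rcons ys z] :\: Q \subset selected f (H, PP, hh)))%:R
  + (A2 H)%:R * (indep_mod N (sqw (H, PP, hh)) (fw (H, PP, hh)) (gw (H, PP, hh)) Q ([set x in ys] :\: Q)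
      && ([set x in ys] :\: Q \subset selected f (H, PP, hh)))%:R)))); last first.
  rewrite ExZ ler_wpM2l// ExD !ExZ /W ![_ * (A1 H)%:R]mulrC ![_ * (A2 H)%:R]mulrC.
  by apply: lerD; rewrite ler_wpM2l.
apply: Ex_le => hh; rewrite -!natrM -natrD -natrM ler_nat !mulnb.
case: (boolP (certified _ _ _ _)) => // /and4P [_ ce sel ind].
move: ce; rewrite /certificate E1 E2 => /and5P [_ e1 e2 al /andP [n1 n2]].
have -> : B = true by apply/and3P.
rewrite mul1n /A1 /A2 n1 n2.
rewrite (subset_trans (subsetDl _ _) sel) (subset_trans yr sel) !andbT.
by case/orP: ind => [->|/andP [-> ->]]; rewrite ?addn1.
Qed.

Local Notation mu := (\sum_x p x).
Local Notation layer := (layer k (3 * k - 8) (split_cost Rt k) d mu).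

Lemma lin_dep_union : (forall w, Q \subset selected f w) ->
  Ex (fun w => (lin_dep [set dkey w x | x in selected f w])%:R)
  <= \sum_(l < #|{: keyt}|.+1) pairing_sum Rt l / m ^+ l.-1 * layer l.
Proof.
move=> hQ; apply: (@le_trans _ _ (Ex (fun w => \sum_(l < #|{: keyt}|.+1) \sum_(0 <= b < l.+1) (b`!)%:R^-1 *
         \sum_(ys <- seqs keyt l) \sum_z (certified w ys b z)%:R))).
  apply: Ex_le => w; case: (boolP (lin_dep _)) => [h|_]; first exact: certified_count.
  apply: sumr_ge0 => l _; apply: sumr_ge0 => b _.
  by rewrite mulr_ge0 ?invr_ge0// sumr_ge0// => ys _; apply: sumr_ge0.
rewrite Ex_sum; apply: ler_sum => l _; rewrite Ex_sum.
have mi : 0 <= (m ^+ l.-1)^-1 by rewrite invr_ge0 exprn_ge0.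
rewrite /pairing_sum !mulr_suml big_nat_cond [leRHS]big_nat_cond; apply: ler_sum => b.
rewrite andbT => /= bl; rewrite ExZ.
have -> : (npair b)%:R ^+ 2 / b`!%:R / m ^+ l.-1 * layer l
  = b`!%:R^-1 * ((npair b)%:R ^+ 2 / m ^+ l.-1 * layer l).
  by move: (m ^+ l.-1)^-1 => im; rewrite (mulrC (_ ^+ 2)) -!mulrA.
rewrite ler_wpM2l ?invr_ge0// Ex_sum.
have K0 : 0 <= (npair b)%:R ^+ 2 / m ^+ l.-1 by rewrite mulr_ge0 ?exprn_ge0.
apply: le_trans (ler_wpM2l K0 (lerD (sum_top_dep hk hc hd (3 * k - 8) (split_cost_ge0 Rt k) p0 p1 l)
   (sum_top_full d (3 * k - 8) (split_cost_ge0 Rt k) p0 l))).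
rewrite -big_split mulr_sumr big_seq [leRHS]big_seq; apply: ler_sum => ys.
rewrite mem_seqs => /eqP hl; rewrite Ex_sum -big_split mulr_sumr [leRHS]big_mkcond.
apply: ler_sum => z _; case: (boolP (uniq (rcons ys z))) => [u|/negPf nu]; last first.
  by apply: Ex_le_const => // w; rewrite /certified nu.
by have := @certified_prob ys b z; rewrite hl; apply.
Qed.

End Model.

End WithField.

Lemma p_sel_le1 (k r c : nat) (Q : {set key k c}) (f : selector k r c Q) x : p_sel f x <= 1.
Proof. by apply: bigmax_le => // phi _; rewrite /Pr PrE Pr_le1. Qed.

Lemma p_sel_ge0 (k r c : nat) (Q : {set key k c}) (f : selector k r c Q) x : 0 <= p_sel f x.
Proof. exact: bigmax_ge_id. Qed.

Lemma p_sel_ge (k r c : nat) (Q : {set key k c}) (f : selector k r c Q) x phi :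
  Ex (fun u : bits r => (f x u phi)%:R) <= p_sel f x.
Proof. by rewrite -PrE; apply: (le_bigmax _ (fun phi => Pr (fun u : bits r => f x u phi))). Qed.

Theorem theorem5p1 (k k' r c d : nat) (Q : {set key k c}) (f : selector k r c Q) :
  (8 <= k)%N -> (1 <= c)%N -> (2 <= d)%N ->
  (forall (q : key k c) (rr : bits r) phi, q \in Q -> f q rr phi) ->
  mu_sel f <= #|bits k'|%:R / 2 ->
  Pr (fun w : Omega k k' r c d =>
        lin_dep [set dkey w x | x in selected f w])
  <= 14%:R * mu_sel f ^+ 3 * (3%:R / #|bits k'|%:R) ^+ 2
       * (3%:R / #|bits k|%:R) ^+ d.-1
     + (2%:R ^+ (#|bits k| %/ 2))^-1.
Proof.
move=> hk hc hd hQ hmu; rewrite /Pr PrE.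
have pQ x : x \in Q -> p_sel f x = 1.
  move=> xQ; apply/eqP; rewrite eq_le p_sel_le1 /=; apply: le_trans (p_sel_ge f x 0).
  rewrite -[leLHS](Ex_const (T := bits r) 1 0); apply: Ex_le => u; by rewrite hQ.
have m0 : 0 < #|bits k'|%:R :> rat by rewrite ltr0n; apply/card_gt0P; exists 0.
have mu0 : 0 <= mu_sel f by apply: sumr_ge0 => x _; apply: p_sel_ge0.
set m : rat := #|bits k'|%:R in m0 hmu *; set mu := mu_sel f in mu0 hmu *.
apply: ler_wpDr; first by rewrite invr_ge0 exprn_ge0.
have -> : 14%:R * mu ^+ 3 * (3%:R / m) ^+ 2 * (3%:R / #|bits k|%:R) ^+ d.-1
  = 126%:R * (mu * (mu / m) ^+ 2 * (3%:R / #|bits k|%:R) ^+ d.-1).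
  by rewrite -[126%N]/(14 * 9)%N; field; rewrite lt0r_neq0.
(* A bound above 1 is trivial; otherwise the terms quadratic in it are under control. *)
have [small|large] := lerP (126%:R * (mu * (mu / m) ^+ 2 * (3%:R / #|bits k|%:R) ^+ d.-1)) 1; last first.
  exact: le_trans (Pr_le1 _ _) (ltW large).
apply: le_trans (lin_dep_union hk hc hd (@p_sel_ge0 _ _ _ _ f) (@p_sel_le1 _ _ _ _ f) pQ (@p_sel_ge _ _ _ _ f) _) _.
  by move=> w; apply/subsetP => x xQ; rewrite inE hQ.
exact: (layers_le hk (split_cost_ge0 _ k) (split_shift_cost_le _ hk) hd m0 mu0 hmu _ small).
Qed.
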